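(* Let $E=A\#_fH$ be a crossed product and $M$ an $E$-bimodule. The cohomological Hochschild-Serre spectral sequence, i.e. the spectral sequence associated to the filtration $F_0(\mathrm{Hom}_k(\overline E^*,M))\supseteq F_1(\mathrm{Hom}_k(\overline E^*,M))\supseteq\cdots$ of the normalized Hochschild complex $(\mathrm{Hom}_k(\overline E^*,M),b^* )$, where $F_i(\mathrm{Hom}_k(\overline E^n,M))$ is the $k$-submodule of those $g\in\mathrm{Hom}_k(\overline E^n,M)$ for which $g(x_1\otimes\cdots\otimes x_n)=0$ whenever at least $n-i+1$ of the $x_j$'s belong to $A$, is isomorphic to the spectral sequence $$E_1^{rs}=H^r(A,\mathrm{Hom}_k(\overline H^s,M))\Rightarrow H^{r+s}(E,M)$$ associated to the filtration $F_i(\widehat X^n)=\bigoplus_{s\ge i}\mathrm{Hom}_k(\overline H^s\otimes\overline A^{n-s},M)$ of the cochain complex $\widehat X^*(E,M)$ defined in the context.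
   Context: $k$ is a commutative ring with unit, $\otimes=\otimes_k$, $H$ is a Hopf algebra with counit $\epsilon$ and Sweedler notation $\Delta(h)=h^{(1)}\otimes h^{(2)}$ (sum understood), $A$ is a $k$-algebra. A weak action of $H$ on $A$ is a bilinear map $(h,a)\mapsto a^h$, $H\times A\to A$, with $(ab)^h=a^{h^{(1)}}b^{h^{(2)}}$, $1^h=\epsilon(h)1$, $a^1=a$. Given a weak action and a $k$-linear map $f:H\otimes H\to A$, $A\#_fH$ is $A\otimes H$ (elements written $a\#h$) with product $(a\#h)(b\#l)=ab^{h^{(1)}}f(h^{(2)},l^{(1)})\#h^{(3)}l^{(2)}$; it is called a crossed product if it is associative with unit $1\#1$, equivalently: $f(h,1)=f(1,h)=\epsilon(h)1_A$; $f(l^{(1)},m^{(1)})^{h^{(1)}}f(h^{(2)},l^{(2)}m^{(2)})=f(h^{(1)},l^{(1)})f(h^{(2)}l^{(2)},m)$; and $(a^{l^{(1)}})^{h^{(1)}}f(h^{(2)},l^{(2)})=f(h^{(1)},l^{(1)})a^{h^{(2)}l^{(2)}}$ for all $h,l,m\in H$, $a\in A$. $A$ is regarded as the subalgebra $A\#1$ of $E$. Notation: $\overline B=B/k$ (classes denoted by the same letter), $\overline B^l$ its $l$-fold tensor power. $\mathbf h_{ij}=h_i\otimes\cdots\otimes h_j$, $\mathfrak h_{ij}=h_i\cdots h_j\in H$, $\mathbf a_{ij}=a_i\otimes\cdots\otimes a_j$ (empty tensors are $1_k$). For $\mathbf h=h_i\otimes\cdots\otimes h_j$: $\mathbf h^{(1)}\otimes\mathbf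 h^{(2)}=(h_i^{(1)}\otimes\cdots\otimes h_j^{(1)})\otimes(h_i^{(2)}\otimes\cdots\otimes h_j^{(2)})$; $a^{\overline{\mathbf h}}=(\cdots((a^{h_j})^{h_{j-1}})\cdots)^{h_i}$ for $a\in A$; and for $\mathbf a=a_1\otimes\cdots\otimes a_r$, $\mathbf a^{\overline{\mathbf h}}=a_1^{\overline{\mathbf h^{(1)}}}\otimes\cdots\otimes a_r^{\overline{\mathbf h^{(r)}}}$; for a single $h\in H$, $\mathbf a^h=a_1^{h^{(1)}}\otimes\cdots\otimes a_r^{h^{(r)}}$. $\mathrm{Hom}_k(\overline H^s,M)$ is an $A$-bimodule via $(a_1\varphi a_2)(\mathbf h)=a_1^{\overline{\mathbf h^{(1)}}}\varphi(\mathbf h^{(2)})a_2$. The maps $F^{(l)}_r$ ($l\ge2$, $r\ge0$), $F^{(l)}_r:\overline H^l\otimes\overline A^r\to\overline A^{r+l-1}$. For $r=0$: $F^{(2)}_0(h_1\otimes h_2)=-f(h_1,h_2)$ and $F^{(l+1)}_0(\mathbf h)=\sum_{j=1}^l(-1)^jf(h_j^{(1)},h_{j+1}^{(1)})^{\overline{\mathbf h_{1,j-1}^{(1)}}}\otimes F^{(l)}_0(\mathbf h_{1,j-1}^{(2)}\otimes h_j^{(2)}h_{j+1}^{(2)}\otimes\mathbf h_{j+2,l+1})$. For $r\ge1$: $F^{(2)}_r(\mathbf h\otimes\mathbf a)=\sum_{i=0}^r(-1)^{i+1}\mathbf a_{1i}^{\overline{\mathbf h_{12}^{(1)}}}\otimes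 f(h_1^{(2)},h_2^{(2)})\otimes\mathbf a_{i+1,r}^{\mathfrak h_{12}^{(3)}}$ and $F^{(l+1)}_r(\mathbf h\otimes\mathbf a)=\sum_{j=1}^l\sum_{i=0}^r(-1)^{il+j}\mathbf a_{1i}^{\overline{\mathbf h_{1,l+1}^{(1)}}}\otimes f(h_j^{(2)},h_{j+1}^{(2)})^{\overline{\mathbf h_{1,j-1}^{(2)}}}\otimes F^{(l)}_{r-i}\big((\mathbf h_{1,j-1}^{(3)}\otimes h_j^{(3)}h_{j+1}^{(3)}\otimes\mathbf h_{j+2,l+1}^{(2)})\otimes\mathbf a_{i+1,r}\big)$. The complex $\widehat X^*(E,M)$: $\widehat X^n=\bigoplus_{r+s=n}\mathrm{Hom}_k(\overline H^s\otimes\overline A^r,M)$ with differential $\widehat d^{\,n}=\sum_{r+s=n}\sum_{0\le l\le s,\,r+l>0}\widehat d^{\,rs}_l$, where $\widehat d^{\,rs}_l:\mathrm{Hom}_k(\overline H^{s-l}\otimes\overline A^{r+l-1},M)\to\mathrm{Hom}_k(\overline H^s\otimes\overline A^r,M)$ is, for $\mathbf x=\mathbf h\otimes\mathbf a$, $\mathbf h=h_1\otimes\cdots\otimes h_s$, $\mathbf a=a_1\otimes\cdots\otimes a_r$, $\widehat d^{\,rs}_0(\varphi)(\mathbf x)=a_1^{\overline{\mathbf h^{(1)}}}\varphi(\mathbf h^{(2)}\otimes\mathbf a_{2r})+(-1)^r\varphi(\mathbf h\otimes\mathbf a_{1,r-1})a_r+\sum_{i=1}^{r-1}(-1)^i\varphi(\mathbf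 h\otimes\mathbf a_{1,i-1}\otimes a_ia_{i+1}\otimes\mathbf a_{i+2,r})$; $\widehat d^{\,rs}_1(\varphi)(\mathbf x)=(-1)^r(1\#h_1)\varphi(\mathbf h_{2s}\otimes\mathbf a)+(-1)^{r+s}\varphi(\mathbf h_{1,s-1}\otimes\mathbf a^{h_s^{(1)}})(1\#h_s^{(2)})+\sum_{i=1}^{s-1}(-1)^{r+i}f(h_i^{(1)},h_{i+1}^{(1)})^{\overline{\mathbf h_{1,i-1}^{(1)}}}\varphi(\mathbf h_{1,i-1}^{(2)}\otimes h_i^{(2)}h_{i+1}^{(2)}\otimes\mathbf h_{i+2,s}\otimes\mathbf a)$; for $l\ge2$: $\widehat d^{\,rs}_l(\varphi)(\mathbf x)=(-1)^{l(r+s)}\varphi\big(\mathbf h_{1,s-l}\otimes F^{(l)}_r(\mathbf h_{s-l+1,s}^{(1)}\otimes\mathbf a)\big)(1\#\mathfrak h_{s-l+1,s}^{(2)})$. $H^*(B,N)$ denotes Hochschild cohomology. Spectral sequences are considered from the $E_1$ page on. *)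

(* Defs.v *)
From HB Require Import structures.
From mathcomp Require Import all_boot all_algebra.
From mathcomp Require Import boolp functions.

Set Implicit Arguments.
Unset Strict Implicit.
Unset Printing Implicit Defensive.

Import GRing.Theory.
Local Open Scope ring_scope.
Local Open Scope quotient_scope.

Section Submodules.
Context {k : comNzRingType}.

Record submod (V : lmodType k) (S : submodClosed V) :=
  Submod { submod_val : V; _ : submod_val \in S }.

HB.instance Definition _ V S := [isSub for @submod_val V S].
HB.instance Definition _ V S := [Choice of @submod V S by <:].
HB.instance Definition _ V S := [SubChoice_isSubLmodule of @submod V S by <:].

Section QuotientModule.
Variables (V : lmodType k) (S : submodClosed V).

(* MathComp quotients by a zmodClosed; a submodClosed is not one by inheritance
   because that structure is stated over semirings. *)
Definition zpred : {pred V} := [pred x | x \in S].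

Let zpredP : zmod_closed zpred.
Proof.
split=> [|x y]; rewrite !inE ?rpred0 // => Sx Sy.
by rewrite -scaleN1r rpredD // rpredZ.
Qed.
HB.instance Definition _ := GRing.isZmodClosed.Build V zpred zpredP.

Definition quotmod := Quotient.quot zpred.
HB.instance Definition _ : EqQuotient V (Quotient.equiv zpred) quotmod :=
  EqQuotient.on quotmod.
HB.instance Definition _ := GRing.Zmodule.on quotmod.

Definition qscale (a : k) : quotmod -> quotmod := lift_op1 quotmod ( *:%R a).

Lemma pi_qscale a : {morph \pi_quotmod : x / a *: x >-> qscale a x}.
Proof.
move=> x; unlock qscale; apply/eqP; rewrite piE Quotient.equivE -scalerBr.
suff: x - repr (\pi_quotmod x) \in zpred by rewrite !inE; exact: rpredZ.
by rewrite Quotient.idealrBE reprK.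
Qed.

Lemma pi_qadd : {morph \pi_quotmod : x y / x + y}.
Proof. by move=> x y; rewrite raddfD. Qed.

Let qscaleA a b v : qscale a (qscale b v) = qscale (a * b) v.
Proof. by elim/quotW: v => v; rewrite -!pi_qscale scalerA. Qed.
Let qscale1 : left_id 1 qscale.
Proof. by elim/quotW => v; rewrite -pi_qscale scale1r. Qed.
Let qscaleDr : right_distributive qscale +%R.
Proof.
move=> a; elim/quotW => u; elim/quotW => v.
by rewrite -pi_qadd -!pi_qscale -pi_qadd scalerDr.
Qed.
Let qscaleDl v : {morph qscale^~ v : a b / a + b}.
Proof.
by elim/quotW: v => v a b; rewrite -!pi_qscale -pi_qadd scalerDl.
Qed.

HB.instance Definition _ :=
  GRing.Zmodule_isLmodule.Build k quotmod qscaleA qscale1 qscaleDr qscaleDl.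

End QuotientModule.

(* The subquotient Z/B; B is not required to be contained in Z, so that this
   is Z/(Z `&` B) in general. *)
Section Subquotient.
Variables (V : lmodType k) (Z B : submodClosed V).

Definition subpred : {pred submod Z} := [pred x | val x \in B].

Let subpredP : GRing.subsemimod_closed subpred.
Proof.
split; first by split=> [|x y]; rewrite !inE ?raddf0 ?rpred0 // raddfD; exact: rpredD.
by move=> a x; rewrite !inE linearZ; exact: rpredZ.
Qed.
HB.instance Definition _ := GRing.isSubmodClosed.Build k (submod Z) subpred subpredP.

Definition subquo : lmodType k := quotmod subpred.

Definition subcls (x : V) (Zx : x \in Z) : subquo :=
  \pi_(quotmod subpred) (Submod Zx).

Lemma subclsP x y (Zx : x \in Z) (Zy : y \in Z) :
  reflect (subcls Zx = subcls Zy) (x - y \in B).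
Proof. by apply: (iffP idP) => [xy|/eqP]; [apply/eqP|]; rewrite piE. Qed.

Lemma subcls_repr (c : subquo) : subcls (valP (repr c)) = c.
Proof.
rewrite -[RHS]reprK; congr (\pi_(quotmod subpred) _); exact: val_inj.
Qed.

End Subquotient.

End Submodules.

Section Tensor.
Context {k : comNzRingType} (V W : lmodType k).
Implicit Types s t : seq (V * W).

(* Formal sums of pure tensors, identified when no bilinear map separates them. *)
Definition tensor_eq s t : bool :=
  `[< forall (U : lmodType k) (b : {bilinear V -> W -> U}),
        \sum_(p <- s) b p.1 p.2 = \sum_(p <- t) b p.1 p.2 >].

Lemma tensor_eq_class : equiv_class_of tensor_eq.
Proof.
split=> [s|s t|t s u]; first exact/asboolP.
  by apply/asboolP/asboolP => st U b; rewrite st.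
by move=> /asboolP st /asboolP tu; apply/asboolP => U b; rewrite st.
Qed.
Canonical tensor_equiv := EquivRelPack tensor_eq_class.
Canonical tensor_encModRel := defaultEncModRel tensor_eq.

Definition tensor := {eq_quot tensor_eq}.
HB.instance Definition _ : EqQuotient _ tensor_eq tensor := EqQuotient.on tensor.
HB.instance Definition _ := Choice.on tensor.

Lemma tensorP s t :
  (forall (U : lmodType k) (b : {bilinear V -> W -> U}),
        \sum_(p <- s) b p.1 p.2 = \sum_(p <- t) b p.1 p.2)
  <-> \pi_tensor s = \pi_tensor t.
Proof.
split=> [st|/eqP]; first by apply/eqP; rewrite piE; exact/asboolP.
by rewrite piE => /asboolP.
Qed.

Lemma sum_repr (U : lmodType k) (b : {bilinear V -> W -> U}) s :
  \sum_(p <- repr (\pi_tensor s)) b p.1 p.2 = \sum_(p <- s) b p.1 p.2.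
Proof. by move: U b; apply/tensorP; rewrite reprK. Qed.

Let scl (a : k) s := [seq (a *: p.1, p.2) | p <- s].

Let sum_scl (U : lmodType k) (b : {bilinear V -> W -> U}) a s :
  \sum_(p <- scl a s) b p.1 p.2 = a *: \sum_(p <- s) b p.1 p.2.
Proof.
by rewrite big_map scaler_sumr; apply: eq_bigr => p _; rewrite /= linearZl_LR.
Qed.

Definition tadd (x y : tensor) := \pi_tensor (repr x ++ repr y).
Definition tzero := \pi_tensor [::].
Definition tscale (a : k) (x : tensor) := \pi_tensor (scl a (repr x)).
Definition topp (x : tensor) := tscale (-1) x.

Let taddA : associative tadd.
Proof.
by move=> x y z; apply/tensorP => U b; rewrite !big_cat /= !sum_repr !big_cat addrA.
Qed.
Let taddC : commutative tadd.
Proof. by move=> x y; apply/tensorP => U b; rewrite !big_cat /= addrC. Qed.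
Let tadd0 : left_id tzero tadd.
Proof.
move=> x; rewrite -[RHS]reprK; apply/tensorP => U b.
by rewrite big_cat /= sum_repr big_nil add0r.
Qed.
Let taddN : left_inverse tzero topp tadd.
Proof.
move=> x; apply/tensorP => U b.
by rewrite big_cat /= sum_repr sum_scl scaleN1r addNr big_nil.
Qed.
HB.instance Definition _ := GRing.isZmodule.Build tensor taddA taddC tadd0 taddN.

Let tscaleA a b x : tscale a (tscale b x) = tscale (a * b) x.
Proof. by apply/tensorP => U c; rewrite !sum_scl sum_repr sum_scl scalerA. Qed.
Let tscale1 : left_id 1 tscale.
Proof.
move=> x; rewrite -[RHS]reprK; apply/tensorP => U b.
by rewrite sum_scl scale1r.
Qed.
Let tscaleDr : right_distributive tscale +%R.
Proof.
move=> a x y; apply/tensorP => U b.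
by rewrite sum_scl sum_repr !big_cat /= !sum_repr !sum_scl scalerDr.
Qed.
Let tscaleDl x : {morph tscale^~ x : a b / a + b}.
Proof.
move=> a c; apply/tensorP => U b.
by rewrite sum_scl !big_cat /= !sum_repr !sum_scl scalerDl.
Qed.
HB.instance Definition _ :=
  GRing.Zmodule_isLmodule.Build k tensor tscaleA tscale1 tscaleDr tscaleDl.

Definition tens (v : V) (w : W) : tensor := \pi_tensor [:: (v, w)].

Lemma tens_is_bilinear : bilinear_for *:%R *:%R tens.
Proof.
split=> [w|v] a x y; apply/tensorP => U b;
  by rewrite big_cat /= !sum_repr sum_scl sum_repr !big_seq1 /= ?(linearPl, linearPr).
Qed.
HB.instance Definition _ :=
  bilinear_isBilinear.Build k V W tensor *:%R *:%R tens tens_is_bilinear.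

Lemma tensorE (x : tensor) : x = \sum_(p <- repr x) tens p.1 p.2.
Proof.
rewrite -{1}[x]reprK; elim: (repr x) => [|p s IH]; first by rewrite big_nil.
rewrite big_cons -IH; apply/tensorP => U b.
by rewrite big_cat /= !sum_repr big_cons big_seq1.
Qed.

Section Lift.
Variables (U : lmodType k) (b : {bilinear V -> W -> U}).

Definition tlift (x : tensor) : U := \sum_(p <- repr x) b p.1 p.2.

Lemma tlift_is_linear : linear tlift.
Proof.
by move=> a x y; rewrite /tlift sum_repr big_cat /= sum_repr sum_scl.
Qed.
HB.instance Definition _ := GRing.isLinear.Build k tensor U _ tlift tlift_is_linear.

Lemma tlift_tens v w : tlift (tens v w) = b v w.
Proof. by rewrite /tlift sum_repr big_seq1. Qed.
End Lift.

End Tensor.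

Notation "v ⊗ w" := (tens v w) (at level 40, left associativity) : ring_scope.

(* Sweedler sums run over an arbitrary finite family of pure tensors whose sum is
   the given tensor (see [tensorE]); every multilinear expression in the components
   is independent of that family (see [tlift]). *)
HB.mixin Record Algebra_isHopf (k : comNzRingType) H of GRing.Algebra k H := {
  coproduct : H -> tensor H H;
  counit : H -> k;
  antipode : H -> H;
  coproduct_linear : linear coproduct;
  counit_linear : scalar counit;
  antipode_linear : linear antipode;
  coproductA : forall h,
    \sum_(p <- repr (coproduct h)) p.1 ⊗ coproduct p.2 =
    \sum_(p <- repr (coproduct h)) \sum_(q <- repr (coproduct p.1))
       q.1 ⊗ (q.2 ⊗ p.2);
  counitl : forall h, \sum_(p <- repr (coproduct h)) counit p.1 *: p.2 = h;
  counitr : forall h, \sum_(p <- repr (coproduct h)) counit p.2 *: p.1 = h;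
  coproductM : forall h l,
    coproduct (h * l) =
    \sum_(p <- repr (coproduct h)) \sum_(q <- repr (coproduct l))
       (p.1 * q.1) ⊗ (p.2 * q.2);
  coproduct1 : coproduct 1 = 1 ⊗ 1;
  counitM : {morph counit : h l / h * l};
  counit1 : counit 1 = 1;
  antipodel : forall h,
    \sum_(p <- repr (coproduct h)) antipode p.1 * p.2 = (counit h)%:A;
  antipoder : forall h,
    \sum_(p <- repr (coproduct h)) p.1 * antipode p.2 = (counit h)%:A
}.

#[short(type="hopfAlgType")]
HB.structure Definition HopfAlgebra (k : comNzRingType) :=
  {H of GRing.Algebra k H & Algebra_isHopf k H}.

Section Sweedler.
Context {k : comNzRingType} {H : hopfAlgType k}.

HB.instance Definition _ :=
  GRing.isLinear.Build k H (tensor H H) _ (@coproduct k H) coproduct_linear.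
HB.instance Definition _ :=
  GRing.isLinear.Build k H k _ (@counit k H) counit_linear.

(* [p <- sw h] stands for h^(1) = p.1, h^(2) = p.2. *)
Definition sw (h : H) : seq (H * H) := repr (coproduct h).

(* The words h = h_1 (x) ... (x) h_l: [p <- wsw h] stands for the pair of words
   h^(1) = p.1, h^(2) = p.2, split letter by letter. *)
Fixpoint wsw (h : seq H) : seq (seq H * seq H) :=
  if h is x :: h' then
    [seq (p.1 :: q.1, p.2 :: q.2) | p <- sw x, q <- wsw h']
  else [:: ([::], [::])].

Definition weps (h : seq H) : k := \prod_(x <- h) counit x.

End Sweedler.

Section Crossed.
Context {k : comNzRingType} {H : hopfAlgType k} {A : algType k}.

(* [act h a] is a^h. *)
Record weak_action := WeakAction {
  act :> {bilinear H -> A -> A};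
  actM : forall h a b, act h (a * b) = \sum_(p <- sw h) act p.1 a * act p.2 b;
  act1r : forall h, act h 1 = (counit h)%:A;
  act1l : forall a, act 1 a = a
}.

(* E is A#_fH: an associative unital algebra whose underlying module is
   identified with A ⊗ H by [cp_iso], a # h being the image of a ⊗ h. *)
Record crossed_product (act : weak_action) (f : {linear tensor H H -> A})
    (E : algType k) := CrossedProduct {
  cp_iso : {linear tensor A H -> E};
  cp_bij : bijective cp_iso;
  cpM : forall a h b l,
    cp_iso (a ⊗ h) * cp_iso (b ⊗ l) =
    \sum_(p <- sw h) \sum_(q <- sw p.2) \sum_(u <- sw l)
      cp_iso ((a * act p.1 b * f (q.1 ⊗ u.1)) ⊗ (q.2 * u.2));
  cp1 : cp_iso (1 ⊗ 1) = 1
}.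

End Crossed.
Arguments weak_action {k} H A.

Definition sharp (k : comNzRingType) (H : hopfAlgType k) (A : algType k)
    (act : weak_action H A) (f : {linear tensor H H -> A}) (E : algType k)
    (cp : crossed_product act f E) (a : A) (h : H) : E := cp_iso cp (a ⊗ h).

(* Bimodules over the k-algebra B, with k acting symmetrically. *)
Record bimodule (k : comNzRingType) (B : algType k) (N : lmodType k) := Bimodule {
  lact : {bilinear B -> N -> N};
  ract : {bilinear N -> B -> N};
  lactA : forall x y m, lact (x * y) m = lact x (lact y m);
  lact1 : forall m, lact 1 m = m;
  ractA : forall m x y, ract m (x * y) = ract (ract m x) y;
  ract1 : forall m, ract m 1 = m;
  lractA : forall x m y, ract (lact x m) y = lact x (ract m y)
}.

Section Normalized.
Context {k : comNzRingType} {B : algType k} {N : lmodType k}.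

(* Multilinear maps on words over B that factor through the reduced tensor powers
   of B/k. *)
Definition multilin (g : seq B -> N) : Prop :=
  forall u v c x y, g (u ++ (c *: x + y) :: v) = c *: g (u ++ x :: v) + g (u ++ y :: v).

Definition normalized (g : seq B -> N) : Prop :=
  forall u v, g (u ++ 1 :: v) = 0.

(* Hom_k((B/k)^{⊗ n}, N): a map on B^n is extended by 0 to the words of length
   other than n. *)
Definition homP (n : nat) (g : seq B -> N) : Prop :=
  [/\ multilin g, normalized g & forall u, size u != n -> g u = 0].

Definition homset n : {pred (seq B -> N)} := [pred g | `[< homP n g >]].

Let homset_closed n : GRing.subsemimod_closed (homset n).
Proof.
split; first split.
- by apply/asboolP; split=> // u v c x y; apply: esym; rewrite -[X in _ = X](scaler0 _ c); exact: addr0.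
- move=> g g' /asboolP[gm g1 gs] /asboolP[gm' g1' gs']; apply/asboolP; split=> /=.
  + by move=> u v c x y; rewrite /GRing.add /= gm gm' scalerDr addrACA.
  + by move=> u v; rewrite /GRing.add /= g1 g1' addr0.
  + by move=> u su; rewrite /GRing.add /= gs // gs' // addr0.
move=> a g /asboolP[gm g1 gs]; apply/asboolP; split=> /=.
- by move=> u v c x y; rewrite !scalrfctE gm scalerDr !scalerA mulrC.
- by move=> u v; rewrite scalrfctE g1 scaler0.
- by move=> u su; rewrite scalrfctE gs // scaler0.
Qed.
HB.instance Definition _ n :=
  GRing.isSubmodClosed.Build k (seq B -> N) (homset n) (homset_closed n).

End Normalized.

Definition redhom {k : comNzRingType} (B : algType k) (N : lmodType k) (n : nat) :
  lmodType k := submod (@homset k B N n).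

Section Complexes.
Context {k : comNzRingType}.

(* All the C^n live in one ambient module, and so do their differentials. *)
Record precomplex := Precomplex {
  cmod : lmodType k;
  cdeg : nat -> submodClosed cmod;
  cdif : {linear cmod -> cmod}
}.

Record filtered_precomplex := FilteredPrecomplex {
  fcpx :> precomplex;
  fil : nat -> nat -> submodClosed (cmod fcpx)
}.

(* [fil K i n] is F_i(K^n); F_i = F_0 = K^n for i < 0 is left implicit. *)
Record is_filtered_complex (K : filtered_precomplex) : Prop := IsFilteredComplex {
  cdif_deg : forall n x, x \in cdeg K n -> cdif K x \in cdeg K n.+1;
  cdifK : forall n x, x \in cdeg K n -> cdif K (cdif K x) = 0;
  fil0 : forall n, fil K 0 n =i cdeg K n;
  filS : forall i n, {subset fil K i.+1 n <= fil K i n};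
  cdif_fil : forall i n x, x \in fil K i n -> cdif K x \in fil K i n.+1
}.

Section Cohomology.
Variable K : precomplex.
Local Notation d := (cdif K).

Definition cocycle n : {pred cmod K} := [pred x | (x \in cdeg K n) && (d x == 0)].

Definition coboundary n : {pred cmod K} :=
  [pred x | `[< if n is m.+1 then exists2 y, y \in cdeg K m & x = d y
                else x = 0 >]].

Let cocycle_closed n : GRing.subsemimod_closed (cocycle n).
Proof.
split; first split.
- by rewrite inE rpred0 raddf0 eqxx.
- move=> x y /andP[Cx /eqP dx] /andP[Cy /eqP dy].
  by rewrite inE rpredD // raddfD /= dx dy addr0 eqxx.
- by move=> a x /andP[Cx /eqP dx]; rewrite inE rpredZ // linearZ /= dx scaler0 eqxx.
Qed.
HB.instance Definition _ n :=
  GRing.isSubmodClosed.Build k (cmod K) (cocycle n) (cocycle_closed n).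

Let coboundary_closed n : GRing.subsemimod_closed (coboundary n).
Proof.
split; first split.
- by apply/asboolP; case: n => // n; exists 0; rewrite ?rpred0 ?raddf0.
- move=> x y /asboolP Bx /asboolP By; apply/asboolP; case: n Bx By => [->->|n].
    exact: addr0.
  by move=> [u Cu ->] [v Cv ->]; exists (u + v); rewrite ?rpredD // raddfD.
- move=> a x /asboolP Bx; apply/asboolP; case: n Bx => [->|n]; first exact: scaler0.
  by move=> [u Cu ->]; exists (a *: u); rewrite ?rpredZ // linearZ.
Qed.
HB.instance Definition _ n :=
  GRing.isSubmodClosed.Build k (cmod K) (coboundary n) (coboundary_closed n).

Definition cohom n : lmodType k := subquo (cocycle n) (coboundary n).

End Cohomology.

Section Pages.
Variable K : filtered_precomplex.
Local Notation d := (cdif K).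
Local Notation F := (fil K).

(* E_q in filtration degree p and total degree n is Z_q / B_q with
     Z_q = {x in F_p K^n | d x in F_(p+q) K^(n+1)}
     B_q = Z_(q-1)^(p+1,n) + d Z_(q-1)^(p-q+1,n-1).
   As F_i = F_0 for i <= 0, the truncated subtraction [p.+1 - q] is harmless: the
   condition d y in F_p below is stated separately. *)
Definition Zpage q p n : {pred cmod K} :=
  [pred x | (x \in F p n) && (d x \in F (p + q) n.+1)].

Definition Bpage q p n : {pred cmod K} :=
  [pred x | `[< exists z y,
     [/\ x = z + d y, z \in F p.+1 n, d z \in F (p + q) n.+1,
         if n is m.+1 then y \in F (p.+1 - q) m else y = 0 & d y \in F p n] >]].

Let Zpage_closed q p n : GRing.subsemimod_closed (Zpage q p n).
Proof.
split; first split.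
- by rewrite inE raddf0 !rpred0.
- move=> x y /andP[Cx dx] /andP[Cy dy].
  by rewrite inE raddfD /= !rpredD.
- by move=> a x /andP[Cx dx]; rewrite inE linearZ /= !rpredZ.
Qed.
HB.instance Definition _ q p n :=
  GRing.isSubmodClosed.Build k (cmod K) (Zpage q p n) (Zpage_closed q p n).

Let Bpage_closed q p n : GRing.subsemimod_closed (Bpage q p n).
Proof.
split; first split.
- apply/asboolP; exists 0, 0; rewrite !raddf0 addr0 !rpred0; split=> //.
  by case: n => //= n; rewrite rpred0.
- move=> _ _ /asboolP[z [y [-> zF dz yF dy]]] /asboolP[z' [y' [-> zF' dz' yF' dy']]].
  apply/asboolP; exists (z + z'), (y + y'); rewrite !raddfD /= addrACA !rpredD //.
  split=> //; case: n yF yF' {zF dz dy zF' dz' dy'} => [->->|n]; last exact: rpredD.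
  exact: addr0.
- move=> a _ /asboolP[z [y [-> zF dz yF dy]]].
  apply/asboolP; exists (a *: z), (a *: y); rewrite !linearZ /= -scalerDr !rpredZ //.
  split=> //; case: n yF {zF dz dy} => [->|n]; last exact: rpredZ.
  exact: scaler0.
Qed.
HB.instance Definition _ q p n :=
  GRing.isSubmodClosed.Build k (cmod K) (Bpage q p n) (Bpage_closed q p n).

Definition page q p n : lmodType k := subquo (Zpage q p n) (Bpage q p n).

Definition pcls q p n x (Zx : x \in Zpage q p n) : page q p n :=
  subcls (Bpage q p n) Zx.

Hypothesis cK : is_filtered_complex K.

Lemma Zpage_dif q p n x : x \in Zpage q p n -> d x \in Zpage q (p + q) n.+1.
Proof.
move=> /andP[Fx Fdx]; rewrite inE Fdx /= (cdifK cK (n := n)) ?rpred0 //.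
by rewrite -(fil0 cK); elim: p Fx {Fdx} => // p IH /(filS cK).
Qed.

Definition page_dif q p n (c : page q p n) : page q (p + q) n.+1 :=
  pcls (Zpage_dif (valP (repr c))).

Lemma page_difE q p n x (Zx : x \in Zpage q p n) :
  page_dif (pcls Zx) = pcls (Zpage_dif Zx).
Proof.
have fil_deg i m y : y \in F i m -> y \in cdeg K m.
  by rewrite -(fil0 cK); elim: i => // i IH /(filS cK).
rewrite /page_dif; set y := repr _.
have /subclsP/asboolP[z [t [yx zF dz tF dt]]] := subcls_repr (pcls Zx).
apply/subclsP/asboolP; rewrite -raddfB /= yx; exists 0, z.
rewrite !raddf0 add0r !rpred0 raddfD /= -addSn addnK; split=> //.
case: n x Zx y z t {yx zF dz dt} tF => [|n] x Zx y z t tF; first by rewrite tF !raddf0 addr0.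
by rewrite (cdifK cK (fil_deg _ _ _ tF)) addr0.
Qed.

End Pages.

End Complexes.
Arguments precomplex k : clear implicits.
Arguments filtered_precomplex k : clear implicits.
Arguments Zpage {k} K q p n.
Arguments Bpage {k} K q p n.
Arguments page {k} K q p n.
Arguments cocycle {k} K n.
Arguments coboundary {k} K n.
Arguments cohom {k} K n.

Section SpectralSequences.
Context {k : comNzRingType}.

(* Isomorphism of spectral sequences, from the first page on: isomorphisms of the
   pages that commute with the differentials, and such that the one on E_(q+1) is
   induced in homology by the one on E_q. For the last clause, the cycles of E_q are
   the classes of the elements of Z_(q+1), and the isomorphism H(E_q) = E_(q+1) is
   given by the identity on these elements. *)
Definition sseq_iso (K K' : filtered_precomplex k)
    (cK : is_filtered_complex K) (cK' : is_filtered_complex K') : Prop :=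
  exists phi : forall q p n, {linear page K q p n -> page K' q p n},
    forall q p n, (1 <= q)%N ->
    [/\ bijective (phi q p n),
        forall c, phi q (p + q)%N n.+1 (page_dif cK c) = page_dif cK' (phi q p n c)
      & forall x (Zx : x \in Zpage K q p n) (Zx1 : x \in Zpage K q.+1 p n)
               x' (Zx' : x' \in Zpage K' q p n) (Zx1' : x' \in Zpage K' q.+1 p n),
        phi q p n (pcls Zx) = pcls Zx' -> phi q.+1 p n (pcls Zx1) = pcls Zx1'].

(* The spectral sequence of K converges to Hn: each Hn n has a finite exhaustive
   filtration whose p-th graded piece is E_oo in filtration degree p and total
   degree n. Filtration degrees being nonnegative, no differential enters
   (p, n) on the pages q > p; E_oo is E_q for any q > p from which on none leaves. *)
Definition converges (K : filtered_precomplex k) (cK : is_filtered_complex K)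
    (Hn : nat -> lmodType k) : Prop :=
  forall n, exists G : nat -> submodClosed (Hn n),
    [/\ forall x, x \in G 0%N,
        forall p, {subset G p.+1 <= G p},
        exists m, forall x, x \in G m -> x = 0
      & forall p, exists2 q, (p < q)%N &
          (forall q' (c : page K q' p n), (q <= q')%N -> page_dif cK c = 0) /\
          exists psi : {linear page K q p n -> subquo (G p) (G p.+1)}, bijective psi].

End SpectralSequences.

Section Hochschild.
Context {k : comNzRingType} {B : algType k} {N : lmodType k} (bN : bimodule B N).

Definition hochd_fun (g : seq B -> N) (x : seq B) : N :=
  if x is x1 :: x' then
    let n := size x in
    lact bN x1 (g x')
    + \sum_(1 <= i < n)
        (-1) ^+ i *: g (take i.-1 x ++ x`_i.-1 * x`_i :: drop i.+1 x)
    + (-1) ^+ n *: ract bN (g (take n.-1 x)) (last x1 x')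
  else 0.

Let hochd_linear : linear hochd_fun.
Proof.
move=> a g g'; apply/funext => x.
have E y : (a *: g + g') y = a *: g y + g' y by [].
transitivity (a *: hochd_fun g x + hochd_fun g' x) => //.
case: x => [|x1 x']; first by rewrite /= scaler0 addr0.
rewrite /hochd_fun !E linearPr linearPl; move: (size _) => n.
under eq_bigr do rewrite E scalerDr scalerA mulrC -scalerA.
rewrite big_split -scaler_sumr /= [(-1) ^+ n *: (_ + _)]scalerDr.
by rewrite [(-1) ^+ n *: (_ *: _)]scalerA mulrC -scalerA !scalerDr
  [X in X + _ = _]addrACA [LHS]addrACA.
Qed.

Definition hochd (g : seq B -> N) : seq B -> N := hochd_fun g.
HB.instance Definition _ :=
  GRing.isLinear.Build k (seq B -> N) (seq B -> N) _ hochd hochd_linear.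

(* The normalized Hochschild complex; it computes H^*(B, N) over any k. *)
Definition hochschild : precomplex k :=
  Precomplex (fun n => homset n) hochd.

Definition HH n : lmodType k := cohom hochschild n.

End Hochschild.

Section HochschildSerre.
Context {k : comNzRingType} {H : hopfAlgType k} {A : algType k}.
Context {act : weak_action H A} {f : {linear tensor H H -> A}} {E : algType k}.
Context (cp : crossed_product act f E) {M : lmodType k} (bM : bimodule E M).

Definition in_A (x : E) : bool := `[< exists a, x = sharp cp a 1 >].

(* "at least n - i + 1 of the x_j" is written additively. *)
Definition hs_fil i n : {pred (seq E -> M)} :=
  [pred g | (g \in homset n) &&
    `[< forall x, size x = n -> (n + 1 <= count in_A x + i)%N -> g x = 0 >]].

Let hs_fil_closed i n : GRing.subsemimod_closed (hs_fil i n).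
Proof.
split; first split.
- by rewrite inE rpred0; apply/asboolP.
- move=> g g' /andP[Cg /asboolP g0] /andP[Cg' /asboolP g0'].
  rewrite inE rpredD //=; apply/asboolP => x xn le.
  by rewrite addrfctE g0 // g0' // addr0.
- move=> a g /andP[Cg /asboolP g0]; rewrite inE rpredZ //=; apply/asboolP => x xn le.
  by rewrite scalrfctE g0 // scaler0.
Qed.
HB.instance Definition _ i n :=
  GRing.isSubmodClosed.Build k (seq E -> M) (hs_fil i n) (hs_fil_closed i n).

Definition hochschild_serre : filtered_precomplex k :=
  FilteredPrecomplex (fcpx := hochschild bM) (fun i n => hs_fil i n).

End HochschildSerre.

Section SweedlerSums.
Context {k : comNzRingType} {H : hopfAlgType k} {U : lmodType k}.

Definition bilin (V W : lmodType k) (b : V -> W -> U) : Prop :=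
  (forall w, linear (b ^~ w)) /\ (forall v, linear (b v)).

Definition mkbilin (V W : lmodType k) (b : V -> W -> U) (bP : bilin b) :
  {bilinear V -> W -> U} :=
  HB.pack_for {bilinear V -> W -> U} b
    (bilinear_isBilinear.Build k V W U *:%R *:%R b (bP.1, bP.2)).

Lemma sum_sw (b : H -> H -> U) (bP : bilin b) h :
  \sum_(p <- sw h) b p.1 p.2 = tlift (mkbilin bP) (coproduct h).
Proof. by []. Qed.

Lemma sw_linear (b : H -> H -> U) : bilin b ->
  linear (fun h => \sum_(p <- sw h) b p.1 p.2).
Proof. by move=> bP c x y; rewrite !(sum_sw bP) !linearP. Qed.

Lemma sw_1 (b : H -> H -> U) : bilin b -> \sum_(p <- sw 1) b p.1 p.2 = b 1 1.
Proof. by move=> bP; rewrite (sum_sw bP) coproduct1; exact: tlift_tens. Qed.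

Lemma bilin_sum (V W : lmodType k) (I : Type) (r : seq I) (b : I -> V -> W -> U) :
  (forall i, bilin (b i)) -> bilin (fun v w => \sum_(i <- r) b i v w).
Proof.
move=> bP; split=> [w|v] c x y; rewrite scaler_sumr -big_split;
  apply: eq_bigr => i _; [exact: (bP i).1 | exact: (bP i).2].
Qed.

Lemma sw_coassoc (T : H -> H -> H -> U) :
  (forall z, bilin (fun x y => T x y z)) -> (forall x, bilin (T x)) ->
  forall h, \sum_(p <- sw h) \sum_(q <- sw p.2) T p.1 q.1 q.2 =
            \sum_(p <- sw h) \sum_(q <- sw p.1) T q.1 q.2 p.2.
Proof.
move=> Tz Tx h.
pose c x (t : tensor H H) := tlift (mkbilin (Tx x)) t.
have cP : bilin c.
  split=> [t|x] a u v; last exact: linearP.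
  by rewrite /c /tlift scaler_sumr -big_split; apply: eq_bigr => q _; exact: (Tz q.2).1.
have := congr1 (tlift (mkbilin cP)) (coproductA h).
rewrite !raddf_sum /= => E.
transitivity (\sum_(p <- sw h) tlift (mkbilin cP) (p.1 ⊗ coproduct p.2)).
  by apply: eq_bigr => p _; rewrite tlift_tens.
rewrite E; apply: eq_bigr => p _; rewrite raddf_sum; apply: eq_bigr => q _ /=.
by rewrite tlift_tens /= /c tlift_tens.
Qed.

Lemma wsw_cons x h (G : seq H -> seq H -> U) :
  \sum_(p <- wsw (x :: h)) G p.1 p.2 =
  \sum_(p <- wsw h) \sum_(q <- sw x) G (q.1 :: p.1) (q.2 :: p.2).
Proof. by rewrite /= big_allpairs_dep exchange_big. Qed.

Lemma wsw_nil (G : seq H -> seq H -> U) :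
  \sum_(p <- wsw [::]) G p.1 p.2 = G [::] [::].
Proof. by rewrite big_seq1. Qed.

Lemma wsw_cat u v (G : seq H -> seq H -> U) :
  \sum_(p <- wsw (u ++ v)) G p.1 p.2 =
  \sum_(p <- wsw u) \sum_(q <- wsw v) G (p.1 ++ q.1) (p.2 ++ q.2).
Proof.
elim: u G => [|x u IH] G; first by rewrite cat0s big_seq1.
rewrite cat_cons wsw_cons (IH (fun a b => \sum_(q <- sw x) G (q.1 :: a) (q.2 :: b))).
rewrite (wsw_cons _ _ (fun a b => \sum_(q <- wsw v) G (a ++ q.1) (b ++ q.2))).
by apply: eq_bigr => p _; rewrite exchange_big.
Qed.

Lemma multilin_cons (G : seq H -> U) x : multilin G -> multilin (fun h => G (x :: h)).
Proof. by move=> Gm u v c y z; rewrite -!cat_cons Gm. Qed.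

Section WordSums.
Variable G : seq H -> seq H -> U.
Hypotheses (Gl : forall h, multilin (G ^~ h)) (Gr : forall h, multilin (G h)).

Lemma wsw_bilin u v u' v' : bilin (fun x y => G (u ++ x :: v) (u' ++ y :: v')).
Proof. by split=> [w|w] c x y; [exact: Gl | exact: Gr]. Qed.

Lemma wsw_mid u x v : \sum_(p <- wsw (u ++ x :: v)) G p.1 p.2 =
  \sum_(q <- sw x) \sum_(p <- wsw u) \sum_(r <- wsw v)
     G (p.1 ++ q.1 :: r.1) (p.2 ++ q.2 :: r.2).
Proof.
rewrite wsw_cat [RHS]exchange_big; apply: eq_bigr => p _ /=.
by rewrite (wsw_cons x v (fun a b => G (p.1 ++ a) (p.2 ++ b))) exchange_big.
Qed.

Let wsw_mid_bilin u v : bilin (fun x y => \sum_(p <- wsw u) \sum_(r <- wsw v)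
     G (p.1 ++ x :: r.1) (p.2 ++ y :: r.2)).
Proof.
apply: (@bilin_sum _ _ _ _ (fun (p : seq H * seq H) x y => \sum_(r <- wsw v)
     G (p.1 ++ x :: r.1) (p.2 ++ y :: r.2))) => p.
apply: (@bilin_sum _ _ _ _ (fun (r : seq H * seq H) x y =>
     G (p.1 ++ x :: r.1) (p.2 ++ y :: r.2))) => r.
exact: wsw_bilin.
Qed.

Lemma wsw_multilin : multilin (fun h => \sum_(p <- wsw h) G p.1 p.2).
Proof.
by move=> u v c x y; rewrite !wsw_mid; exact: (sw_linear (wsw_mid_bilin u v)).
Qed.

Lemma wsw_normalized : (forall h, normalized (G h)) ->
  normalized (fun h => \sum_(p <- wsw h) G p.1 p.2).
Proof.
move=> G1 u v; rewrite wsw_mid (sw_1 (wsw_mid_bilin u v)).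
by rewrite big1 // => p _; rewrite big1 // => r _; exact: G1.
Qed.
End WordSums.

Lemma linear_sumZ (V : lmodType k) (g : V -> U) I (r : seq I) (c : I -> k) (x : I -> V) :
  linear g -> g (\sum_(i <- r) c i *: x i) = \sum_(i <- r) c i *: g (x i).
Proof.
move=> gP.
pose g' : {linear V -> U} := HB.pack_for {linear V -> U} g (GRing.isLinear.Build k V U _ g gP).
rewrite -[g]/(g' : V -> U) raddf_sum; apply: eq_bigr => i _; exact: linearZ.
Qed.

Lemma wsw_counit (G : seq H -> U) : multilin G ->
  forall h, \sum_(p <- wsw h) weps p.1 *: G p.2 = G h.
Proof.
move=> + h; elim: h G => [|x h IH] G Gm; first by rewrite big_seq1 /weps big_nil scale1r.
rewrite (wsw_cons x h (fun a b => weps a *: G b)) -[RHS](IH _ (multilin_cons x Gm)).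
apply: eq_bigr => p _.
rewrite -[in RHS](counitl x) (@linear_sumZ _ (fun y => G (y :: p.2))).
  rewrite scaler_sumr; apply: eq_bigr => q _.
  by rewrite /weps big_cons scalerA mulrC.
by move=> c y z; exact: (Gm [::]).
Qed.

Lemma wsw_coassoc (T : seq H -> seq H -> seq H -> U) :
  (forall y z, multilin (fun x => T x y z)) ->
  (forall x z, multilin (fun y => T x y z)) ->
  (forall x y, multilin (fun z => T x y z)) ->
  forall h, \sum_(p <- wsw h) \sum_(q <- wsw p.2) T p.1 q.1 q.2 =
            \sum_(p <- wsw h) \sum_(q <- wsw p.1) T q.1 q.2 p.2.
Proof.
move=> + + + h; elim: h T => [|x h IH] T T1 T2 T3; first by rewrite !big_seq1.
pose T' a b c := \sum_(p <- sw x) \sum_(q <- sw p.2) T (p.1 :: a) (q.1 :: b) (q.2 :: c).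
transitivity (\sum_(p <- wsw h) \sum_(q <- wsw p.2) T' p.1 q.1 q.2).
  rewrite (wsw_cons x h (fun a b => \sum_(q <- wsw b) T a q.1 q.2)).
  apply: eq_bigr => p _; rewrite exchange_big; apply: eq_bigr => q _ /=.
  by rewrite (wsw_cons q.2 p.2 (fun a b => T (q.1 :: p.1) a b)).
rewrite (IH T').
- rewrite (wsw_cons x h (fun a b => \sum_(q <- wsw a) T q.1 q.2 b)).
  apply: eq_bigr => p _.
  transitivity (\sum_(q <- wsw p.1) \sum_(i <- sw x) \sum_(j <- sw i.1)
    T (j.1 :: q.1) (j.2 :: q.2) (i.2 :: p.2)).
    apply: eq_bigr => q _; rewrite /T'.
    apply: (sw_coassoc (T := fun a b c => T (a :: q.1) (b :: q.2) (c :: p.2))).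
    + by move=> z; split=> [w|w] c a b; [exact: (T1 _ _ [::])|exact: (T2 _ _ [::])].
    + by move=> z; split=> [w|w] c a b; [exact: (T2 _ _ [::])|exact: (T3 _ _ [::])].
  rewrite exchange_big; apply: eq_bigr => i _ /=.
  by rewrite (wsw_cons i.1 p.1 (fun a b => T a b (i.2 :: p.2))).
- move=> b c u v a y z; rewrite /T' scaler_sumr -big_split; apply: eq_bigr => p _ /=.
  by rewrite scaler_sumr -big_split; apply: eq_bigr => q _; rewrite -!cat_cons T1.
- move=> b c u v a y z; rewrite /T' scaler_sumr -big_split; apply: eq_bigr => p _ /=.
  by rewrite scaler_sumr -big_split; apply: eq_bigr => q _; rewrite -!cat_cons T2.
- move=> b c u v a y z; rewrite /T' scaler_sumr -big_split; apply: eq_bigr => p _ /=.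
  by rewrite scaler_sumr -big_split; apply: eq_bigr => q _; rewrite -!cat_cons T3.
Qed.

Lemma wsw_size (h : seq H) p : p \in wsw h -> size p.2 = size h.
Proof.
elim: h p => [|x h IH] p /=; first by rewrite inE => /eqP->.
by move=> /allpairsP[[q r] [/= _ /IH <- ->]].
Qed.

End SweedlerSums.

Section WordAction.
Context {k : comNzRingType} {H : hopfAlgType k} {A : algType k} (act : weak_action H A).

(* a^{\overline h} = (...((a^{h_j})^{h_{j-1}})...)^{h_i} for h = h_i (x) ... (x) h_j. *)
Definition wact (h : seq H) (a : A) : A := foldr act a h.

Lemma wact_linear h : linear (wact h).
Proof.
by move=> c x y; elim: h => //= z h ->; rewrite linearPr.
Qed.

Lemma wact_multilin a : multilin (fun h => wact h a).
Proof.
move=> u v c x y; rewrite /wact !foldr_cat /= linearPl; exact: wact_linear.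
Qed.

Lemma wact_1r h : wact h 1 = (weps h)%:A.
Proof.
elim: h => [|x h IH]; first by rewrite /weps big_nil scale1r.
by rewrite /= IH linearZr_LR /= act1r scalerA /weps big_cons mulrC.
Qed.

Lemma wactM h a b : wact h (a * b) = \sum_(p <- wsw h) wact p.1 a * wact p.2 b.
Proof.
elim: h => [|x h IH]; first by rewrite big_seq1.
rewrite (wsw_cons x h (fun u v => wact u a * wact v b)) /= IH linear_sumr.
by apply: eq_bigr => p _; rewrite actM.
Qed.

End WordAction.

Section HomBimodule.
Context {k : comNzRingType} {H : hopfAlgType k} {A : algType k}.
Context {act : weak_action H A} {f : {linear tensor H H -> A}} {E : algType k}.
Context (cp : crossed_product act f E) {M : lmodType k} (bM : bimodule E M).

Lemma sharp_is_bilinear : bilinear_for *:%R *:%R (sharp cp).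
Proof.
by split=> [h|a] c x y; rewrite /sharp ?linearPl ?linearPr /= linearP.
Qed.
HB.instance Definition _ := bilinear_isBilinear.Build k A H E *:%R *:%R (sharp cp)
  sharp_is_bilinear.

Let sharp11 a b : sharp cp a 1 * sharp cp b 1 = sharp cp (a * b * f (1 ⊗ 1)) 1.
Proof.
rewrite [LHS](cpM cp).
pose T x y z w : E := sharp cp (a * act x b * f (y ⊗ w.1)) (z * w.2).
have b3 x y z : bilin (fun v w => T x y z (v, w)).
  split=> [w|v] c s t; rewrite /T /=.
    by rewrite linearPr linearP mulrDr -scalerAr linearPl.
  by rewrite mulrDr -scalerAr linearPr.
have b2 x : bilin (fun y z => T x y z (1, 1)).
  split=> [w|v] c s t; rewrite /T /=.
    by rewrite linearPl linearP mulrDr -scalerAr linearPl.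
  by rewrite mulrDl -scalerAl linearPr.
have b1 : bilin (fun x y => \sum_(q <- sw y) T x q.1 q.2 (1, 1)).
  split=> [w|v]; last exact: sw_linear (b2 v).
  move=> c s t; rewrite scaler_sumr -big_split; apply: eq_bigr => q _.
  by rewrite /T /= linearPl mulrDr -scalerAr mulrDl -scalerAl linearPl.
transitivity (\sum_(p <- sw 1) \sum_(q <- sw p.2) T p.1 q.1 q.2 (1 : H, 1 : H)).
  apply: eq_bigr => p _; apply: eq_bigr => q _.
  rewrite -(sw_1 (b3 p.1 q.1 q.2)); apply: eq_bigr => -[u v] _ //.
by rewrite (sw_1 b1) (sw_1 (b2 1)) /T /= act1l mulr1.
Qed.

Let f11 : f (1 ⊗ 1) = 1.
Proof.
have: sharp cp 1 1 = sharp cp (f (1 ⊗ 1)) 1.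
  have s1 : sharp cp 1 1 = 1 := cp1 cp.
  by have := sharp11 1 1; rewrite s1 !mul1r.
move=> /(bij_inj (cp_bij cp)) E11.
pose b (a : A) (h : H) : A := counit h *: a.
have bP : bilin b.
  split=> [h|a] c x y; rewrite /b; first by rewrite scalerDr !scalerA mulrC.
  by rewrite linearP /= scalerDl scalerA.
have := congr1 (tlift (mkbilin bP)) E11.
by rewrite !tlift_tens /= /b counit1 !scale1r.
Qed.

Lemma sharp1M a b : sharp cp (a * b) 1 = sharp cp a 1 * sharp cp b 1.
Proof. by rewrite sharp11 f11 mulr1. Qed.

Lemma sharpZ1 c : sharp cp c%:A 1 = c%:A.
Proof. by rewrite linearZl_LR /= /sharp cp1. Qed.

Section Degree.
Variable s : nat.
Local Notation HM := (redhom H M s).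

(* A acts on M through a |-> a # 1. *)
Definition homl_fun (a : A) (g : seq H -> M) (h : seq H) : M :=
  \sum_(p <- wsw h) lact bM (sharp cp (wact act p.1 a) 1) (g p.2).

Definition homr_fun (g : seq H -> M) (a : A) (h : seq H) : M :=
  ract bM (g h) (sharp cp a 1).

Let homP_val (g : HM) : homP s (val g).
Proof. exact/asboolP/(valP g). Qed.

Let G_l a (g : HM) y :
  multilin (fun x => lact bM (sharp cp (wact act x a) 1) (val g y)).
Proof. by move=> u v c x z; rewrite wact_multilin !linearPl. Qed.
Let G_r a (g : HM) x :
  multilin (fun y => lact bM (sharp cp (wact act x a) 1) (val g y)).
Proof. by move=> u v c y z; have [-> _ _] := homP_val g; rewrite linearPr. Qed.

Let homl_in a (g : HM) : homl_fun a (val g) \in homset s.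
Proof.
have [gm g1 gs] := homP_val g; apply/asboolP; split.
- exact: (wsw_multilin (G_l a g) (G_r a g)).
- apply: (wsw_normalized (G_l a g) (G_r a g)) => x u v.
  by rewrite g1 linear0r.
- move=> h hs; rewrite /homl_fun big_seq big1 // => p /wsw_size ph.
  by rewrite gs ?ph // linear0r.
Qed.

Let homr_in (g : HM) a : homr_fun (val g) a \in homset s.
Proof.
have [gm g1 gs] := homP_val g; apply/asboolP; split.
- by move=> u v c x y; rewrite /homr_fun gm linearPl.
- by move=> u v; rewrite /homr_fun g1 linear0l.
- by move=> h hs; rewrite /homr_fun gs // linear0l.
Qed.

Definition homl a (g : HM) : HM := Submod (homl_in a g).
Definition homr (g : HM) a : HM := Submod (homr_in g a).

Let homl_bilinear : bilinear_for *:%R *:%R homl.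
Proof.
split=> [g|a] c x y; apply: val_inj; apply/funext => h /=.
  transitivity (c *: homl_fun x (val g) h + homl_fun y (val g) h) => //.
  rewrite /homl_fun scaler_sumr -big_split; apply: eq_bigr => p _ /=.
  by rewrite wact_linear !linearPl.
transitivity (c *: homl_fun a (val x) h + homl_fun a (val y) h) => //.
rewrite /homl_fun scaler_sumr -big_split; apply: eq_bigr => p _ /=.
by rewrite -linearPr.
Qed.
HB.instance Definition _ :=
  bilinear_isBilinear.Build k A HM HM *:%R *:%R homl homl_bilinear.

Let homr_bilinear : bilinear_for *:%R *:%R homr.
Proof.
split=> [a|g] c x y; apply: val_inj; apply/funext => h /=.
  transitivity (c *: homr_fun (val x) a h + homr_fun (val y) a h) => //.
  by rewrite /homr_fun -linearPl.
transitivity (c *: homr_fun (val g) x h + homr_fun (val g) y h) => //.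
by rewrite /homr_fun linearPl /= linearPr.
Qed.
HB.instance Definition _ :=
  bilinear_isBilinear.Build k HM A HM *:%R *:%R homr homr_bilinear.

Let homlA a b g : homl (a * b) g = homl a (homl b g).
Proof.
apply: val_inj; apply/funext => h /=; rewrite /homl_fun.
pose T x y z := lact bM (sharp cp (wact act x a) 1)
  (lact bM (sharp cp (wact act y b) 1) (val g z)).
transitivity (\sum_(p <- wsw h) \sum_(q <- wsw p.1) T q.1 q.2 p.2).
  apply: eq_bigr => p _; rewrite wactM linear_sumlz linear_sumlz /=.
  by apply: eq_bigr => q _; rewrite sharp1M lactA.
rewrite -wsw_coassoc; first by apply: eq_bigr => p _; rewrite /= linear_sumr.
- by move=> y z u v c x x'; rewrite /T wact_multilin !linearPl.
- by move=> x z u v c y y'; rewrite /T wact_multilin linearPl /= linearPl /= linearPr.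
- move=> x y u v c z z'; rewrite /T; have [-> _ _] := homP_val g.
  by rewrite !linearPr.
Qed.

Let homl1 g : homl 1 g = g.
Proof.
apply: val_inj; apply/funext => h /=; have [gm _ _] := homP_val g.
rewrite -[RHS](wsw_counit gm); apply: eq_bigr => p _.
by rewrite wact_1r sharpZ1 linearZl_LR /= lact1.
Qed.

Let homrA g a b : homr g (a * b) = homr (homr g a) b.
Proof.
by apply: val_inj; apply/funext => h; rewrite /= /homr_fun sharp1M ractA.
Qed.

Let homr1 g : homr g 1 = g.
Proof.
by apply: val_inj; apply/funext => h; rewrite /= /homr_fun /sharp cp1 ract1.
Qed.

Let homlrA a g b : homr (homl a g) b = homl a (homr g b).
Proof.
apply: val_inj; apply/funext => h; rewrite /= /homr_fun /homl_fun linear_sumlz.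
by apply: eq_bigr => p _; rewrite /= lractA.
Qed.

Definition hom_bimodule : bimodule A HM :=
  Bimodule (lact := homl) (ract := homr) homlA homl1 homrA homr1 homlrA.

End Degree.

End HomBimodule.

Section FMaps.
Context {k : comNzRingType} {H : hopfAlgType k} {A : algType k}.
Context (act : weak_action H A) (f : {linear tensor H H -> A}).

(* Formal k-linear combinations of words over A, standing for elements of the
   reduced tensor powers of A/k; they are only evaluated under normalized
   multilinear maps, with [feval]. Addition is concatenation of the sequences. *)
Definition fsum := seq (k * seq A).

Definition fscale (c : k) (t : fsum) : fsum := [seq (c * x.1, x.2) | x <- t].

Definition fcat (t t' : fsum) : fsum :=
  [seq (x.1 * y.1, x.2 ++ y.2) | x <- t, y <- t'].

Definition fword (a : seq A) : fsum := [:: (1, a)].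

Definition feval (N : lmodType k) (g : seq A -> N) (t : fsum) : N :=
  \sum_(x <- t) x.1 *: g x.2.

Local Notation "\fsum_ ( i <- r ) F" := (\big[cat/[::]]_(i <- r) F)
  (at level 41, F at level 41, i, r at level 50).
Local Notation "\fsum_ ( m <= i < n ) F" := (\big[cat/[::]]_(m <= i < n) F)
  (at level 41, F at level 41, i, m, n at level 50).

(* a^{\overline h} for words h over H and a = a_1 (x) ... (x) a_r, that is
   a_1^{\overline{h^(1)}} (x) ... (x) a_r^{\overline{h^(r)}}; the empty tensor
   absorbs h through the counit. For a single element, a^h is [tact [:: h] a]. *)
Fixpoint tact (h : seq H) (a : seq A) : fsum :=
  if a is a1 :: a' then
    \fsum_(p <- wsw h) fcat (fword [:: wact act p.1 a1]) (tact p.2 a')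
  else [:: (weps h, [::])].

(* The sum of the f(h_j^(1), h_{j+1}^(1))^{\overline{h_{1,j-1}^(1)}} paired with
   h_{1,j-1}^(2) (x) h_j^(2) h_{j+1}^(2) (x) h_{j+2,l}, where l = size h and
   1 <= j < l. *)
Definition contract (j : nat) (h : seq H) : seq (A * seq H) :=
  \big[cat/[::]]_(p <- wsw (take j.-1 h))
    [seq (wact act p.1 (f (x.1 ⊗ y.1)), p.2 ++ x.2 * y.2 :: drop j.+1 h)
       | x <- sw h`_j.-1, y <- sw h`_j].

Definition F2 (h : seq H) (a : seq A) : fsum :=
  if a is [::] then [:: (-1, [:: f (h`_0 ⊗ h`_1)])]
  else
    \fsum_(0 <= i < (size a).+1) \fsum_(p <- wsw h) \fsum_(q <- wsw p.2)
      fscale ((-1) ^+ i.+1)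
        (fcat (tact p.1 (take i a))
           (fcat (fword [:: f (q.1`_0 ⊗ q.1`_1)])
              (tact [:: \prod_(x <- q.2) x] (drop i a)))).

(* [Fmap l h a] is F^(l)_r (h (x) a), for size h = l >= 2 and r = size a. *)
Fixpoint Fmap (l : nat) (h : seq H) (a : seq A) : fsum :=
  match l with
  | 0 | 1 => [::]
  | 2 => F2 h a
  | l'.+1 =>
    if a is [::] then
      \fsum_(1 <= j < l) \fsum_(c <- contract j h)
        fscale ((-1) ^+ j) (fcat (fword [:: c.1]) (Fmap l' c.2 [::]))
    else
      \fsum_(1 <= j < l) \fsum_(0 <= i < (size a).+1)
        \fsum_(p <- wsw h) \fsum_(c <- contract j p.2)
          fscale ((-1) ^+ (i * l' + j))
            (fcat (tact p.1 (take i a))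
               (fcat (fword [:: c.1]) (Fmap l' c.2 (drop i a))))
  end.

End FMaps.

Section XHat.
Context {k : comNzRingType} {H : hopfAlgType k} {A : algType k}.
Context {act : weak_action H A} {f : {linear tensor H H -> A}} {E : algType k}.
Context (cp : crossed_product act f E) {M : lmodType k} (bM : bimodule E M).

Local Notation "a # h" := (sharp cp a h) (at level 40).
Local Notation "x *l m" := (lact bM x m) (at level 40).
Local Notation "m *r x" := (ract bM m x) (at level 40).

(* The sum over s >= i, r + s = n of the Hom_k((H/k)^{⊗ s} ⊗ (A/k)^{⊗ r}, M):
   its elements are maps on pairs (h, a) of words, whose component of bidegree
   (s, r) is the restriction to size h = s, size a = r. *)
Definition xP (i n : nat) (phi : seq H -> seq A -> M) : Prop :=
  [/\ forall a, multilin (phi ^~ a) /\ normalized (phi ^~ a),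
      forall h, multilin (phi h) /\ normalized (phi h)
    & forall h a, ~~ ((i <= size h) && (size h + size a == n))%N -> phi h a = 0].

Definition xfil i n : {pred (seq H -> seq A -> M)} := [pred phi | `[< xP i n phi >]].

Let xfil_closed i n : GRing.subsemimod_closed (xfil i n).
Proof.
split; first split.
- by apply/asboolP; split=> // [a|h]; split=> // u v c x y;
    apply: esym; rewrite -[X in _ = X](scaler0 _ c); exact: addr0.
- move=> g g' /asboolP[gh ga gs] /asboolP[gh' ga' gs']; apply/asboolP.
  have D h a : (g + g') h a = g h a + g' h a by [].
  split=> [a|h|h a hs].
  + have [gm g1] := gh a; have [gm' g1'] := gh' a.
    by split=> u v *; rewrite !D (gm, g1) (gm', g1') ?addr0 // scalerDr addrACA.
  + have [gm g1] := ga h; have [gm' g1'] := ga' h.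
    by split=> u v *; rewrite !D (gm, g1) (gm', g1') ?addr0 // scalerDr addrACA.
  + by rewrite D gs // gs' // addr0.
- move=> c g /asboolP[gh ga gs]; apply/asboolP.
  have D h a : (c *: g) h a = c *: g h a by [].
  split=> [a|h|h a hs].
  + have [gm g1] := gh a.
    by split=> u v *; rewrite !D (gm, g1) ?scaler0 // scalerDr !scalerA mulrC.
  + have [gm g1] := ga h.
    by split=> u v *; rewrite !D (gm, g1) ?scaler0 // scalerDr !scalerA mulrC.
  + by rewrite D gs // scaler0.
Qed.
HB.instance Definition _ i n :=
  GRing.isSubmodClosed.Build k (seq H -> seq A -> M) (xfil i n) (xfil_closed i n).

Section Differential.
Variables (phi : seq H -> seq A -> M) (h : seq H) (a : seq A).
Let s := size h.
Let r := size a.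

Definition xd0 : M :=
  if a is a1 :: a' then
    \sum_(p <- wsw h) (wact act p.1 a1 # 1) *l phi p.2 a'
    + (-1) ^+ r *: (phi h (take r.-1 a) *r (a`_r.-1 # 1))
    + \sum_(1 <= i < r)
        (-1) ^+ i *: phi h (take i.-1 a ++ a`_i.-1 * a`_i :: drop i.+1 a)
  else 0.

Definition xd1 : M :=
  if h is h1 :: h' then
    (-1) ^+ r *: ((1 # h1) *l phi h' a)
    + (-1) ^+ (r + s) *: \sum_(x <- sw h`_s.-1)
        (feval (phi (take s.-1 h)) (tact act [:: x.1] a) *r (1 # x.2))
    + \sum_(1 <= i < s) (-1) ^+ (r + i) *:
        \sum_(c <- contract act f i h) ((c.1 # 1) *l phi c.2 a)
  else 0.

Definition xdl (l : nat) : M :=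
  (-1) ^+ (l * (r + s)) *: \sum_(p <- wsw (drop (s - l) h))
     (feval (phi (take (s - l) h)) (Fmap act f l p.1 a) *r (1 # \prod_(x <- p.2) x)).

(* The sum of the d_l over 0 <= l <= s: [xd0] vanishes for r = 0 and [xd1] for
   s = 0, which are the cases where that component is absent. *)
Definition xdif_fun : M :=
  xd0 + xd1 + \sum_(2 <= l < s.+1) xdl l.

End Differential.

Let X := seq H -> seq A -> M.
Let lin (T : X -> M) := forall c g g', T (c *: g + g') = c *: T g + T g'.

Let lin_add T T' : lin T -> lin T' -> lin (fun g => T g + T' g).
Proof. by move=> LT LT' c g g'; rewrite LT LT' scalerDr addrACA. Qed.
Let lin_sum I (r : seq I) (T : I -> X -> M) :
  (forall i, lin (T i)) -> lin (fun g => \sum_(i <- r) T i g).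
Proof.
by move=> LT c g g'; rewrite scaler_sumr -big_split; apply: eq_bigr => i _; exact: LT.
Qed.
Let lin_scale e T : lin T -> lin (fun g => e *: T g).
Proof. by move=> LT c g g'; rewrite LT scalerDr !scalerA mulrC. Qed.
Let lin_lact x T : lin T -> lin (fun g => x *l T g).
Proof. by move=> LT c g g'; rewrite LT linearPr. Qed.
Let lin_ract x T : lin T -> lin (fun g => T g *r x).
Proof. by move=> LT c g g'; rewrite LT linearPl. Qed.
Let lin_app h a : lin (fun g => g h a). Proof. by []. Qed.
Let lin_feval h t : lin (fun g => feval (g h) t).
Proof. by apply: lin_sum => x; exact: lin_scale. Qed.

Let xd0_lin h a : lin (fun g => xd0 g h a).
Proof.
case: a => [|a1 a'] /=; first by move=> *; rewrite scaler0 addr0.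
apply: lin_add; last by apply: lin_sum => i; exact: lin_scale.
apply: lin_add; last by apply: lin_scale; exact: lin_ract.
by apply: lin_sum => p; exact: lin_lact.
Qed.

Let xd1_lin h a : lin (fun g => xd1 g h a).
Proof.
case: h => [|h1 h'] /=; first by move=> *; rewrite scaler0 addr0.
apply: lin_add; last first.
  by apply: lin_sum => i; apply: lin_scale; apply: lin_sum => c; exact: lin_lact.
apply: lin_add; first by apply: lin_scale; exact: lin_lact.
by apply: lin_scale; apply: lin_sum => x; apply: lin_ract; exact: lin_feval.
Qed.

Let xdl_lin h a l : lin (fun g => xdl g h a l).
Proof.
by apply: lin_scale; apply: lin_sum => p; apply: lin_ract; exact: lin_feval.
Qed.

Definition xdif (phi : seq H -> seq A -> M) : seq H -> seq A -> M := xdif_fun phi.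

Let xdif_linear : linear xdif.
Proof.
move=> c g g'; apply/funext => h; apply/funext => a.
suff: lin (fun g => xdif_fun g h a) by exact.
apply: lin_add; last by apply: lin_sum => l; exact: xdl_lin.
by apply: lin_add.
Qed.
HB.instance Definition _ := GRing.isLinear.Build k
  (seq H -> seq A -> M) (seq H -> seq A -> M) _ xdif xdif_linear.

Definition xhat : filtered_precomplex k :=
  FilteredPrecomplex (fcpx := Precomplex (fun n => xfil 0 n) xdif)
    (fun i n => xfil i n).

End XHat.

(* Main.v *)
(* The normalized Hochschild complex C of E is mapped to X = Xhat by a comparison map
   Phi, which evaluates a cochain on words over E produced from the left to the right out
   of a pair of words (h, a): the next letter is either a_1^h # 1, or 1 # h_1, or the value
   f(h_i, h_(i+1)) of the cocycle when h_i and h_(i+1) are merged. Phi turns the Hochschild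
   differential into that of X: the merges of consecutive letters cancel by a
   Maurer-Cartan identity for these words, the terms in which the last letter acts on M are
   sorted by the final block of letters of h multiplied together, and a block of l letters
   yields F^(l).

   Phi maps F_p C onto F_p X, so d d = 0 in X is inherited from C. The spectral sequences
   are isomorphic because the kernel of Phi is acyclic on each F_p / F_(p+1): modulo
   coboundaries of elements of the kernel, obtained by splitting a letter a # h into a # 1
   and 1 # h, a cochain of F_p that is a cocycle modulo F_(p+1) vanishes on the words with
   p letters outside A unless these come first; on the remaining words, the cocycle
   condition makes it balanced over A, hence determined by its image in X. *)
Require Import Defs.
From HB Require Import structures.
From mathcomp Require Import all_boot all_algebra.
From mathcomp Require Import boolp functions zify ring.

Set Implicit Arguments.
Unset Strict Implicit.
Unset Printing Implicit Defensive.

Import GRing.Theory.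
Local Open Scope ring_scope.
Local Open Scope quotient_scope.

(** * Subquotients and filtered surjections *)

(** The obstacle is the tangle of iterated actions, values of f and Sweedler components in Xhat. It
    is avoided by computing in E ⊗_A ... ⊗_A E: balanced maps on words e, x_1, ..., x_s over E
    correspond to maps on E x H^s ([NF], [NF_ones], [NF_universal]). There a step of [Phi] is one of
    two operations on the word 1, 1 # h_1, ..., 1 # h_s: right multiplication by a_1 # 1, or the
    merge of two neighbours, where the merge with the leading 1 is the emission of 1 # h_1 ([PhiS]).
    The relations between f and the weak action then enter only as associativity of E. The maps
    F^(l) are recognized by their own recursion, whose index i counts the letters of a consumed
    before the first merge. They forget the letter in which the block ends; this is a counit, and
    colinearity of the merges restores the letter from h^(2). Pages are compared on representatives:
    as Phi is onto on every F_p and its kernel is acyclic, cochains of Xhat lift with control of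
    their differentials. The abutment is filtered on the side of C, where it is Hochschild
    cohomology by definition. *)

Section QuotientMaps.
Context {k : comNzRingType}.

Lemma submodN (V : lmodType k) (S : submodClosed V) x : x \in S -> - x \in S.
Proof. by move=> Sx; rewrite -scaleN1r rpredZ. Qed.

Lemma submodB (V : lmodType k) (S : submodClosed V) x y :
  x \in S -> y \in S -> x - y \in S.
Proof. by move=> Sx Sy; rewrite rpredD // submodN. Qed.

Section Subquotient.
Variables (V : lmodType k) (Z B : submodClosed V).

Lemma subcls_linear a x y (Zx : x \in Z) (Zy : y \in Z) (Zxy : a *: x + y \in Z) :
  subcls B Zxy = a *: subcls B Zx + subcls B Zy.
Proof.
have -> : a *: subcls B Zx = \pi_(quotmod (@Defs.subpred k V Z B)) (a *: Submod Zx).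
  exact: (esym (pi_qscale _ a _)).
rewrite /subcls -pi_qadd; congr (\pi_(quotmod (@Defs.subpred k V Z B)) _).
exact: val_inj.
Qed.

Lemma subcls_surj (c : subquo Z B) : exists x (Zx : x \in Z), c = subcls B Zx.
Proof. by exists (val (repr c)), (valP (repr c)); rewrite subcls_repr. Qed.

Lemma subcls_eq x y (Zx : x \in Z) (Zy : y \in Z) :
  x - y \in B -> subcls B Zx = subcls B Zy.
Proof. by move/subclsP. Qed.

Lemma subcls0 x (Zx : x \in Z) : x \in B -> subcls B Zx = 0.
Proof.
move=> Bx; have Z0 : (0 : V) \in Z by rewrite rpred0.
have -> : subcls B Zx = subcls B Z0 by apply: subcls_eq; rewrite subr0.
rewrite /subcls -[RHS](raddf0 (\pi_(quotmod (@Defs.subpred k V Z B)))).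
by congr (\pi_(quotmod (@Defs.subpred k V Z B)) _); exact: val_inj.
Qed.

End Subquotient.

Section Induced.
Variables (V W : lmodType k) (Z B : submodClosed V) (Z' B' : submodClosed W).
Variable R : V -> W -> Prop.
Hypotheses
  (Rlin : forall a x y x' y', R x x' -> R y y' -> R (a *: x + y) (a *: x' + y'))
  (RZ : forall x, x \in Z -> exists2 y, y \in Z' & R x y)
  (RB : forall x y, x \in Z -> x \in B -> R x y -> y \in B').

Let RsubB x y x' y' (Zx : x \in Z) (Zy : y \in Z) :
  R x x' -> R y y' -> x - y \in B -> x' - y' \in B'.
Proof.
move=> Rx Ry Bxy.
have -> : x' - y' = (-1) *: y' + x' by rewrite scaleN1r addrC.
apply: (@RB ((-1) *: y + x)); last exact: Rlin.
  by rewrite rpredD // rpredZ.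
by rewrite scaleN1r addrC.
Qed.

(** Representatives are matched by a linear relation rather than a map, because passing to a
    cohomology class or restricting a cochain to one column makes sense only on part of the ambient
    module. *)
Lemma subquo_map_exists : exists phi : {linear subquo Z B -> subquo Z' B'},
  forall x x' (Zx : x \in Z) (Zx' : x' \in Z'), R x x' ->
    phi (subcls B Zx) = subcls B' Zx'.
Proof.
have rep (c : subquo Z B) : exists x' : submod Z', R (val (repr c)) (val x').
  by have [y Zy Ry] := RZ (valP (repr c)); exists (Submod Zy).
pose m c := subcls B' (valP (sval (cid (rep c)))).
have mE x x' (Zx : x \in Z) (Zx' : x' \in Z') : R x x' ->
    m (subcls B Zx) = subcls B' Zx'.
  move=> Rx; apply: subcls_eq.
  apply: (RsubB (valP (repr (subcls B Zx))) Zx (svalP (cid (rep _))) Rx).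
  by have /subclsP := subcls_repr (subcls B Zx).
have ml : linear m.
  move=> a c c'.
  have [x [Zx ->]] := subcls_surj c; have [y [Zy ->]] := subcls_surj c'.
  have Zxy : a *: x + y \in Z by rewrite rpredD // rpredZ.
  have [x' Zx' Rx] := RZ Zx; have [y' Zy' Ry] := RZ Zy.
  have Zxy' : a *: x' + y' \in Z' by rewrite rpredD // rpredZ.
  rewrite -(subcls_linear B Zx Zy Zxy) (mE _ _ _ Zx' Rx) (mE _ _ _ Zy' Ry).
  by rewrite (mE _ _ _ Zxy') ?(subcls_linear B' Zx' Zy' Zxy') //; exact: Rlin.
by exists (HB.pack_for {linear subquo Z B -> subquo Z' B'} m
  (GRing.isLinear.Build k (subquo Z B) (subquo Z' B') _ m ml)).
Qed.

Lemma subquo_map_bij (phi : subquo Z B -> subquo Z' B') :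
  (forall x x' (Zx : x \in Z) (Zx' : x' \in Z'), R x x' ->
     phi (subcls B Zx) = subcls B' Zx') ->
  (forall y, y \in Z' -> exists2 x, x \in Z & exists2 y', R x y' & y' - y \in B') ->
  (forall x y, x \in Z -> R x y -> y \in B' -> x \in B) -> bijective phi.
Proof.
move=> phiE fs fi.
have inj : injective phi.
  move=> c c'.
  have [x [Zx ->]] := subcls_surj c; have [y [Zy ->]] := subcls_surj c'.
  have [x' Zx' Rx] := RZ Zx; have [y' Zy' Ry] := RZ Zy.
  rewrite (phiE _ _ _ Zx' Rx) (phiE _ _ _ Zy' Ry) => /subclsP Bxy.
  apply: subcls_eq; apply: (fi _ (x' - y')) => //; first exact: submodB.
  have -> : x - y = (-1) *: y + x by rewrite scaleN1r addrC.
  have -> : x' - y' = (-1) *: y' + x' by rewrite scaleN1r addrC.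
  exact: Rlin.
have sur d : exists c, phi c = d.
  have [y [Zy ->]] := subcls_surj d; have [x Zx [y' Ry' By']] := fs y Zy.
  have [y'' Zy'' Ry''] := RZ Zx.
  exists (subcls B Zx); rewrite (phiE _ _ _ Zy'' Ry''); apply: subcls_eq.
  have -> : y'' - y = (y'' - y') + (y' - y) by rewrite addrA subrK.
  rewrite rpredD //; apply: (RsubB Zx Zx) => //; rewrite subrr; exact: rpred0.
exists (fun d => sval (cid (sur d))) => [c|d]; last exact: (svalP (cid (sur d))).
by apply: inj; exact: (svalP (cid (sur _))).
Qed.

End Induced.

Lemma linear_bij_inv (V W : lmodType k) (f : {linear V -> W}) : bijective f ->
  exists g : {linear W -> V}, cancel f g /\ cancel g f.
Proof.
move=> [g fK gK].
have gl : linear g by move=> a x y; apply: (can_inj fK); rewrite linearP !gK.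
by exists (HB.pack_for {linear W -> V} g (GRing.isLinear.Build k W V _ g gl)).
Qed.

End QuotientMaps.

(** * Filtered surjections whose kernel is acyclic on the graded pieces *)

Section FilteredSurjection.
Context {k : comNzRingType} (K X : filtered_precomplex k).
Hypothesis cK : is_filtered_complex K.
Hypothesis X0 : forall n, fil X 0 n =i cdeg X n.
Hypothesis XS : forall i n, {subset fil X i.+1 n <= fil X i n}.
Variable Phi : {linear cmod K -> cmod X}.
Local Notation d := (cdif K).
Hypothesis PhiF : forall p n x, x \in fil K p n -> Phi x \in fil X p n.
Hypothesis PhiS : forall p n y, y \in fil X p n -> exists2 x, x \in fil K p n & Phi x = y.
Hypothesis Phid : forall n x, x \in cdeg K n -> Phi (d x) = cdif X (Phi x).
(** Acyclicity of the kernel on the p-th graded piece, stated on representatives. The element [t] is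
    killed by Phi itself and not merely modulo F_(p+1), so that the corrections made on successive
    pieces can be added. *)
Hypothesis Phiker : forall p n x, x \in fil K p n -> d x \in fil K p.+1 n.+1 ->
  Phi x \in fil X p.+1 n ->
  exists t, [/\ if n is m.+1 then t \in fil K p m else t = 0, Phi t = 0
              & x - d t \in fil K p.+1 n].

Lemma fil_le (Y : filtered_precomplex k) :
  (forall i n, {subset fil Y i.+1 n <= fil Y i n}) ->
  forall i j n, (i <= j)%N -> {subset fil Y j n <= fil Y i n}.
Proof.
move=> YS i j n /subnK<- x; elim: (j - i)%N => //= m IH.
by rewrite addSn => /YS.
Qed.
Let Kle := fil_le (filS cK).
Let Xle := fil_le XS.
Let Kdeg p n x : x \in fil K p n -> x \in cdeg K n.
Proof. by rewrite -(fil0 cK); exact: Kle. Qed.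

Lemma surj_is_filtered_complex : is_filtered_complex X.
Proof.
split=> // [n x|n x|i n x].
- rewrite -!X0 => /PhiS[y Fy <-]; rewrite -(Phid (Kdeg Fy)); apply: PhiF.
  exact: cdif_fil.
- rewrite -X0 => /PhiS[y Fy <-]; rewrite -(Phid (Kdeg Fy)).
  have Fdy := cdif_fil cK Fy; rewrite -(Phid (Kdeg Fdy)).
  by rewrite (cdifK cK (Kdeg Fy)) raddf0.
- move=> /PhiS[y Fy <-]; rewrite -(Phid (Kdeg Fy)); apply: PhiF.
  exact: cdif_fil.
Qed.

(** F_p in degree n - 1, where degree -1 is the zero module. *)
Definition degpred p n (t : cmod K) := if n is m.+1 then t \in fil K p m else t = 0.

Let degpred_dd p n t : degpred p n t -> d (d t) = 0.
Proof.
case: n => [|n] /=; first by move=> ->; rewrite !raddf0.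
by move=> /Kdeg; exact: cdifK.
Qed.
Let degpred_d p n t : degpred p n t -> d t \in fil K p n.
Proof.
case: n => [|n] /=; first by move=> ->; rewrite raddf0 rpred0.
exact: cdif_fil.
Qed.
Let degpred_Phid p n t : degpred p n t -> Phi (d t) = cdif X (Phi t).
Proof.
case: n => [|n] /=; first by move=> ->; rewrite !raddf0.
by move=> /Kdeg; exact: Phid.
Qed.
Let degpredD p n t t' : degpred p n t -> degpred p n t' -> degpred p n (t + t').
Proof. by case: n => [->->|n] /=; [exact: addr0|exact: rpredD]. Qed.
Let degpred_le p p' n t : (p <= p')%N -> degpred p' n t -> degpred p n t.
Proof. by case: n => //= n pp'; exact: Kle. Qed.

(** Iteration of [Phiker] over the m - p graded pieces. Subtracting d t changes neither the
    differential nor, as Phi t = 0, the image under Phi, so the hypotheses persist. *)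
Lemma kernel_acyclic p m n x : (p <= m)%N -> x \in fil K p n ->
  d x \in fil K m n.+1 -> Phi x \in fil X m n ->
  exists t, [/\ degpred p n t, Phi t = 0 & x - d t \in fil K m n].
Proof.
move=> /subnK; move: (m - p)%N => e <-; elim: e p x => [|e IH] p x.
  move=> Fx _ _; exists 0; rewrite !raddf0 addr0 add0n; split=> //.
  by rewrite /degpred; case: n {Fx} => //= n; rewrite rpred0.
move=> Fx Fdx FPx; have lep : (p.+1 <= e.+1 + p)%N by rewrite addSn ltnS leq_addl.
have [t [Ft Pt xt]] := Phiker Fx (Kle lep Fdx) (Xle lep FPx).
have := IH p.+1 (x - d t) xt.
rewrite addnS -addSn !raddfB /= (degpred_dd Ft) (degpred_Phid Ft) Pt !raddf0 !addr0.
move=> /(_ Fdx FPx)[u [Fu Pu xu]]; exists (t + u); split.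
- by apply: degpredD => //; exact: degpred_le Fu.
- by rewrite raddfD /= Pt Pu addr0.
- by rewrite raddfD opprD addrA.
Qed.

(** A first lift x of y has d x only in F_p. As Phi (d x) lies in F_(p+q), acyclicity applied to the
    cocycle d x gives a correction of x by an element of the kernel. *)
Lemma Zpage_lift q p n y : y \in Zpage X q p n ->
  exists2 x, x \in Zpage K q p n & Phi x = y.
Proof.
move=> /andP[Fy Fdy]; have [x Fx Pxy] := PhiS Fy.
have Fdx := cdif_fil cK Fx.
have Pdx : Phi (d x) = cdif X y by rewrite (Phid (Kdeg Fx)) Pxy.
have [||t [Ft Pt xt]] := @kernel_acyclic p (p + q) n.+1 (d x) (leq_addr _ _) Fdx.
- by rewrite (cdifK cK (Kdeg Fx)) rpred0.
- by rewrite Pdx.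
exists (x - t); last by rewrite raddfB /= Pt subr0.
by rewrite inE raddfB xt submodB.
Qed.

Lemma Zpage_map q p n x : x \in Zpage K q p n -> Phi x \in Zpage X q p n.
Proof.
move=> /andP[Fx Fdx]; rewrite inE (PhiF Fx) -(Phid (Kdeg Fx)); exact: PhiF.
Qed.

Lemma Bpage_map q p n x : x \in Bpage K q p n -> Phi x \in Bpage X q p n.
Proof.
move=> /asboolP[z [y [-> Fz Fdz Fy Fdy]]]; apply/asboolP; exists (Phi z), (Phi y).
have E : Phi (d y) = cdif X (Phi y).
  case: n Fy {Fz Fdz Fdy} => [->|n]; first by rewrite !raddf0.
  by move=> /Kdeg; exact: Phid.
rewrite raddfD -E -(Phid (Kdeg Fz)) !PhiF //; split=> //.
by case: n Fy {Fz Fdz Fdy} => [->|n]; [rewrite raddf0|exact: PhiF].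
Qed.

(** Both terms of Phi x = z + d y are lifted. The remainder is in the kernel of Phi, and a
    coboundary d t moves it from F_(p+1-q) into F_(p+q), which is contained in F_(p+1) because q >
    0. *)
Lemma Bpage_reflect q p n x : (0 < q)%N -> x \in Zpage K q p n ->
  Phi x \in Bpage X q p n -> x \in Bpage K q p n.
Proof.
move=> q0 /andP[Fx Fdx] /asboolP[z [y [Pxy Fz Fdz Fy Fdy]]].
have ppq : (p.+1 + q.-1 = p + q)%N by case: q q0 {Fdx Fdz Fy} => // q _; rewrite addSnnS.
have Zz : z \in Zpage X q.-1 p.+1 n by rewrite inE Fz ppq.
have [z' Zz' Pz'] := Zpage_lift Zz.
have /andP[Fz' Fdz'] := Zz'; rewrite ppq in Fdz'.
have [y' Fy' Py'] : exists2 y', degpred (p.+1 - q) n y' & Phi y' = y.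
  case: n Fy {Fx Fdx Fz Fdz Fdy Zz Zz' Pz' Fz' Fdz'} => [->|n]; last exact: PhiS.
  by exists 0; rewrite ?raddf0.
have lep : (p.+1 - q <= p)%N by case: q q0 {Fdx Fdz Fy Zz Zz' Fdz' ppq Fy'} => // q _; rewrite subSS leq_subr.
have leq : (p.+1 - q <= p + q)%N by rewrite (leq_trans lep) ?leq_addr.
have := @kernel_acyclic _ _ n (x - z' - d y') leq.
case=> [||| t [Ft Pt xt]].
- by rewrite !submodB ?(Kle _ Fx) ?(Kle _ Fz') ?(leq_trans lep) ?(degpred_d Fy').
- by rewrite !raddfB /= (degpred_dd Fy') subr0 submodB.
- rewrite !raddfB /= (degpred_Phid Fy') Py' Pz' Pxy addrAC addrK subrr; exact: rpred0.
have dytE : d (y' + t) = x - z' - (x - z' - d y' - d t).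
  by rewrite raddfD -[x - z' - d y' - d t]addrA opprD addrA subrr sub0r opprD !opprK.
apply/asboolP; exists (z' + (x - z' - d y' - d t)), (y' + t); split.
- by rewrite dytE [RHS]addrC -[X in X + _]addrA -opprD subrK.
- by rewrite rpredD // (Kle _ xt) // -ppq leq_addr.
- rewrite raddfD rpredD // !raddfB /= (degpred_dd Fy') (degpred_dd Ft) !subr0.
  exact: submodB.
- exact: degpredD.
- have xt' : x - z' - d y' - d t \in fil K p n by apply: (Kle _ xt); exact: leq_addr.
  rewrite dytE; apply: submodB => //; apply: submodB => //; exact: (Kle _ Fz').
Qed.

Lemma page_map_exists q p n : exists phi : {linear page K q p n -> page X q p n},
  forall x x' (Zx : x \in Zpage K q p n) (Zx' : x' \in Zpage X q p n),
    Phi x = x' -> phi (pcls Zx) = pcls Zx'.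
Proof.
apply: (subquo_map_exists (R := fun x x' => Phi x = x')).
- by move=> a x y _ _ <- <-; rewrite linearP.
- by move=> x Zx; exists (Phi x) => //; exact: Zpage_map.
- by move=> x _ _ Bx <-; exact: Bpage_map.
Qed.

Definition page_map q p n := sval (cid (page_map_exists q p n)).

Lemma page_mapE q p n x x' (Zx : x \in Zpage K q p n) (Zx' : x' \in Zpage X q p n) :
  Phi x = x' -> page_map q p n (pcls Zx) = pcls Zx'.
Proof. exact: (svalP (cid (page_map_exists q p n))). Qed.

Lemma page_map_bij q p n : (0 < q)%N -> bijective (page_map q p n).
Proof.
move=> q0; apply: (subquo_map_bij (R := fun x x' => Phi x = x')).
- by move=> a x y _ _ <- <-; rewrite linearP.
- by move=> x Zx; exists (Phi x) => //; exact: Zpage_map.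
- by move=> x _ _ Bx <-; exact: Bpage_map.
- by move=> x x' Zx Zx'; exact: page_mapE.
- move=> y /Zpage_lift[x Zx <-]; exists x => //; exists (Phi x) => //.
  rewrite subrr; exact: rpred0.
- by move=> x _ Zx <-; exact: Bpage_reflect.
Qed.

Lemma surj_sseq_iso (cX : is_filtered_complex X) : sseq_iso cK cX.
Proof.
exists page_map => q p n q1; split; first exact: page_map_bij.
- move=> c; have [x [Zx ->]] := subcls_surj c.
  rewrite -/(pcls Zx) (page_mapE Zx (Zpage_map Zx) erefl) !page_difE.
  apply: page_mapE; apply: (Phid (n := n)).
  by case/andP: Zx => /Kdeg.
- move=> x Zx Zx1 x' Zx' Zx1'; rewrite (page_mapE Zx (Zpage_map Zx) erefl) (page_mapE Zx1 (Zpage_map Zx1) erefl) => /subclsP.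
  case/asboolP=> z [y [xx' Fz Fdz Fy Fdy]]; apply: subcls_eq; apply/asboolP.
  exists z, y; split=> //.
    (* Only the bound on d z has to improve, from F_(p+q) to F_(p+q+1). It does because d z = d (Phi
       x) - d x', and both representatives are in Z_(q+1). *)
    have -> : z = Phi x - x' - cdif X y by rewrite xx' addrK.
    have ddy : cdif X (cdif X y) = 0.
      case: n {Zx Zx1 Zx' Zx1' Fz Fdz Fdy} Fy => [->|n Fy]; first by rewrite !raddf0.
      by apply: (cdifK cX (n := n)); rewrite -X0; apply: (Xle _ Fy).
    rewrite !raddfB /= ddy subr0; apply: submodB.
      by have /andP[] := Zpage_map Zx1.
    by have /andP[] := Zx1'.
  case: n {Zx Zx1 Zx' Zx1' Fz Fdz Fdy} Fy => [->|n Fy] //.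
  by apply: (Xle _ Fy); rewrite leq_sub2l.
Qed.

Hypothesis Kn : forall p n x, (n < p)%N -> x \in fil K p n -> x = 0.

(** * The filtration of the cohomology and its graded pieces *)

Section Convergence.
Variable n : nat.

Definition cohom_fil p : {pred cohom K n} :=
  [pred c | `[< exists x (Zx : x \in cocycle K n),
                  x \in fil K p n /\ c = subcls (coboundary K n) Zx >]].

Let cohom_fil_closed p : GRing.subsemimod_closed (cohom_fil p).
Proof.
split; first split.
- apply/asboolP; have Z0 : 0 \in cocycle K n by rewrite rpred0.
  exists 0, Z0; rewrite rpred0; split=> //; apply/esym/subcls0; exact: rpred0.
- move=> _ _ /asboolP[x [Zx [Fx ->]]] /asboolP[y [Zy [Fy ->]]].
  have Zxy : 1 *: x + y \in cocycle K n by rewrite rpredD ?rpredZ.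
  apply/asboolP; exists (1 *: x + y), Zxy.
  by rewrite (subcls_linear _ Zx Zy) scale1r rpredD // scale1r.
- move=> a _ /asboolP[x [Zx [Fx ->]]]; have Z0 : 0 \in cocycle K n by rewrite rpred0.
  have Zxy : a *: x + 0 \in cocycle K n by rewrite rpredD ?rpredZ.
  apply/asboolP; exists (a *: x + 0), Zxy.
  rewrite (subcls_linear _ Zx Z0) (subcls0 Z0) ?rpred0 // !addr0; split=> //.
  by rewrite rpredZ.
Qed.
HB.instance Definition _ p :=
  GRing.isSubmodClosed.Build k (cohom K n) (cohom_fil p) (cohom_fil_closed p).

(** The bound p < q turns F_(p+1-q) into F_0, so B_q contains every coboundary lying in F_p; the
    bound n + 1 < p + q makes F_(p+q) vanish in degree n + 1, so Z_q consists of cocycles. *)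
Lemma cohom_fil_gr q p : (p < q)%N -> (n.+1 < p + q)%N ->
  exists psi : {linear page K q p n -> subquo (cohom_fil p) (cohom_fil p.+1)},
    bijective psi.
Proof.
move=> pq npq.
have Zc x : x \in Zpage K q p n -> x \in cocycle K n.
  by move=> /andP[Fx Fdx]; rewrite inE (Kdeg Fx) (Kn npq Fdx) eqxx.
pose R x (c : cohom K n) := exists Zx : x \in cocycle K n, c = subcls (coboundary K n) Zx.
have Rlin a x y x' y' : R x x' -> R y y' -> R (a *: x + y) (a *: x' + y').
  move=> [Zx ->] [Zy ->]; have Zxy : a *: x + y \in cocycle K n.
    by rewrite rpredD // rpredZ.
  by exists Zxy; rewrite (subcls_linear _ Zx Zy).
have RZ x : x \in Zpage K q p n -> exists2 c, c \in cohom_fil p & R x c.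
  move=> Zx; exists (subcls (coboundary K n) (Zc x Zx)); last by exists (Zc x Zx).
  by apply/asboolP; exists x, (Zc x Zx); split=> //; have /andP[] := Zx.
have RB x c : x \in Zpage K q p n -> x \in Bpage K q p n -> R x c -> c \in cohom_fil p.+1.
  move=> _ /asboolP[z [y [xE Fz Fdz Fy Fdy]]] [Zx ->].
  have Zz : z \in cocycle K n by rewrite inE (Kdeg Fz) (Kn npq Fdz) eqxx.
  apply/asboolP; exists z, Zz; split=> //; apply: subcls_eq.
  rewrite xE addrAC subrr add0r; apply/asboolP.
  case: n Fy {Zx xE Fz Fdz Fdy Zz npq} => [->|m Fy]; first by rewrite raddf0.
  by exists y => //; exact: Kdeg Fy.
have [psi psiE] := subquo_map_exists Rlin RZ RB.
exists psi; apply: (subquo_map_bij Rlin RZ RB psiE).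
- move=> _ /asboolP[x [Zx [Fx ->]]]; exists x.
    by rewrite inE Fx; have /andP[_ /eqP->] := Zx; rewrite rpred0.
  exists (subcls (coboundary K n) Zx); first by exists Zx.
  by rewrite subrr rpred0.
- move=> x _ /andP[Fx Fdx] [Zx ->] /asboolP[y [Zy [Fy]]] /subclsP/asboolP Bxy.
  have /andP[_ /eqP dy] := Zy.
  have [t Ft xyt] : exists2 t, degpred 0 n t & x - y = d t.
    case: n Bxy {Zx Zy Fx Fdx Fy npq} => [->|m [t Ft ->]].
      by exists 0; rewrite ?raddf0.
    by exists t; rewrite //= (fil0 cK).
  apply/asboolP; exists y, t; rewrite dy rpred0 -xyt addrC subrK; split=> //.
    have -> : (p.+1 - q = 0)%N by apply/eqP; rewrite subn_eq0.
    by [].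
  by rewrite submodB // filS.
Qed.
End Convergence.

(** The abutment is the cohomology of K, filtered by the classes of cocycles in F_p; the pages of X
    are carried to those of K by the inverse of [page_map]. *)
Lemma surj_converges (cX : is_filtered_complex X) : converges cX (cohom K).
Proof.
move=> n; pose G p : submodClosed (cohom K n) := @cohom_fil n p; exists G; split.
- move=> c; have [x [Zx ->]] := subcls_surj c; apply/asboolP; exists x, Zx.
  by rewrite (fil0 cK); have /andP[] := Zx.
- move=> p c /asboolP[x [Zx [Fx ->]]]; apply/asboolP; exists x, Zx; split=> //.
  exact: (filS cK).
- exists n.+1 => c /asboolP[x [Zx [Fx ->]]].
  by apply: subcls0; rewrite (Kn _ Fx) ?rpred0.
(* This q exceeds p and makes p + q exceed n + 1, as [cohom_fil_gr] requires; beyond it the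
   differentials land in F_(p+q') of degree n + 1, which is zero. *)
move=> p; exists (p + n).+2; first by rewrite ltnS leqW // leq_addr.
split.
  move=> q' c; have [x [Zx ->]] := subcls_surj c => le; rewrite -/(pcls Zx) page_difE.
  have Xn m r y : (m < r)%N -> y \in fil X r m -> y = 0.
    by move=> mr /PhiS[t Ft <-]; rewrite (Kn mr Ft) raddf0.
  apply: subcls0; have /andP[_ Fdx] := Zx.
  have np : (n.+1 < p + q')%N.
    apply: leq_trans (leq_addl p q'); apply: leq_trans le.
    by rewrite !ltnS leq_addl.
  by rewrite (Xn _ _ _ np Fdx) rpred0.
have [psi psib] : exists psi : {linear page K (p + n).+2 p n ->
    subquo (@cohom_fil n p) (@cohom_fil n p.+1)}, bijective psi.
  apply: cohom_fil_gr; first by rewrite ltnS leqW // leq_addr.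
  by rewrite !addnS !ltnS addnA leq_addl.
have [phi [phiK Kphi]] := linear_bij_inv (@page_map_bij (p + n).+2 p n isT).
exists (psi \o phi); apply: bij_comp => //; exact: Bijective Kphi phiK.
Qed.

End FilteredSurjection.

(** * The Hochschild differential *)

Section Merges.
Context {k : comNzRingType} {B : algType k} {U : lmodType k}.
Implicit Types (g : seq B -> U) (w : seq B).

(* [mergesum g w] is the alternating sum, starting with the sign -, of the values
   of g on the words obtained from w by multiplying two consecutive letters. *)
Fixpoint mergesum g w : U :=
  if w is x :: w' then
    if w' is y :: v then - g (x * y :: v) - mergesum (fun u => g (x :: u)) w'
    else 0
  else 0.

Lemma mergesum_cons g x y v : mergesum g (x :: y :: v) =
  - g (x * y :: v) - mergesum (fun u => g (x :: u)) (y :: v).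
Proof. by []. Qed.

Lemma eq_mergesum g g' w : (forall u, (size u).+1 = size w -> g u = g' u) ->
  mergesum g w = mergesum g' w.
Proof.
elim: w g g' => // x [|y v] // IH g g' gg'.
rewrite !mergesum_cons gg' //; congr (_ - _); apply: IH => u su.
by apply: gg'; rewrite /= su.
Qed.

Lemma mergesumE g w : mergesum g w =
  \sum_(1 <= i < size w)
     (-1) ^+ i *: g (take i.-1 w ++ w`_i.-1 * w`_i :: drop i.+1 w).
Proof.
elim: w g => [|x [|y v] IH] g; [by rewrite big_geq|by rewrite big_geq|].
rewrite mergesum_cons IH [in RHS]big_ltn //= drop0 expr1 scaleN1r; congr (_ + _).
rewrite -sumrN [RHS]big_add1 /=; apply: eq_big_nat => -[|i] // _.
by rewrite -scaleNr [in RHS]exprS mulN1r.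
Qed.

Lemma mergesumD g g' w : mergesum (fun u => g u + g' u) w = mergesum g w + mergesum g' w.
Proof.
elim: w g g' => [|x [|y v] IH] g g'; rewrite ?addr0 //.
by rewrite !mergesum_cons IH !opprD addrACA.
Qed.

Lemma mergesumZ c g w : mergesum (fun u => c *: g u) w = c *: mergesum g w.
Proof.
elim: w g => [|x [|y v] IH] g; rewrite ?scaler0 //.
by rewrite !mergesum_cons IH scalerDr !scalerN.
Qed.

Lemma mergesumN g w : mergesum (fun u => - g u) w = - mergesum g w.
Proof.
elim: w g => [|x [|y v] IH] g; rewrite ?oppr0 //.
by rewrite !mergesum_cons IH opprD.
Qed.

Lemma mergesum_sum I (r : seq I) (g : I -> seq B -> U) w :
  mergesum (fun u => \sum_(i <- r) g i u) w = \sum_(i <- r) mergesum (g i) w.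
Proof.
elim: w g => [|x [|y v] IH] g; [by rewrite big1|by rewrite big1|].
rewrite mergesum_cons IH -!sumrN -big_split; exact: eq_bigr.
Qed.

Lemma mergesum0 w : mergesum (fun=> 0) w = 0.
Proof. by elim: w => [|x [|y v] IH] //; rewrite mergesum_cons IH oppr0 addr0. Qed.

(** The first merge avoids x, the second may use it. The pairs avoiding x twice cancel, and
    associativity turns the others into the merges of x * y :: v. *)
Lemma mergesum_head g x y v :
  mergesum (fun u => mergesum g (x :: u)) (y :: v) = - mergesum g (x * y :: v).
Proof.
elim: v g x y => [|z v IH] g x y; first by rewrite /= oppr0.
rewrite mergesum_cons.
rewrite (eq_mergesum (w := z :: v) (g' := fun u => - g (x * y :: u) +
  - mergesum (fun u => g (x :: u)) (y :: u))) //.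
rewrite mergesumD !mergesumN IH opprK opprD opprK.
by rewrite !mergesum_cons mulrA !opprD !opprK addrACA subrr addr0.
Qed.

Lemma mergesum_mergesum g w : mergesum (mergesum g) w = 0.
Proof.
case: w => [|x [|y v]] //.
by rewrite mergesum_cons mergesum_head opprK addNr.
Qed.

End Merges.

Section Multilinear.
Context {k : comNzRingType} {B : algType k} {U : lmodType k}.
Implicit Types (g : seq B -> U).

Lemma normalized_cons g x : normalized g -> normalized (fun u => g (x :: u)).
Proof. by move=> g1 u v; rewrite -cat_cons g1. Qed.

Lemma multilin_tail g x : multilin g -> multilin (fun u => g (x :: u)).
Proof. by move=> gm u v c y z; rewrite -!cat_cons gm. Qed.

Lemma multilin_consl g x y c w : multilin g ->
  g ((c *: x + y) :: w) = c *: g (x :: w) + g (y :: w).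
Proof. by move=> gm; have := gm [::] w c x y. Qed.

Lemma normalized_head g w : normalized g -> g (1 :: w) = 0.
Proof. by move=> g1; have := g1 [::] w. Qed.

Lemma multilin_Z g c : multilin g -> multilin (fun u => c *: g u).
Proof. by move=> gm u v a x y; rewrite gm scalerDr !scalerA mulrC. Qed.

Lemma multilin_sum I (r : seq I) (g : I -> seq B -> U) :
  (forall i, multilin (g i)) -> multilin (fun u => \sum_(i <- r) g i u).
Proof.
move=> gm u v c x y; rewrite scaler_sumr -big_split; apply: eq_bigr => i _; exact: gm.
Qed.

Lemma multilin_mul2 g x : multilin g ->
  multilin (fun u => if u is y :: v then g (x * y :: v) else 0).
Proof.
move=> gm [|z u] v c y y' /=; last by rewrite -!cat_cons gm.
by rewrite mulrDr -scalerAr multilin_consl.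
Qed.

Lemma mergesum_multilin g : multilin g -> multilin (mergesum g).
Proof.
move=> gm u; elim: u g gm => [|z u IH] g gm v c x y.
  case: v => [|t v]; first by rewrite /= scaler0 addr0.
  rewrite !cat0s !mergesum_cons mulrDl -scalerAl multilin_consl //.
  rewrite (eq_mergesum (g' := fun u => c *: g (x :: u) + g (y :: u))); last first.
    by move=> w _; exact: multilin_consl.
  by rewrite mergesumD mergesumZ scalerDr !scalerN !opprD addrACA.
have IH' := IH (fun u => g (z :: u)) (multilin_tail z gm) v c x y.
case: u {IH} IH' => [|t u]; rewrite ?cat_cons ?cat0s => IH'; rewrite !mergesum_cons IH'.
  rewrite mulrDr -scalerAr multilin_consl //.
  by rewrite scalerDr !scalerN !opprD addrACA.
by rewrite -!cat_cons gm scalerDr !scalerN !opprD addrACA.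
Qed.
End Multilinear.

Section Hochschild.
Context {k : comNzRingType} {B : algType k} {N : lmodType k} (bN : bimodule B N).
Implicit Types (g : seq B -> N) (w : seq B).

(* The Hochschild differential without its first term. *)
Fixpoint tdif g w : N :=
  if w is x :: w' then
    if w' is y :: v then - g (x * y :: v) - tdif (fun u => g (x :: u)) w'
    else - ract bN (g [::]) x
  else 0.

Lemma tdif_cons g x y v : tdif g (x :: y :: v) =
  - g (x * y :: v) - tdif (fun u => g (x :: u)) (y :: v).
Proof. by []. Qed.

Lemma tdif_rcons g w x :
  tdif g (rcons w x) = mergesum g (rcons w x) + (-1) ^+ (size w).+1 *: ract bN (g w) x.
Proof.
elim: w g => [|y w IH] g; first by rewrite /= add0r expr1 scaleN1r.
case: w IH => [|z w] IH.
  by rewrite /= !subr0 opprK exprS expr1 mulN1r opprK scale1r.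
rewrite !rcons_cons tdif_cons mergesum_cons -!rcons_cons IH opprD addrA; congr (_ + _).
by rewrite /= [in RHS]exprS mulN1r scaleNr.
Qed.

Lemma hochd_cons g x w : hochd bN g (x :: w) = lact bN x (g w) + tdif g (x :: w).
Proof.
rewrite /hochd /hochd_fun -addrA -mergesumE; congr (_ + _).
case/lastP: w => [|w y]; first by rewrite /= expr1 scaleN1r add0r.
rewrite -rcons_cons tdif_rcons last_rcons size_rcons.
by rewrite -cats1 take_size_cat.
Qed.

Lemma eq_tdif g g' w : (forall u, (size u).+1 = size w -> g u = g' u) ->
  tdif g w = tdif g' w.
Proof.
elim: w g g' => // x [|y v] IH g g' gg'; first by rewrite /= gg'.
rewrite !tdif_cons gg' //; congr (_ - _); apply: IH => u su.
by apply: gg'; rewrite /= su.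
Qed.

Lemma tdif_lin c g g' w : tdif (fun u => c *: g u + g' u) w = c *: tdif g w + tdif g' w.
Proof.
elim: w g g' => [|x [|y v] IH] g g'; first by rewrite /= scaler0 addr0.
  by rewrite /= linearPl opprD scalerN.
rewrite !tdif_cons (IH (fun u => g (x :: u))) scalerDr !scalerN !opprD.
by rewrite addrACA.
Qed.

Lemma tdifD g g' w : tdif (fun u => g u + g' u) w = tdif g w + tdif g' w.
Proof.
rewrite -[in RHS](scale1r (tdif g w)) -tdif_lin.
by apply: eq_tdif => u _; rewrite scale1r.
Qed.

Lemma tdif_const0 w : tdif (fun=> 0) w = 0.
Proof.
elim: w => [|x [|y v] IH] //; first by rewrite /= linear0l oppr0.
by rewrite tdif_cons IH oppr0 addr0.
Qed.

Lemma tdifN g w : tdif (fun u => - g u) w = - tdif g w.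
Proof.
apply/eqP; rewrite -addr_eq0 -tdifD; apply/eqP.
by rewrite (eq_tdif (g' := fun=> 0)) ?tdif_const0 // => u _; rewrite addNr.
Qed.

Lemma tdif_lact g x w : tdif (fun u => lact bN x (g u)) w = lact bN x (tdif g w).
Proof.
elim: w g => [|y [|z v] IH] g; first by rewrite /= linear0r.
  by rewrite /= lractA linearNr.
by rewrite !tdif_cons (IH (fun u => g (y :: u))) linearBr linearNr.
Qed.

Lemma tdif_head g x y v :
  tdif (fun u => tdif g (x :: u)) (y :: v) = - tdif g (x * y :: v).
Proof.
elim: v g x y => [|z v IH] g x y; first by rewrite /= linearNl /= opprK -ractA opprK.
rewrite tdif_cons.
rewrite (eq_tdif (w := z :: v) (g' := fun u => - g (x * y :: u) +
  - tdif (fun u => g (x :: u)) (y :: u))) //.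
rewrite tdifD !tdifN IH opprK opprD opprK.
by rewrite !tdif_cons mulrA !opprD !opprK addrACA subrr addr0.
Qed.

Lemma hochd_hochd g w : hochd bN (hochd bN g) w = 0.
Proof.
case: w => // x [|y v]; first by rewrite hochd_cons /= linear0r linear0l oppr0 addr0.
rewrite hochd_cons hochd_cons tdif_cons hochd_cons.
rewrite (eq_tdif (g := fun u => hochd bN g (x :: u))
  (g' := fun u => lact bN x (g u) + tdif g (x :: u))); last first.
  by move=> u _; rewrite hochd_cons.
rewrite tdifD tdif_lact tdif_head linearDr -lactA !opprD opprK.
by rewrite [X in _ + X]addrACA addNr addr0 -opprD subrr.
Qed.

Lemma tdif_1 g w : normalized g -> tdif g (1 :: w) = - g w.
Proof.
case: w => [|y v] g1; first by rewrite /= ract1.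
rewrite tdif_cons mul1r (eq_tdif (g' := fun=> 0)) ?tdif_const0 ?subr0 //.
by move=> u _; rewrite normalized_head.
Qed.

Lemma tdif_normalized g x u v : normalized g -> tdif g (x :: u ++ 1 :: v) = 0.
Proof.
elim: u g x => [|y u IH] g x g1.
  by rewrite cat0s tdif_cons mulr1 tdif_1 ?opprK ?addNr //; exact: normalized_cons.
by rewrite cat_cons tdif_cons -cat_cons g1 IH ?oppr0 ?addr0 //; exact: normalized_cons.
Qed.

Lemma hochd_normalized g : normalized g -> normalized (hochd bN g).
Proof.
move=> g1 [|x u] v; first by rewrite cat0s hochd_cons lact1 tdif_1 // subrr.
by rewrite cat_cons hochd_cons tdif_normalized // g1 linear0r addr0.
Qed.

Lemma tdif_multilin g : multilin g -> multilin (tdif g).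
Proof.
move=> gm u; elim: u g gm => [|z u IH] g gm v c x y.
  case: v => [|t v]; first by rewrite /= linearPr opprD scalerN.
  rewrite !cat0s !tdif_cons mulrDl -scalerAl multilin_consl //.
  rewrite (eq_tdif (g' := fun u => c *: g (x :: u) + g (y :: u))); last first.
    by move=> w _; exact: multilin_consl.
  by rewrite tdif_lin scalerDr !scalerN !opprD addrACA.
have IH' := IH (fun u => g (z :: u)) (multilin_tail z gm) v c x y.
case: u {IH} IH' => [|t u]; rewrite ?cat_cons ?cat0s => IH'; rewrite !tdif_cons IH'.
  rewrite mulrDr -scalerAr multilin_consl //.
  by rewrite scalerDr !scalerN !opprD addrACA.
by rewrite -!cat_cons gm scalerDr !scalerN !opprD addrACA.
Qed.

Lemma hochd_multilin g : multilin g -> multilin (hochd bN g).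
Proof.
move=> gm u v c x y; case: u => [|z u].
  rewrite !cat0s !hochd_cons linearPl.
  by rewrite (tdif_multilin gm [::]) scalerDr addrACA.
by rewrite !cat_cons !hochd_cons gm linearPr -!cat_cons tdif_multilin // scalerDr addrACA.
Qed.

Lemma hochd_homset n g : g \in homset n -> hochd bN g \in homset n.+1.
Proof.
move=> /asboolP[gm g1 gs]; apply/asboolP; split.
- exact: hochd_multilin.
- exact: hochd_normalized.
move=> [|x w] // sw; rewrite hochd_cons gs // linear0r add0r.
rewrite (eq_tdif (g' := fun=> 0)) ?tdif_const0 // => u su.
by rewrite gs //; apply: contraNneq sw => <-; rewrite su.
Qed.

Section Filtration.
Variable P : pred B.
Hypothesis PM : forall x y, P x -> P y -> P (x * y).

Definition outside w := count (predC P) w.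

Lemma outside_mul x y w : (outside ((x * y)%R :: w) <= outside (x :: y :: w))%N.
Proof.
rewrite /outside /= addnA leq_add2r.
by have := @PM x y; case: (P x); case: (P y); case: (P _) => //= /(_ isT isT).
Qed.

(** Products of letters satisfying P satisfy P, so no face of a word has more letters outside P than
    the word itself. *)
Lemma tdif_outside i n g w : (forall u, size u = n -> (outside u < i)%N -> g u = 0) ->
  size w = n.+1 -> (outside w < i)%N -> tdif g w = 0.
Proof.
elim: w i n g => // x [|y v] IH i n g g0 [?]; subst n => wi.
  by rewrite /= g0 ?linear0l ?oppr0 //; exact: leq_ltn_trans wi.
rewrite tdif_cons g0 //; last by apply: leq_ltn_trans wi; exact: outside_mul.
rewrite oppr0 sub0r (IH (i - ~~ P x)%N (size v)) ?oppr0 // => [u su ui|].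
  by apply: g0; [rewrite /= su|move: ui; rewrite ltn_subRL].
by rewrite ltn_subRL.
Qed.

Lemma hochd_outside i n g w : (forall u, size u = n -> (outside u < i)%N -> g u = 0) ->
  size w = n.+1 -> (outside w < i)%N -> hochd bN g w = 0.
Proof.
case: w => // x w g0 sw wi; rewrite hochd_cons (tdif_outside g0) // addr0 g0 ?linear0r //.
  by case: sw.
by apply: leq_ltn_trans wi; rewrite /outside /= leq_addl.
Qed.
End Filtration.
End Hochschild.

(** * The algebra of a crossed product *)

Lemma linear_bigsum (k : comNzRingType) (V U : lmodType k) (g : V -> U) I (r : seq I)
  (x : I -> V) : linear g -> g (\sum_(i <- r) x i) = \sum_(i <- r) g (x i).
Proof.
move=> gl.
pose j : {linear V -> U} := HB.pack_for {linear V -> U} g (GRing.isLinear.Build k V U _ g gl).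
exact: (raddf_sum j).
Qed.

Section SweedlerCounit.
Context {k : comNzRingType} {H : hopfAlgType k} {U : lmodType k}.

Lemma sw_counitl (G : H -> U) : linear G ->
  forall h, \sum_(p <- sw h) counit p.1 *: G p.2 = G h.
Proof. by move=> Gl h; rewrite -[in RHS](counitl h) linear_sumZ. Qed.

Lemma sw_counitr (G : H -> U) : linear G ->
  forall h, \sum_(p <- sw h) counit p.2 *: G p.1 = G h.
Proof. by move=> Gl h; rewrite -[in RHS](counitr h) linear_sumZ. Qed.

End SweedlerCounit.

Section CrossedProduct.
Context {k : comNzRingType} {H : hopfAlgType k} {A : algType k}.
Context {act : weak_action H A} {f : {linear tensor H H -> A}} {E : algType k}.
Variable cp : crossed_product act f E.
Local Notation "a # h" := (sharp cp a h) (at level 40).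

Lemma sharp_sharp a h b l : (a # h) * (b # l) =
  \sum_(p <- sw h) \sum_(q <- sw p.2) \sum_(u <- sw l)
    (a * act p.1 b * f (q.1 ⊗ u.1)) # (q.2 * u.2).
Proof. exact: cpM. Qed.

Lemma sharp11 : 1 # 1 = 1.
Proof. exact: cp1. Qed.

Lemma sharp_linearr a : linear (sharp cp a).
Proof. by move=> c x y; rewrite linearPr. Qed.

Lemma sharp_linearl h : linear (fun a => a # h).
Proof. by move=> c x y; rewrite linearPl. Qed.

Lemma one_sharp_mul h l : (1 # h) * (1 # l) =
  \sum_(p <- sw h) \sum_(u <- sw l) f (p.1 ⊗ u.1) # (p.2 * u.2).
Proof.
rewrite sharp_sharp.
pose G h := \sum_(q <- sw h) \sum_(u <- sw l) f (q.1 ⊗ u.1) # (q.2 * u.2).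
rewrite -[RHS]/(G h) -[RHS]sw_counitl; last first.
  apply: (sw_linear (b := fun x y => \sum_(u <- sw l) f (x ⊗ u.1) # (y * u.2))).
  apply: bilin_sum => u; split=> [w|v] c x y.
    by rewrite linearPl linearP linearPl.
  by rewrite mulrDl -scalerAl linearPr.
apply: eq_bigr => p _; rewrite /G scaler_sumr; apply: eq_bigr => q _.
rewrite scaler_sumr; apply: eq_bigr => u _.
by rewrite act1r mul1r -scalerAl mul1r linearZl_LR.
Qed.

Definition unsharp : E -> tensor A H :=
  sval (cid (let: Bijective g gK Kg := cp_bij cp in
    ex_intro (fun g => cancel (cp_iso cp) g /\ cancel g (cp_iso cp)) g (conj gK Kg))).

Lemma sharpK : cancel (cp_iso cp) unsharp.
Proof. by rewrite /unsharp; case: cid => g []. Qed.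
Lemma unsharpK : cancel unsharp (cp_iso cp).
Proof. by rewrite /unsharp; case: cid => g []. Qed.

Lemma unsharp_linear : linear unsharp.
Proof. by move=> c x y; apply: (can_inj sharpK); rewrite linearP !unsharpK. Qed.

(* [p <- dec x] runs over a family with x = \sum p.1 # p.2. *)
Definition dec (x : E) : seq (A * H) := repr (unsharp x).

Section DecSums.
Variables (U : lmodType k) (b : A -> H -> U).
Hypothesis bP : bilin b.

Lemma sum_dec x : \sum_(p <- dec x) b p.1 p.2 = tlift (mkbilin bP) (unsharp x).
Proof. by []. Qed.

Lemma sum_dec_linear : linear (fun x => \sum_(p <- dec x) b p.1 p.2).
Proof. by move=> c x y; rewrite !sum_dec unsharp_linear linearP. Qed.

Lemma sum_dec_sharp a h : \sum_(p <- dec (a # h)) b p.1 p.2 = b a h.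
Proof. by rewrite sum_dec sharpK tlift_tens. Qed.
End DecSums.

Lemma decE x : x = \sum_(p <- dec x) p.1 # p.2.
Proof. by rewrite -[LHS]unsharpK [unsharp x]tensorE raddf_sum. Qed.

Lemma linear_eq_sharp (U : lmodType k) (g g' : E -> U) : linear g -> linear g' ->
  (forall a h, g (a # h) = g' (a # h)) -> g =1 g'.
Proof.
move=> gl gl' gg' x.
by rewrite [x]decE !linear_bigsum //; apply: eq_bigr => p _.
Qed.

(** The map id ⊗ counit, an A-linear retraction of a |-> a # 1. *)
Definition epsA (x : E) : A := \sum_(p <- dec x) counit p.2 *: p.1.

Lemma epsA_bilin : bilin (fun (a : A) (h : H) => counit h *: a).
Proof.
split=> [h|a] c x y; first by rewrite scalerDr !scalerA mulrC.
by rewrite linearP /= scalerDl scalerA.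
Qed.

Lemma epsA_linear : linear epsA.
Proof. exact: (sum_dec_linear epsA_bilin). Qed.

Lemma epsA_sharp a h : epsA (a # h) = counit h *: a.
Proof. exact: (sum_dec_sharp epsA_bilin). Qed.

Lemma epsA_iota a : epsA (a # 1) = a.
Proof. by rewrite epsA_sharp counit1 scale1r. Qed.

Lemma epsA_sum I (r : seq I) (x : I -> E) :
  epsA (\sum_(i <- r) x i) = \sum_(i <- r) epsA (x i).
Proof.
exact: linear_bigsum epsA_linear.
Qed.

(** Apply [epsA] to (1 # h) (1 # 1) = 1 # h: the normalization of the cocycle is read off from 1 # 1
    being the unit. *)
Lemma f_1r h : f (h ⊗ 1) = (counit h)%:A.
Proof.
have: epsA ((1 # h) * (1 # 1)) = counit h *: 1 by rewrite sharp11 mulr1 epsA_sharp.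
rewrite one_sharp_mul epsA_sum => <-.
transitivity (\sum_(p <- sw h) counit p.2 *: f (p.1 ⊗ 1)).
  rewrite (sw_counitr (G := fun h => f (h ⊗ 1))) // => c x y.
  by rewrite linearPl linearP.
apply: eq_bigr => p _; rewrite (sw_1 (b := fun x y => f (p.1 ⊗ x) # (p.2 * y))).
  by rewrite mulr1 epsA_sharp.
split=> [w|v] c x y; first by rewrite linearPr linearP linearPl.
by rewrite mulrDr -scalerAr linearPr.
Qed.

Lemma f_1l h : f (1 ⊗ h) = (counit h)%:A.
Proof.
have: epsA ((1 # 1) * (1 # h)) = counit h *: 1 by rewrite sharp11 mul1r epsA_sharp.
rewrite one_sharp_mul.
rewrite (sw_1 (b := fun x y => \sum_(u <- sw h) f (x ⊗ u.1) # (y * u.2))); last first.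
  apply: bilin_sum => u; split=> [w|v] c x y; first by rewrite linearPl linearP linearPl.
  by rewrite mulrDl -scalerAl linearPr.
rewrite epsA_sum => <-.
transitivity (\sum_(p <- sw h) counit p.2 *: f (1 ⊗ p.1)).
  rewrite (sw_counitr (G := fun h => f (1 ⊗ h))) // => c x y.
  by rewrite linearPr linearP.
by apply: eq_bigr => p _; rewrite mul1r epsA_sharp.
Qed.

Lemma iota_sharp a b h : (a # 1) * (b # h) = (a * b) # h.
Proof.
rewrite sharp_sharp.
have bu u x : bilin (fun y z => (a * act x b * f (y ⊗ u.1)) # (z * u.2)).
  split=> [w|v] c y z; first by rewrite linearPl linearP mulrDr -scalerAr linearPl.
  by rewrite mulrDl -scalerAl linearPr.
rewrite (sw_1 (b := fun x y => \sum_(q <- sw y) \sum_(u <- sw h)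
    (a * act x b * f (q.1 ⊗ u.1)) # (q.2 * u.2))); last first.
  split=> [w|v] c x y; last first.
    by apply: (sw_linear (b := fun q r => \sum_(u <- sw h)
       (a * act v b * f (q ⊗ u.1)) # (r * u.2))); apply: bilin_sum => u; exact: bu.
  rewrite scaler_sumr -big_split; apply: eq_bigr => q _ /=.
  rewrite scaler_sumr -big_split; apply: eq_bigr => u _ /=.
  by rewrite linearPl mulrDr -scalerAr mulrDl -scalerAl linearPl.
rewrite (sw_1 (b := fun x y => \sum_(u <- sw h)
    (a * act 1 b * f (x ⊗ u.1)) # (y * u.2))); last first.
  by apply: bilin_sum => u; exact: bu.
rewrite act1l -[RHS](sw_counitl (G := fun h => (a * b) # h)); last exact: sharp_linearr.
by apply: eq_bigr => u _; rewrite f_1l mul1r -scalerAr mulr1 linearZl_LR.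
Qed.

Lemma sharpE a h : a # h = (a # 1) * (1 # h).
Proof. by rewrite iota_sharp mulr1. Qed.

Lemma iotaM a b : (a * b) # 1 = (a # 1) * (b # 1).
Proof. by rewrite iota_sharp. Qed.

Lemma one_sharp_iota h b : (1 # h) * (b # 1) = \sum_(p <- sw h) act p.1 b # p.2.
Proof.
rewrite sharp_sharp; apply: eq_bigr => p _.
transitivity (\sum_(q <- sw p.2) (act p.1 b * f (q.1 ⊗ 1)) # q.2).
  apply: eq_bigr => q _.
  rewrite (sw_1 (b := fun x y => (1 * act p.1 b * f (q.1 ⊗ x)) # (q.2 * y))).
    by rewrite mul1r mulr1.
  split=> [w|v] c x y; first by rewrite linearPr linearP mulrDr -scalerAr linearPl.
  by rewrite mulrDr -scalerAr linearPr.
rewrite -[RHS](sw_counitl (G := fun h => act p.1 b # h)); last exact: sharp_linearr.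
by apply: eq_bigr => q _; rewrite f_1r -scalerAr mulr1 linearZl_LR.
Qed.

End CrossedProduct.

(** * Normal forms of words *)

Section NormalForm.
Context {k : comNzRingType} {H : hopfAlgType k} {A : algType k}.
Context {act : weak_action H A} {f : {linear tensor H H -> A}} {E : algType k}.
Variable cp : crossed_product act f E.
Local Notation "a # h" := (sharp cp a h) (at level 40).
Local Notation ones h := (map (sharp cp 1) h).

(* The normal form of x_1 (x) ... (x) x_s in E (x)_A ... (x)_A E = A (x) H^s. *)
Fixpoint nf (xs : seq E) : seq (A * seq H) :=
  if xs is x :: xs' then
    [seq (q.1, q.2 :: p.2) | p <- nf xs', q <- dec cp (x * (p.1 # 1))]
  else [:: (1, [::])].

Lemma nf_size xs p : p \in nf xs -> size p.2 = size xs.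
Proof.
elim: xs p => [|x xs IH] p /=; first by rewrite inE => /eqP->.
by move=> /allpairsPdep[q [r [/IH <- _ ->]]].
Qed.

Section Sums.
Context {U : lmodType k}.
Implicit Types (K : E -> seq H -> U) (F : seq E -> U).

(** The map on E ⊗_A E ⊗_A ... ⊗_A E induced by a map K on E x H^s: coefficients in A are carried to
    the left until the first letter absorbs them. *)
Definition NF K (w : seq E) : U :=
  if w is e :: xs then \sum_(p <- nf xs) K (e * (p.1 # 1)) p.2 else 0.

(** K with e frozen, the next letter becoming the argument in E. This allows recursion from the left
    although [nf] is computed from the right. *)
Definition NFtail K e (y : E) (hs : seq H) : U :=
  \sum_(q <- dec cp y) K (e * (q.1 # 1)) (q.2 :: hs).

Lemma NF1 K e : NF K [:: e] = K e [::].
Proof. by rewrite /= big_seq1 sharp11 mulr1. Qed.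

Lemma NF_cons K e x xs : NF K (e :: x :: xs) = NF (NFtail K e) (x :: xs).
Proof. by rewrite /= big_allpairs_dep. Qed.

Lemma eq_NF K K' w :
  (forall e h, (size h).+1 = size w -> K e h = K' e h) -> NF K w = NF K' w.
Proof.
case: w => //= e xs KK'; rewrite big_seq [RHS]big_seq; apply: eq_bigr => p /nf_size sp.
by apply: KK'; rewrite sp.
Qed.

Lemma NF_mul K e x xs : NF (fun y => K (e * y)) (x :: xs) = NF K (e * x :: xs).
Proof. by apply: eq_bigr => p _; rewrite mulrA. Qed.

Lemma NF_lin c K K' w :
  NF (fun e h => c *: K e h + K' e h) w = c *: NF K w + NF K' w.
Proof.
case: w => [|e xs] /=; first by rewrite scaler0 addr0.
by rewrite scaler_sumr -big_split.
Qed.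

Lemma NF_mergesum (B : algType k) (K : seq B -> E -> seq H -> U) b w :
  NF (fun e h => mergesum (fun b => K b e h) b) w = mergesum (fun b => NF (K b) w) b.
Proof.
by case: w => [|e xs]; [rewrite mergesum0|rewrite [RHS]mergesum_sum].
Qed.

Definition letter_linear K :=
  (forall h, linear (fun e => K e h)) /\ (forall e, multilin (K e)).

Definition balanced F :=
  multilin F /\ forall u x a y v,
    F (u ++ x * (a # 1) :: y :: v) = F (u ++ x :: (a # 1) * y :: v).

Section Linear.
Variable K : E -> seq H -> U.
Hypothesis Kl : letter_linear K.

Lemma NFtail_bilin e hs : bilin (fun a h => K (e * (a # 1)) (h :: hs)).
Proof.
have [K1 K2] := Kl; split=> [h|a] c x y; last exact: (K2 _ [::]).
by rewrite linearPl mulrDr -scalerAr K1.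
Qed.

Lemma NFtail_linear e : letter_linear (NFtail K e).
Proof.
have [K1 K2] := Kl; split=> [h|y].
  exact: (sum_dec_linear cp (NFtail_bilin e h)).
by apply: multilin_sum => q; exact: multilin_tail.
Qed.

Lemma NFtail_sharp e a h hs : NFtail K e (a # h) hs = K (e * (a # 1)) (h :: hs).
Proof. exact: (sum_dec_sharp cp (NFtail_bilin e hs)). Qed.

Lemma NFtail_bal e a y hs : NFtail K (e * (a # 1)) y hs = NFtail K e ((a # 1) * y) hs.
Proof.
move: y; apply: (linear_eq_sharp (cp := cp) (g := fun y => NFtail K (e * (a # 1)) y hs)
  (g' := fun y => NFtail K e ((a # 1) * y) hs)).
- exact: (NFtail_linear _).1.
- by move=> c x y; rewrite mulrDr -scalerAr (NFtail_linear _).1.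
by move=> b h; rewrite iota_sharp !NFtail_sharp iotaM mulrA.
Qed.

End Linear.

Lemma NF_ones K e h : letter_linear K -> NF K (e :: ones h) = K e h.
Proof.
elim: h K e => [|x h IH] K e Kl; first exact: NF1.
rewrite /= -/(ones h) -[LHS]/(NF K (e :: _ :: _)) NF_cons IH; last exact: NFtail_linear.
by rewrite NFtail_sharp // sharp11 mulr1.
Qed.

Lemma NF_multilin K : letter_linear K -> multilin (NF K).
Proof.
move=> + u; elim: u K => [|e u IH] K Kl v c x y.
  rewrite /= scaler_sumr -big_split; apply: eq_bigr => p _ /=.
  by rewrite mulrDl -scalerAl Kl.1.
have Kt := IH _ (NFtail_linear Kl e) v c x y.
by case: u {IH} Kt => [|z u]; rewrite ?cat0s ?cat_cons !NF_cons.
Qed.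

Lemma NF_balanced K : letter_linear K -> balanced (NF K).
Proof.
move=> Kl; split; first exact: NF_multilin.
move=> u; elim: u K Kl => [|e u IH] K Kl x a y v.
  rewrite !cat0s !NF_cons /=; apply: eq_bigr => p _.
  by rewrite NFtail_bal // mulrA.
have Kt := IH _ (NFtail_linear Kl e) x a y v.
by case: u {IH} Kt => [|z u]; rewrite ?cat0s ?cat_cons !NF_cons.
Qed.

Lemma NF_normalized K e u v : letter_linear K -> (forall e, normalized (K e)) ->
  NF K (e :: u ++ 1 :: v) = 0.
Proof.
elim: u K e => [|x u IH] K e Kl K1.
  rewrite cat0s NF_cons /= big1 // => p _.
  by rewrite mul1r NFtail_sharp // normalized_head.
rewrite cat_cons NF_cons IH //; first exact: NFtail_linear.
by move=> y u' v'; rewrite /NFtail big1 // => q _; rewrite -cat_cons K1.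
Qed.

Lemma balanced_cons F x : balanced F -> balanced (fun u => F (x :: u)).
Proof.
move=> [Fm Fb]; split; first exact: multilin_tail.
by move=> u y a z v; rewrite -!cat_cons Fb.
Qed.

Lemma balanced_cat F v : balanced F -> balanced (fun u => F (u ++ v)).
Proof.
move=> [Fm Fb]; split; first by move=> u w c x y; rewrite -!catA !cat_cons Fm.
by move=> u y a z w; rewrite -!catA !cat_cons Fb.
Qed.

(** By balancedness the A-part of each letter moves into the letter before it, so the words e ::
    ones h generate. Identities between balanced maps therefore need to be checked on these words
    only. *)
Lemma NF_universal F e xs : balanced F ->
  NF (fun e h => F (e :: ones h)) (e :: xs) = F (e :: xs).
Proof.
elim: xs F e => [|x xs IH] F e Fb; first exact: NF1.
have [Fm Fe] := Fb.
rewrite NF_cons -[RHS](IH (fun w => F (e :: w))); last exact: balanced_cons.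
apply: eq_NF => y h _; rewrite /NFtail.
have Fl : linear (fun y => F (e :: y :: ones h)).
  by move=> c s t; exact: (Fm [:: e]).
rewrite [in RHS](decE cp y) (linear_bigsum _ _ Fl); apply: eq_bigr => q _ /=.
by rewrite (Fe [::]) -sharpE.
Qed.

Lemma mergesum_balanced F : balanced F -> balanced (mergesum F).
Proof.
move=> Fb; split; first exact: mergesum_multilin Fb.1.
move=> u; elim: u F Fb => [|z u IH] F Fb x a y v.
  rewrite !cat0s !mergesum_cons mulrA; congr (_ - _).
  case: v => [|t v] //; rewrite !mergesum_cons.
  rewrite -mulrA (Fb.2 [::]) mulrA; congr (_ - _); apply: eq_mergesum => w _.
  exact: (Fb.2 [::]).
have IH' := IH (fun u => F (z :: u)) (balanced_cons z Fb) x a y v.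
case: u {IH} IH' => [|t u]; rewrite ?cat_cons ?cat0s => IH'; rewrite mergesum_cons [RHS]mergesum_cons IH'.
  by rewrite mulrA (Fb.2 [::]).
by rewrite -!cat_cons Fb.2.
Qed.

Fixpoint rmul (w : seq E) (a : A) : seq E :=
  if w is x :: w' then if w' is _ :: _ then x :: rmul w' a else [:: x * (a # 1)]
  else [::].

Lemma size_rmul w a : size (rmul w a) = size w.
Proof. by elim: w => // x [|y w] IH //; exact: (congr1 S IH). Qed.

Lemma rmul_cons x y w a : rmul (x :: y :: w) a = x :: rmul (y :: w) a.
Proof. by []. Qed.

Lemma rmulM w a b : rmul w (a * b) = rmul (rmul w a) b.
Proof.
elim: w => // x [|y w] IH; first by rewrite /= iotaM mulrA.
rewrite !rmul_cons IH; have := size_rmul (y :: w) a.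
by case: (rmul (y :: w) a).
Qed.

Lemma rmul_head e x xs a : rmul (e * x :: xs) a =
  if rmul (x :: xs) a is y :: v then e * y :: v else [::].
Proof. by case: xs => [|z xs] /=; rewrite ?mulrA. Qed.

Lemma mergesum_rmul F w a : mergesum (fun u => F (rmul u a)) w = mergesum F (rmul w a).
Proof.
elim: w F => // x [|y [|z v]] IH F //; first by rewrite /= mulrA.
rewrite mergesum_cons.
rewrite (eq_mergesum (g' := fun u => (fun w => F (x :: w)) (rmul u a))); last by case.
rewrite (IH (fun w => F (x :: w))) [rmul [:: x, y, z & v] a]rmul_cons rmul_head.
by have := size_rmul (y :: z :: v) a; case: (rmul (y :: z :: v) a).
Qed.

Lemma rmul_balanced F a : balanced F -> balanced (fun w => F (rmul w a)).
Proof.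
move=> Fb; split.
  move=> u; elim: u F Fb => [|z u IH] F [Fm Fe] v c x y.
    case: v => [|t v]; rewrite ?cat0s /= -/(rmul _) ?multilin_consl //.
    by rewrite mulrDl -scalerAl multilin_consl.
  have IH' := IH (fun u => F (z :: u)) (balanced_cons z (conj Fm Fe)) v c x y.
  by case: u {IH} IH' => [|t u].
move=> u; elim: u F Fb => [|z u IH] F Fb x b y v.
  rewrite !cat0s !rmul_cons.
  case: v => [|t v]; first by rewrite /= (Fb.2 [::]) mulrA.
  by rewrite !rmul_cons (Fb.2 [::]).
have IH' := IH (fun u => F (z :: u)) (balanced_cons z Fb) x b y v.
by case: u {IH} IH' => [|t u].
Qed.

(** Commuting a to the left across the letters 1 # h_i, one at a time by [one_sharp_iota], is what
    produces the iterated action of the word h. *)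
Lemma rmul_ones F x h a : balanced F ->
  F (rmul (x :: ones h) a) = \sum_(p <- wsw h) F (x * (wact act p.1 a # 1) :: ones p.2).
Proof.
elim: h F x => [|y h IH] F x Fb; first by rewrite big_seq1.
rewrite [ones _]/= rmul_cons (IH (fun u => F (x :: u))); last exact: balanced_cons.
rewrite (wsw_cons y h (fun a' b' => F (x * (wact act a' a # 1) :: ones b'))).
apply: eq_bigr => p _; have [Fm Fe] := Fb.
have Fl : linear (fun z => F (x :: z :: ones p.2)).
  by move=> c s t; exact: (Fm [:: x]).
rewrite one_sharp_iota (linear_bigsum _ _ Fl); apply: eq_bigr => q _ /=.
by rewrite sharpE -(Fe [::]).
Qed.

End Sums.
End NormalForm.

Lemma sum_bigcat (U : nmodType) I J (r : seq I) (F : I -> seq J) (G : J -> U) :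
  \sum_(c <- \big[cat/[::]]_(p <- r) F p) G c = \sum_(p <- r) \sum_(c <- F p) G c.
Proof. by elim: r => [|p r IH]; rewrite !(big_nil, big_cons) // big_cat IH. Qed.

(** * Actions and contractions as operations on normal forms *)

Section Steps.
Context {k : comNzRingType} {H : hopfAlgType k} {A : algType k}.
Context {act : weak_action H A} {f : {linear tensor H H -> A}}.

Lemma wsw_size1 (h : seq H) p : p \in wsw h -> size p.1 = size h.
Proof.
elim: h p => [|x h IH] p /=; first by rewrite inE => /eqP->.
by move=> /allpairsP[[q r] [/= _ /IH <- ->]].
Qed.

Lemma sum_contract (U : nmodType) (K : A -> seq H -> U) j h :
  \sum_(c <- contract act f j h) K c.1 c.2 =
  \sum_(p <- wsw (take j.-1 h)) \sum_(x <- sw h`_j.-1) \sum_(y <- sw h`_j)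
     K (wact act p.1 (f (x.1 ⊗ y.1))) (p.2 ++ x.2 * y.2 :: drop j.+1 h).
Proof.
by rewrite sum_bigcat; apply: eq_bigr => p _; rewrite big_allpairs_dep.
Qed.

Lemma contract_size j h c : (0 < j < size h)%N -> c \in contract act f j h ->
  (size c.2).+1 = size h.
Proof.
move=> /andP[j0 jh]; rewrite /contract big_seq.
elim/big_rec: _ => // p s /wsw_size sp IH; rewrite mem_cat => /orP[|]; last exact: IH.
move=> /allpairsP[[x y] [_ _ ->]] /=.
by rewrite size_cat /= size_drop sp size_take_min; lia.
Qed.

Context {E : algType k}.
Variable cp : crossed_product act f E.
Local Notation "a # h" := (sharp cp a h) (at level 40).
Local Notation ones h := (map (sharp cp 1) h).
Context {U : lmodType k}.
Implicit Types (K : E -> seq H -> U) (F : seq E -> U).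

Lemma rmul_cat F e w a z v : balanced cp F ->
  F (rmul cp (e :: w) a ++ z :: v) = F (e :: w ++ (a # 1) * z :: v).
Proof.
elim: w F e => [|x w IH] F e Fb; first by rewrite /= (Fb.2 [::]).
rewrite rmul_cons cat_cons (IH (fun w => F (e :: w))) //; exact: balanced_cons.
Qed.

Lemma step_tau K h a : letter_linear K ->
  \sum_(p <- wsw h) K (wact act p.1 a # 1) p.2 = NF cp K (rmul cp (1 :: ones h) a).
Proof.
move=> Kl; rewrite rmul_ones; last exact: NF_balanced.
by apply: eq_bigr => p _; rewrite mul1r NF_ones.
Qed.

(** The product of 1 # h_i and 1 # h_(i+1) creates the value of f by [one_sharp_mul]; moving that
    value to the front of the word by [rmul_ones] creates the action on it. *)
Lemma step_contract K i h : letter_linear K -> (0 < i < size h)%N ->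
  \sum_(c <- contract act f i h) K (c.1 # 1) c.2 =
  NF cp K (1 :: take i.-1 (ones h) ++ (ones h)`_i.-1 * (ones h)`_i :: drop i.+1 (ones h)).
Proof.
move=> Kl /andP[i0 ih].
rewrite (sum_contract (fun a h => K (a # 1) h)).
have ih' : (i.-1 < size h)%N by exact: leq_ltn_trans (leq_pred i) ih.
rewrite !(nth_map 0) // one_sharp_mul -map_take -map_drop.
set pre := take _ _; set post := drop _ _.
have [Fm Fe] := NF_balanced cp Kl.
have Fl : linear (fun z => NF cp K (1 :: ones pre ++ z :: ones post)).
  by move=> c s t; rewrite -!cat_cons Fm.
rewrite (linear_bigsum _ _ Fl) exchange_big; apply: eq_bigr => x _.
rewrite (linear_bigsum _ _ Fl) exchange_big; apply: eq_bigr => y _.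
rewrite sharpE -(rmul_cat (F := NF cp K)) //.
rewrite (rmul_ones (F := fun w => NF cp K (w ++ (1 # (x.2 * y.2)) :: ones post))); last first.
  by apply: balanced_cat.
apply: eq_bigr => p _; rewrite mul1r -[X in NF _ _ X]cat_cons.
have -> : (wact act p.1 (f (x.1 ⊗ y.1)) # 1 :: ones p.2) ++ 1 # (x.2 * y.2) :: ones post =
  (wact act p.1 (f (x.1 ⊗ y.1)) # 1) :: ones (p.2 ++ x.2 * y.2 :: post).
  by rewrite map_cat.
by rewrite NF_ones.
Qed.

(** The leading 1 is a placeholder: its merge with the first letter is the emission of 1 # x, and
    the remaining merges are the contractions. *)
Lemma step_merge K h : letter_linear K ->
  (if h is x :: h' then K (1 # x) h' else 0) +
  \sum_(1 <= i < size h) (-1) ^+ i *: \sum_(c <- contract act f i h) K (c.1 # 1) c.2 =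
  - mergesum (NF cp K) (1 :: ones h).
Proof.
move=> Kl; case: h => [|x h]; first by rewrite big_geq ?addr0 ?oppr0.
rewrite mergesumE [in RHS]big_ltn // expr1 scaleN1r /= mul1r drop0.
rewrite -[LHS]opprK opprD; congr (- (- _ + _)).
  by rewrite -(NF_ones cp).
rewrite [in RHS]big_add1 /= size_map -sumrN; apply: eq_big_nat => i /andP[i1 ih].
rewrite step_contract //; last by rewrite i1.
case: i i1 ih => // i _ ih.
by rewrite -scaleNr [in RHS]exprS mulN1r.
Qed.

End Steps.

(** * The comparison map *)

Section Comparison.
Context {k : comNzRingType} {H : hopfAlgType k} {A : algType k}.
Context {act : weak_action H A} {f : {linear tensor H H -> A}} {E : algType k}.
Variable cp : crossed_product act f E.
Local Notation "a # h" := (sharp cp a h) (at level 40).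
Local Notation ones h := (map (sharp cp 1) h).
Context {U : lmodType k}.
Implicit Types (g : seq E -> U).

(** The fuel n is the length of the words on which g is evaluated. Each step lowers size h + size a
    by one, so the value is 0 unless n equals this sum. *)
Fixpoint Phi n g (h : seq H) (a : seq A) : U :=
  if n is n'.+1 then
    (if a is a1 :: a' then
       \sum_(p <- wsw h) Phi n' (fun u => g ((wact act p.1 a1 # 1) :: u)) p.2 a'
     else 0)
    + (-1) ^+ size a *:
        (if h is x :: h' then Phi n' (fun u => g ((1 # x) :: u)) h' a else 0)
    + \sum_(1 <= i < size h) (-1) ^+ (size a + i) *:
        \sum_(c <- contract act f i h) Phi n' (fun u => g ((c.1 # 1) :: u)) c.2 a
  else if nilp h && nilp a then g [::] else 0.

Definition PhiK n g a (e : E) (h : seq H) : U := Phi n (fun u => g (e :: u)) h a.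

Lemma eq_Phi n g g' h a : (forall u, size u = n -> g u = g' u) ->
  Phi n g h a = Phi n g' h a.
Proof.
elim: n g g' h a => [|n IH] g g' h a gg' /=; first by rewrite gg'.
have E1 x h' a' : Phi n (fun u => g (x :: u)) h' a' = Phi n (fun u => g' (x :: u)) h' a'.
  by apply: IH => u su; apply: gg'; rewrite /= su.
congr (_ + _ *: _ + _).
- by case: a => // a1 a'; apply: eq_bigr => p _.
- by case: h.
- by apply: eq_bigr => i _; congr (_ *: _); apply: eq_bigr.
Qed.

Lemma Phi_lin n c g g' h a :
  Phi n (fun u => c *: g u + g' u) h a = c *: Phi n g h a + Phi n g' h a.
Proof.
elim: n g g' h a => [|n IH] g g' h a /=.
  by case: ifP; rewrite ?scaler0 ?addr0.
rewrite !scalerDr [RHS]addrACA [X in _ = X + _]addrACA; congr (_ + _ + _).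
- case: a => [|a1 a']; first by rewrite scaler0 addr0.
  by rewrite scaler_sumr -big_split; apply: eq_bigr => p _; rewrite IH.
- case: h => [|x h]; first by rewrite !scaler0 addr0.
  by rewrite IH scalerDr !scalerA mulrC.
- rewrite scaler_sumr -big_split; apply: eq_bigr => i _ /=.
  rewrite scalerA mulrC -scalerA -scalerDr; congr (_ *: _).
  by rewrite scaler_sumr -big_split; apply: eq_bigr => q _; rewrite IH.
Qed.

Lemma Phi0 n h a : Phi n (fun=> 0) h a = 0.
Proof.
transitivity (Phi n (fun=> (-1) *: 0 + 0) h a).
  by apply: eq_Phi => u _; rewrite scaler0 addr0.
by rewrite (Phi_lin n (-1) (fun=> 0) (fun=> 0)) scaleN1r addNr.
Qed.

Lemma PhiD n g g' h a : Phi n (fun u => g u + g' u) h a = Phi n g h a + Phi n g' h a.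
Proof.
rewrite -[Phi n g h a]scale1r -Phi_lin; apply: eq_Phi => u _; by rewrite scale1r.
Qed.

Lemma PhiZ n c g h a : Phi n (fun u => c *: g u) h a = c *: Phi n g h a.
Proof.
rewrite -[RHS]addr0 -[X in _ + X](Phi0 n h a) -Phi_lin.
by apply: eq_Phi => u _; rewrite addr0.
Qed.

Lemma PhiN n g h a : Phi n (fun u => - g u) h a = - Phi n g h a.
Proof. by rewrite -scaleN1r -PhiZ; apply: eq_Phi => u _; rewrite scaleN1r. Qed.

Lemma PhiK_linear n g a h : multilin g -> linear (fun e => PhiK n g a e h).
Proof.
move=> gm c x y; rewrite /PhiK -Phi_lin; apply: eq_Phi => u _.
exact: multilin_consl.
Qed.

Lemma multilin_ones (G : seq E -> U) : multilin G -> multilin (fun h => G (ones h)).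
Proof. by move=> Gm u v c x y; rewrite !map_cat /= sharp_linearr Gm. Qed.

Section Multilinear.
Variable n : nat.
Hypothesis IH : forall g a, multilin g -> multilin (fun h => Phi n g h a).

Let PhiKl g a : multilin g -> letter_linear (PhiK n g a).
Proof.
move=> gm; split=> [h|e]; first exact: PhiK_linear.
by apply: IH; exact: multilin_tail.
Qed.

(** Normal forms require [PhiK n] to be multilinear in h, and multilinearity in degree n + 1 is in
    turn read off from this recursion; hence the hypothesis [IH] of the section. *)
Lemma Phi_rec g h a : multilin g -> Phi n.+1 g h a =
  (if a is a1 :: a' then NF cp (PhiK n g a') (rmul cp (1 :: ones h) a1) else 0)
  + (-1) ^+ (size a).+1 *: mergesum (NF cp (PhiK n g a)) (1 :: ones h).
Proof.
move=> gm; rewrite [in RHS]exprS mulN1r scaleNr -scalerN.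
rewrite -step_merge; last exact: PhiKl.
rewrite scalerDr /= addrA; congr (_ + _ *: _ + _).
- by case: a => // a1 a'; rewrite -step_tau //; exact: PhiKl.
- by rewrite scaler_sumr; apply: eq_bigr => i _; rewrite scalerA exprD.
Qed.

Lemma Phi_multilinl_rec g a : multilin g -> multilin (fun h => Phi n.+1 g h a).
Proof.
move=> gm u v c x y; rewrite !Phi_rec //.
have Km b := NF_balanced cp (PhiKl b gm).
have M1 := multilin_ones (multilin_tail 1 (mergesum_balanced (Km a)).1).
rewrite M1 !scalerDr [RHS]addrACA; congr (_ + _); last by rewrite !scalerA mulrC.
case: a {M1} => [|a1 a']; first by rewrite scaler0 addr0.
exact: (multilin_ones (multilin_tail 1 (rmul_balanced a1 (Km a')).1)).
Qed.
End Multilinear.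

Lemma Phi_multilinl n g a : multilin g -> multilin (fun h => Phi n g h a).
Proof.
elim: n g a => [|n IH] g a gm; last exact: Phi_multilinl_rec.
by move=> [|z u] v c x y /=; rewrite scaler0 addr0.
Qed.

Lemma PhiK_letter_linear n g a : multilin g -> letter_linear (PhiK n g a).
Proof.
move=> gm; split=> [h|e]; first exact: PhiK_linear.
by apply: Phi_multilinl; exact: multilin_tail.
Qed.

Lemma PhiS n g h a : multilin g -> Phi n.+1 g h a =
  (if a is a1 :: a' then NF cp (PhiK n g a') (rmul cp (1 :: ones h) a1) else 0)
  + (-1) ^+ (size a).+1 *: mergesum (NF cp (PhiK n g a)) (1 :: ones h).
Proof. by move=> gm; apply: Phi_rec => // g' a'; exact: Phi_multilinl. Qed.

Lemma Phi_multilinr n g h : multilin g -> multilin (Phi n g h).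
Proof.
elim: n g h => [|n IH] g h gm u v c x y /=.
  by rewrite !(andbC (nilp h)); case: u => [|z u] /=; rewrite scaler0 addr0.
have IHs e h' : Phi n (fun w => g (e :: w)) h' (u ++ c *: x + y :: v) =
    c *: Phi n (fun w => g (e :: w)) h' (u ++ x :: v) + Phi n (fun w => g (e :: w)) h' (u ++ y :: v).
  by apply: IH; exact: multilin_tail.
rewrite !scalerDr [RHS]addrACA [X in _ = X + _]addrACA !size_cat /=; congr (_ + _ + _).
- case: u {IHs} => [|z u] /=.
    rewrite scaler_sumr -big_split; apply: eq_bigr => p _ /=.
    have := PhiK_linear n v p.2 gm c (wact act p.1 x # 1) (wact act p.1 y # 1).
    by rewrite /PhiK -sharp_linearl -wact_linear.
  rewrite scaler_sumr -big_split; apply: eq_bigr => p _ /=.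
  by apply: IH; exact: multilin_tail.
- case: h => [|z h]; first by rewrite !scaler0 addr0.
  by rewrite IHs scalerDr !scalerA mulrC.
- rewrite scaler_sumr -big_split; apply: eq_bigr => i _ /=.
  rewrite scalerA mulrC -scalerA -scalerDr; congr (_ *: _).
  by rewrite scaler_sumr -big_split; apply: eq_bigr => q _; rewrite IHs.
Qed.

(** A merge with the letter 1 leaves a word of the form [ones h]; any other merge keeps the letter
    1. *)
Lemma mergesum_unit (G : seq E -> U) : (forall h, G (ones h) = 0) ->
  (forall u v, G (u ++ 1 :: v) = 0) ->
  forall u v, mergesum G (ones u ++ 1 :: ones v) = 0.
Proof.
move=> + + u; elim: u G => [|x u IH] G G0 G1 v.
  case: v => [|y v] //; rewrite cat0s map_cons mergesum_cons mul1r.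
  rewrite (G0 (y :: v)) oppr0 sub0r.
  rewrite (eq_mergesum (w := _ :: _) (g' := fun=> 0)) ?mergesum0 ?oppr0 // => w _.
  exact: (G1 [::]).
have := IH (fun w => G ((1 # x) :: w)) (fun h => G0 (x :: h))
  (fun u v => G1 (_ :: u) v) v.
case: u {IH} => [|z u]; rewrite ?map_cons ?cat_cons ?cat0s => IH'.
  by rewrite mergesum_cons IH' mulr1 (G0 (x :: v)) subr0 oppr0.
by rewrite mergesum_cons IH' (G1 (_ :: _)) oppr0 addr0.
Qed.

Lemma Phi_normalizedl n g a : multilin g -> normalized g ->
  normalized (fun h => Phi n g h a).
Proof.
elim: n g a => [|n IH] g a gm g1 u v; first by rewrite /=; case: u.
have Kl b := PhiK_letter_linear n b gm.
have Kn b e : normalized (PhiK n g b e).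
  by apply: IH; [exact: multilin_tail|exact: normalized_cons].
have K1 b h : PhiK n g b 1 h = 0.
  by rewrite /PhiK -[RHS](Phi0 n h b); apply: eq_Phi => w _; exact: normalized_head.
have M0 b : mergesum (NF cp (PhiK n g b)) (1 :: ones (u ++ 1 :: v)) = 0.
  rewrite map_cat map_cons sharp11.
  have F0 h : NF cp (PhiK n g b) (1 :: ones h) = 0 by rewrite NF_ones.
  have F1 e u' v' : NF cp (PhiK n g b) (e :: u' ++ 1 :: v') = 0 by exact: NF_normalized.
  have : mergesum (fun w => NF cp (PhiK n g b) (1 :: w)) (ones u ++ 1 :: ones v) = 0.
    by apply: mergesum_unit.
  case: u => [|x u]; rewrite ?map_cons ?cat_cons ?cat0s => E0.
    by rewrite mergesum_cons E0 mul1r F0 subr0 oppr0.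
  by rewrite mergesum_cons E0 F1 subr0 oppr0.
rewrite PhiS // M0 scaler0 addr0; case: a => // a1 a'.
rewrite -step_tau //.
apply: (wsw_normalized (G := fun x y => PhiK n g a' (wact act x a1 # 1) y)) => //.
- move=> h u' v' c x y; rewrite wact_multilin sharp_linearl.
  exact: PhiK_linear.
- by move=> h; exact: (Kl a').2.
Qed.

Lemma Phi_normalizedr n g h : multilin g -> normalized g -> normalized (Phi n g h).
Proof.
elim: n g h => [|n IH] g h gm g1 u v /=.
  by rewrite andbC; case: u.
have IHs e h' : Phi n (fun w => g (e :: w)) h' (u ++ 1 :: v) = 0.
  by apply: IH; [exact: multilin_tail|exact: normalized_cons].
rewrite [X in _ + _ *: X](_ : _ = 0) ?scaler0 ?addr0; last by case: h.
rewrite [X in _ + X]big1 ?addr0 => [|i _]; last by rewrite big1 ?scaler0.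
case: u {IHs} => [|z u] /=; rewrite big1 // => p _; last first.
  by apply: IH; [exact: multilin_tail|exact: normalized_cons].
rewrite -[LHS]/(PhiK n g v (wact act p.1 1 # 1) p.2) wact_1r sharpZ1 -[X in PhiK _ _ _ X]addr0 PhiK_linear //.
have K0 h' : PhiK n g v 1 h' = 0.
  by rewrite /PhiK -[RHS](Phi0 n h' v); apply: eq_Phi => w _; exact: normalized_head.
rewrite K0 scaler0 add0r.
have := PhiK_linear n v p.2 gm (-1) 0 0; rewrite scaler0 addr0 scaleN1r.
by rewrite addNr.
Qed.

End Comparison.

(** * Compatibility of the comparison map with merges *)

Lemma mergesum_exchange (k : comNzRingType) (B C : algType k) (U : lmodType k)
    (F : seq B -> seq C -> U) b c :
  mergesum (fun c' => mergesum (fun b' => F b' c') b) c =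
  mergesum (fun b' => mergesum (F b') c) b.
Proof.
elim: b F => [|x [|y b] IH] F; [exact: mergesum0|exact: mergesum0|].
rewrite mergesum_cons -(IH (fun b' => F (x :: b'))).
rewrite (eq_mergesum (g' := fun c' => - F (x * y :: b) c' +
  - mergesum (fun b' => F (x :: b') c') (y :: b))) //.
by rewrite mergesumD !mergesumN.
Qed.

Section Comparison.
Context {k : comNzRingType} {H : hopfAlgType k} {A : algType k}.
Context {act : weak_action H A} {f : {linear tensor H H -> A}} {E : algType k}.
Variable cp : crossed_product act f E.
Local Notation "a # h" := (sharp cp a h) (at level 40).
Local Notation ones h := (map (sharp cp 1) h).
Context {U : lmodType k}.
Implicit Types (g : seq E -> U) (F : seq A -> seq E -> U).

(** One step of Phi in the form of [PhiS], with an arbitrary word over E in place of 1 :: ones h. *)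
Definition stepsum F (w : seq E) (a : seq A) : U :=
  (if a is a1 :: a' then F a' (rmul cp w a1) else 0)
  + (-1) ^+ (size a).+1 *: mergesum (F a) w.

(* The Maurer-Cartan identity behind [Phi_mergesum]: it holds because the
   multiplication of E is associative and a |-> a # 1 is multiplicative. *)
Lemma stepsum_MC F w a :
  stepsum (fun a' w => stepsum F w a') w a +
  stepsum (fun a' w => mergesum (fun b => F b w) a') w a +
  mergesum (stepsum F w) a = 0.
Proof.
have mm b c : mergesum (fun w => c *: mergesum (F b) w) w = 0.
  by rewrite mergesumZ mergesum_mergesum scaler0.
case: a => [|a1 a'].
  rewrite /stepsum /= mergesum0 scaler0 !addr0 add0r.
  rewrite (eq_mergesum (g' := fun w => (-1) ^+ 1 *: mergesum (F [::]) w)) ?mm ?scaler0 //.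
  by move=> u _; rewrite add0r.
rewrite {1}/stepsum [X in X + _ + _ = _](_ : _ =
  (if a' is a2 :: a'' then F a'' (rmul cp (rmul cp w a1) a2) else 0)); last first.
  rewrite mergesumD mm addr0 mergesum_rmul /stepsum -addrA -[RHS]addr0.
  by congr (_ + _); rewrite /= [in X in _ + X]exprS mulN1r scaleNr addrN.
rewrite {1}/stepsum [X in _ + X = _](_ : _ =
  mergesum (fun b => if b is b1 :: b' then F b' (rmul cp w b1) else 0) (a1 :: a') +
  (-1) ^+ (size a').+1 *: mergesum (fun b => mergesum (F b) w) (a1 :: a')); last first.
  rewrite -mergesumZ -mergesumD; apply: eq_mergesum => b [sb].
  by rewrite /stepsum sb.
rewrite mergesum_exchange [size (a1 :: a')]/= [in X in X + _]exprS mulN1r scaleNr.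
rewrite [X in _ + X = _]addrC addrA [X in X + _ + _]addrA addrNK.
case: a' => [|a2 a'']; first by rewrite /= !addr0.
by rewrite mergesum_cons rmulM -opprD; exact: subrr.
Qed.

Lemma stepsum_balanced F a : (forall b, balanced cp (F b)) ->
  balanced cp (fun w => stepsum F w a).
Proof.
move=> Fb; have Mb := mergesum_balanced (Fb a).
split.
  move=> u v c x y; rewrite /stepsum Mb.1 !scalerDr [RHS]addrACA.
  congr (_ + _); last by rewrite !scalerA mulrC.
  case: a {Mb} => [|a1 a']; first by rewrite scaler0 addr0.
  exact: (rmul_balanced a1 (Fb a')).1.
move=> u x b y v; rewrite /stepsum Mb.2; congr (_ + _).
case: a {Mb} => // a1 a'; exact: (rmul_balanced a1 (Fb a')).2.
Qed.

(** Multiplying the first emitted letter by e amounts to putting e in place of the leading 1. *)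
Lemma Phi_mulhead n g e h a : multilin g ->
  Phi cp n.+1 (fun u => if u is y :: v then g (e * y :: v) else 0) h a =
  stepsum (fun b => NF cp (PhiK cp n g b)) (e :: ones h) a.
Proof.
move=> gm; rewrite PhiS; last exact: multilin_mul2.
rewrite /stepsum -[e in RHS]mulr1; congr (_ + _ *: _).
  case: a => // a1 a'; rewrite rmul_head.
  have := size_rmul cp (1 :: ones h) a1; case: (rmul cp (1 :: ones h) a1) => // y v _.
  exact: (NF_mul cp (PhiK cp n g a')).
have K w : NF cp (PhiK cp n (fun u => if u is y :: v then g (e * y :: v) else 0) a) w =
    if w is x :: v then NF cp (PhiK cp n g a) (e * x :: v) else 0.
  by case: w => // x v; rewrite -NF_mul.
rewrite (eq_mergesum (g' := fun w => if w is x :: v then NF cp (PhiK cp n g a) (e * x :: v) else 0)) //.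
case: (ones h) => // y v; rewrite !mergesum_cons mulrA; congr (_ - _).
Qed.

(** Induction on n: merges of the first two letters are handled by [Phi_mulhead], later ones by the
    induction hypothesis, and [PhiS] turns the claim into [stepsum_MC]. *)
Lemma Phi_mergesum n g h a : multilin g ->
  Phi cp n.+1 (mergesum g) h a = mergesum (Phi cp n g h) a.
Proof.
elim: n g h a => [|n IH] g h a gm.
  rewrite (eq_Phi cp (g' := fun=> 0)) ?Phi0 => [|[|x [|y u]]] //.
  case: a => [|x [|y a]] //; rewrite (eq_mergesum (g' := fun=> 0)) ?mergesum0 //.
  by case=> // z b _; rewrite /= andbF.
have Kl b := PhiK_letter_linear cp n b gm.
pose F b := NF cp (PhiK cp n g b).
have KE b e h' : PhiK cp n.+1 (mergesum g) b e h' =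
    - (stepsum F (e :: ones h') b + mergesum (fun b => PhiK cp n g b e h') b).
  rewrite /PhiK (eq_Phi cp (g' := fun u => - (if u is y :: v then g (e * y :: v) else 0)
      + - mergesum (fun u => g (e :: u)) u)); last by case.
  rewrite PhiD !PhiN Phi_mulhead // IH ?opprD //; exact: multilin_tail.
(* [KE] concerns words e :: ones h' only. As [stepsum F] is balanced, normal forms extend the
   identity to every word w. *)
have NE b w : NF cp (PhiK cp n.+1 (mergesum g) b) w =
    - (stepsum F w b + mergesum (fun b => F b w) b).
  rewrite (eq_NF cp (K' := fun e h' => (-1) *: (stepsum F (e :: ones h') b) +
    (-1) *: mergesum (fun b => PhiK cp n g b e h') b)); last first.
    by move=> e h' _; rewrite KE opprD !scaleN1r.
  rewrite NF_lin scaleN1r opprD.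
  have -> : NF cp (fun e h' => stepsum F (e :: ones h') b) w = stepsum F w b.
    case: w => [|e xs].
      rewrite /stepsum /= scaler0 addr0; by case: b.
    apply: (NF_universal (F := fun w => stepsum F w b)).
    by apply: stepsum_balanced => b'; exact: NF_balanced.
  congr (_ + _); rewrite -NF_mergesum -scaleN1r -[RHS]addr0.
  have := NF_lin cp (-1) (fun e h' => mergesum (fun b => PhiK cp n g b e h') b) (fun _ _ => 0) w.
  move=> E0; rewrite -[X in _ + X](_ : NF cp (fun _ _ => 0) w = 0) -?E0; last first.
    by case: (w) => //= *; rewrite big1.
  by apply: eq_NF => e h' _; rewrite addr0.
rewrite PhiS; last exact: mergesum_multilin.
have -> : mergesum (Phi cp n.+1 g h) a = mergesum (stepsum F (1 :: ones h)) a.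
  by apply: eq_mergesum => b _; rewrite PhiS.
have := stepsum_MC F (1 :: ones h) a; move/eqP; rewrite addrC addr_eq0 => /eqP ->.
rewrite {1 2}/stepsum addrACA opprD.
congr (_ + _).
  by case: a => [|a1 a']; [rewrite addr0 oppr0|rewrite NE].
rewrite -scalerDr -scalerN -mergesumD -mergesumN; congr (_ *: _).
by apply: eq_mergesum => w _; rewrite NE.
Qed.

End Comparison.

(** * The words on which the comparison map evaluates a cochain *)

Section Support.
Context {k : comNzRingType} {H : hopfAlgType k} {A : algType k}.
Context {act : weak_action H A} {f : {linear tensor H H -> A}} {E : algType k}.
Variable cp : crossed_product act f E.
Local Notation "a # h" := (sharp cp a h) (at level 40).
Local Notation ones h := (map (sharp cp 1) h).
Context {U : lmodType k}.
Implicit Types (g : seq E -> U).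

Lemma in_A_iota a : in_A cp (a # 1).
Proof. by apply/asboolP; exists a. Qed.

Lemma in_AM x y : in_A cp x -> in_A cp y -> in_A cp (x * y).
Proof.
move=> /asboolP[a ->] /asboolP[b ->]; apply/asboolP; exists (a * b).
by rewrite iotaM.
Qed.

Local Notation out := (outside (in_A cp)).

(** The letters that Phi can emit; a general a # h is not among them. *)
Definition letter (x : E) : bool := in_A cp x || `[< exists h, x = 1 # h >].

Lemma out_iota a w : out ((a # 1) :: w) = out w.
Proof. by rewrite /outside /= in_A_iota. Qed.

(** Each emitted letter outside A uses up a letter of h, so at most size h of them occur. *)
Lemma Phi_supp n g h a : n = (size h + size a)%N ->
  (forall w, size w = n -> all letter w -> (out w <= size h)%N -> g w = 0) ->
  Phi cp n g h a = 0.
Proof.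
elim: n g h a => [|n IH] g h a ns g0 /=; first by rewrite g0 ?if_same.
have stepA b h' a' : (size h' <= size h)%N -> n = (size h' + size a')%N ->
    Phi cp n (fun u => g ((b # 1) :: u)) h' a' = 0.
  move=> lh nh; apply: IH => // w sw lw ow; apply: g0; rewrite /= ?sw ?lw //.
    by rewrite /letter in_A_iota.
  by rewrite /outside /= in_A_iota add0n; exact: leq_trans ow lh.
have add3 (x y z : U) : x = 0 -> y = 0 -> z = 0 -> x + (-1) ^+ size a *: y + z = 0.
  by move=> -> -> ->; rewrite scaler0 !addr0.
apply: add3.
- case: a {g0} ns => // a1 a' ns; rewrite big_seq big1 // => p /wsw_size sp.
  by apply: stepA; rewrite sp //; move: ns; rewrite /= addnS => -[].
- case: h g0 ns {stepA} => // x h g0 [ns]; apply: IH => // w sw lw ow.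
  apply: g0; rewrite /= ?sw ?lw ?andbT //.
    by rewrite /letter; apply/orP; right; apply/asboolP; exists x.
  by rewrite /outside /= -add1n leq_add // leq_b1.
- rewrite big_nat big1 // => i ih; rewrite big_seq big1 ?scaler0 // => c ch.
  have sc := contract_size ih ch.
  by apply: stepA; rewrite -?sc //; move: ns; rewrite -sc addSn => -[].
Qed.

(* The term of Phi in which all the letters of h are emitted before those of a. *)
Lemma Phi_lead n g h a : n = (size h + size a)%N ->
  (forall w, size w = n -> (out w <= size h)%N -> has (in_A cp) (take (size h) w) -> g w = 0) ->
  Phi cp n g h a = (-1) ^+ (size a * size h) *: g (ones h ++ map (fun b => b # 1) a).
Proof.
elim: n g h a => [|n IH] g h a ns g0.
  by case: h a ns {g0} => [|x h] [|y a] //= _; rewrite expr0 scale1r.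
case: h g0 ns => [|x h] g0 ns.
  case: a ns => // a1 a' [ns]; rewrite [LHS]/= big_geq // addr0 scaler0 addr0 big_seq1 /=.
  by rewrite IH //= => w; rewrite take0.
have stepA b h' a' : (size h' <= (size h).+1)%N -> n = (size h' + size a')%N ->
    Phi cp n (fun u => g ((b # 1) :: u)) h' a' = 0.
  move=> lh nh; apply: Phi_supp => // w sw _ ow; apply: g0; rewrite ?out_iota; last 1 first.
  - by rewrite /= in_A_iota.
  - by rewrite /= sw.
  exact: leq_trans ow lh.
rewrite [LHS]/= [X in X + _ + _](_ : _ = 0) ?add0r; last first.
  case: a ns => // a1 a' ns.
  rewrite big_seq big1 // => p /(@wsw_size _ _ (x :: h)) sp.
  by apply: stepA; rewrite sp //; move: ns; rewrite /= addnS => -[].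
rewrite [X in _ + X](_ : _ = 0) ?addr0; last first.
  rewrite big_nat big1 // => i ih; rewrite big_seq big1 ?scaler0 // => c ch.
  have sc := contract_size (h := x :: h) ih ch.
  by apply: stepA; rewrite ?sc //; [move: sc => [->]; rewrite leqnSn|move: ns; rewrite -sc addSn => -[]].
rewrite IH; [|by case: ns|].
  by rewrite scalerA -exprD -mulnS.
move=> w sw ow hw; apply: g0; rewrite /= ?sw ?hw ?orbT //.
by rewrite /outside /= -add1n leq_add // leq_b1.
Qed.

End Support.

(** * The comparison map and the last letter *)

Lemma sign_odd_eq (R : pzRingType) m n : odd m = odd n -> (-1) ^+ m = (-1) ^+ n :> R.
Proof. by move=> mn; rewrite -signr_odd mn signr_odd. Qed.

(** Merging the letters i and i + 1 forbids the cut i between them; the other cuts are renumbered as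
    the cuts of the merged word. *)
Lemma sum_skip (U : nmodType) (X : nat -> U) i s : (0 < i < s)%N ->
  \sum_(0 <= m < s.+1) (if (i < m)%N then X m.-1 else if (m < i)%N then X m else 0) =
  \sum_(0 <= m < s) X m.
Proof.
move=> /andP[i0 si].
have [ltsS les leS] : [/\ (i < s.+1)%N, (i <= s)%N & (i <= s.+1)%N] by split; lia.
rewrite (big_cat_nat (n := i)) //= [in RHS](big_cat_nat (n := i)) //=.
rewrite [X in _ + X = _]big_ltn //.
rewrite ltnn add0r; congr (_ + _).
  by rewrite big_nat [in RHS]big_nat; apply: eq_bigr => m /andP[_ mi]; rewrite ltnNge ltnW //= mi.
rewrite big_add1 /= big_nat [in RHS]big_nat; apply: eq_bigr => m /andP[im _].
by rewrite ltnS im.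
Qed.

Lemma sum_split_at (U : nmodType) (X : nat -> U) P Q : ((0 < P)%N -> X P = 0) ->
  \sum_(1 <= i < P + Q) X i = \sum_(1 <= i < P) X i + \sum_(1 <= j < Q) X (P + j)%N.
Proof.
case: P => [|P] X0; first by rewrite [X in _ = X + _]big_geq // add0r.
case: Q => [|Q]; first by rewrite addn0 [X in _ = _ + X]big_geq // addr0.
rewrite (big_cat_nat (n := P.+1)) //=; last exact: leq_addr.
congr (_ + _); rewrite big_ltn; last by lia.
rewrite X0 // add0r (big_addn 1 _ P.+1).
have -> : (P.+1 + Q.+1 - P.+1 = Q.+1)%N by lia.
by apply: eq_bigr => i _; rewrite addnC.
Qed.

Section RightPart.
Context {k : comNzRingType} {H : hopfAlgType k} {A : algType k}.
Context {act : weak_action H A} {f : {linear tensor H H -> A}} {E : algType k}.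
Variable cp : crossed_product act f E.
Local Notation "a # h" := (sharp cp a h) (at level 40).
Context {U : lmodType k}.
Implicit Types (Gam : seq E -> E -> U) (psi : seq A -> H + A -> U).

Fixpoint splitlast (Gam : seq E -> E -> U) w : U :=
  if w is x :: w' then
    if w' is _ :: _ then splitlast (fun u => Gam (x :: u)) w' else Gam [::] x
  else 0.

Lemma splitlast_rcons Gam w x : splitlast Gam (rcons w x) = Gam w x.
Proof.
elim: w Gam => [|y w IH] Gam //=; rewrite -[RHS](IH (fun u => Gam (y :: u))).
by case: w {IH}.
Qed.

(* The part of [Phi (splitlast Gam) h a] in which the last letter comes from the
   letters of h beyond the m-th, or from a when m = size h; these are never merged
   with the first m. *)
Fixpoint Phicut n m (Gam : seq E -> E -> U) (h : seq H) (a : seq A) : U :=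
  if n is n'.+1 then
    if n' == 0 then
      if m == 0 then
        match h, a with
        | [:: x], [::] => Gam [::] (1 # x)
        | [::], [:: a1] => Gam [::] (a1 # 1)
        | _, _ => 0
        end
      else 0
    else
      (if a is a1 :: a' then
         \sum_(p <- wsw h) Phicut n' m (fun u => Gam ((wact act p.1 a1 # 1) :: u)) p.2 a'
       else 0)
      + (-1) ^+ size a *:
          (if h is x :: h' then
             if m is m'.+1 then Phicut n' m' (fun u => Gam ((1 # x) :: u)) h' a else 0
           else 0)
      + \sum_(1 <= i < size h) (-1) ^+ (size a + i) *:
          \sum_(c <- contract act f i h)
            (if (i < m)%N then Phicut n' m.-1 (fun u => Gam ((c.1 # 1) :: u)) c.2 a
             else if (m < i)%N then Phicut n' m (fun u => Gam ((c.1 # 1) :: u)) c.2 a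
             else 0)
  else 0.

(** Each run has one cut m: its last letter gathers the letters of h after the m-th, or is the last
    letter of a, in which case m = size h. *)
Lemma Phi_splitlast n Gam h a : n.+1 = (size h + size a)%N ->
  Phi cp n.+1 (splitlast Gam) h a = \sum_(0 <= m < (size h).+1) Phicut n.+1 m Gam h a.
Proof.
elim: n Gam h a => [|n IH] Gam h a ns.
  case: h a ns => [|x [|y h]] [|a1 [|a2 a]] //=; rewrite ?addnS // => _.
    by rewrite big_seq1 big_nat1 scaler0 addr0 big_geq ?addr0.
  by rewrite add0r scale1r big_geq // addr0 big_nat_recl // big_nat1 /= addr0.
have Psl e h' a' : n.+1 = (size h' + size a')%N ->
    Phi cp n.+1 (fun u => splitlast Gam (e :: u)) h' a' =
    \sum_(0 <= m < (size h').+1) Phicut n.+1 m (fun u => Gam (e :: u)) h' a'.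
  by move=> nh; rewrite -IH //; apply: eq_Phi => -[].
have -> : Phi cp n.+2 (splitlast Gam) h a =
  (if a is a1 :: a' then
     \sum_(p <- wsw h) Phi cp n.+1 (fun u => splitlast Gam ((wact act p.1 a1 # 1) :: u)) p.2 a'
   else 0)
  + (-1) ^+ size a *:
      (if h is x :: h' then Phi cp n.+1 (fun u => splitlast Gam ((1 # x) :: u)) h' a else 0)
  + \sum_(1 <= i < size h) (-1) ^+ (size a + i) *:
      \sum_(c <- contract act f i h) Phi cp n.+1 (fun u => splitlast Gam ((c.1 # 1) :: u)) c.2 a.
  by [].
have PE m : Phicut n.+2 m Gam h a =
   (if a is a1 :: a' then
         \sum_(p <- wsw h) Phicut n.+1 m (fun u => Gam ((wact act p.1 a1 # 1) :: u)) p.2 a'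
       else 0)
      + (-1) ^+ size a *:
          (if h is x :: h' then
             if m is m'.+1 then Phicut n.+1 m' (fun u => Gam ((1 # x) :: u)) h' a else 0
           else 0)
      + \sum_(1 <= i < size h) (-1) ^+ (size a + i) *:
          \sum_(c <- contract act f i h)
            (if (i < m)%N then Phicut n.+1 m.-1 (fun u => Gam ((c.1 # 1) :: u)) c.2 a
             else if (m < i)%N then Phicut n.+1 m (fun u => Gam ((c.1 # 1) :: u)) c.2 a
             else 0).
  by [].
rewrite (eq_bigr _ (fun m _ => PE m)) {PE} !big_split; congr (_ + _ + _).
- case: a ns => [|a1 a'] ns; first by rewrite big1.
  rewrite exchange_big big_seq [in RHS]big_seq; apply: eq_bigr => p /wsw_size sp.
  by rewrite Psl sp //; move: ns; rewrite /= addnS => -[].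
- rewrite -scaler_sumr; congr (_ *: _).
  case: h ns => [|x h] ns; first by rewrite big1.
  by rewrite big_nat_recl // add0r Psl //; case: ns.
- rewrite [RHS]exchange_big_nat; apply: eq_big_nat => i ih.
  rewrite -scaler_sumr; congr (_ *: _); rewrite exchange_big.
  rewrite big_seq [in RHS]big_seq; apply: eq_bigr => c /(contract_size ih) sc.
  rewrite (sum_skip (fun m => Phicut n.+1 m (fun u => Gam ((c.1 # 1) :: u)) c.2 a)) //.
  by rewrite Psl ?sc //; move: ns; rewrite -sc addSn => -[].
Qed.

(* The runs of a single block q of letters: the arguments of psi are the word over A
   produced while the letters of q are merged together, and the resulting letter, or the
   last letter of a when q is empty. *)
Fixpoint block n (psi : seq A -> H + A -> U) (q : seq H) (a : seq A) : U :=
  if n is n'.+1 then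
    if n' == 0 then
      match q, a with
      | [:: x], [::] => psi [::] (inl x)
      | [::], [:: a1] => psi [::] (inr a1)
      | _, _ => 0
      end
    else
      (if a is a1 :: a' then
         \sum_(p <- wsw q) block n' (fun u => psi (wact act p.1 a1 :: u)) p.2 a'
       else 0)
      + \sum_(1 <= i < size q) (-1) ^+ (size a + i) *:
          \sum_(c <- contract act f i q) block n' (fun u => psi (c.1 :: u)) c.2 a
  else 0.

Lemma eq_block n psi psi' q a :
  (forall w e, (size w).+1 = n -> psi w e = psi' w e) ->
  block n psi q a = block n psi' q a.
Proof.
elim: n psi psi' q a => [|n IH] psi psi' q a pp' //=; case: eqP => [n0|_].
  by case: q a => [|x [|y q]] [|a1 [|a2 a]] //; rewrite pp' // n0.
have E1 b q' a' : block n (fun u => psi (b :: u)) q' a' = block n (fun u => psi' (b :: u)) q' a'.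
  by apply: IH => w e sw; apply: pp'; rewrite /= sw.
congr (_ + _); first by case: a => // a1 a'; apply: eq_bigr.
by apply: eq_bigr => i _; congr (_ *: _); apply: eq_bigr.
Qed.

Lemma block_lin n c psi psi' q a :
  block n (fun w e => c *: psi w e + psi' w e) q a = c *: block n psi q a + block n psi' q a.
Proof.
elim: n psi psi' q a => [|n IH] psi psi' q a /=; first by rewrite scaler0 addr0.
case: eqP => [_|_].
  by case: q a => [|x [|y q]] [|a1 [|a2 a]]; rewrite ?scaler0 ?addr0.
rewrite scalerDr [RHS]addrACA; congr (_ + _).
  case: a => [|a1 a]; first by rewrite scaler0 addr0.
  by rewrite scaler_sumr -big_split; apply: eq_bigr => p _; rewrite IH.
rewrite scaler_sumr -big_split; apply: eq_bigr => i _ /=.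
rewrite scalerA mulrC -scalerA -scalerDr; congr (_ *: _).
by rewrite scaler_sumr -big_split; apply: eq_bigr => p _; rewrite IH.
Qed.

Lemma block0 n q a : block n (fun _ _ => 0) q a = 0.
Proof.
transitivity (block n (fun _ _ => (-1) *: 0 + 0) q a).
  by apply: eq_block => w e _; rewrite scaler0 addr0.
by rewrite (block_lin n (-1) (fun _ _ => 0) (fun _ _ => 0)) scaleN1r addNr.
Qed.

Lemma blockD n psi psi' q a :
  block n (fun w e => psi w e + psi' w e) q a = block n psi q a + block n psi' q a.
Proof.
rewrite -[block n psi q a]scale1r -block_lin; apply: eq_block => w e _.
by rewrite scale1r.
Qed.

Lemma blockZ n c psi q a : block n (fun w e => c *: psi w e) q a = c *: block n psi q a.
Proof.
rewrite -[RHS]addr0 -[X in _ + X](block0 n q a) -block_lin.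
by apply: eq_block => w e _; rewrite addr0.
Qed.

Lemma block_sum n I (r : seq I) (psi : I -> seq A -> H + A -> U) q a :
  block n (fun w e => \sum_(i <- r) psi i w e) q a = \sum_(i <- r) block n (psi i) q a.
Proof.
elim: r => [|i r IH].
  by rewrite big_nil -[RHS](block0 n q a); apply: eq_block => w e _; rewrite big_nil.
by rewrite big_cons -IH -blockD; apply: eq_block => w e _; rewrite big_cons.
Qed.

Lemma wact_cat u v (a : A) : wact act (u ++ v) a = wact act u (wact act v a).
Proof. by rewrite /wact foldr_cat. Qed.

Lemma contract_catl (K : A -> seq H -> U) p q i : (0 < i < size p)%N ->
  \sum_(c <- contract act f i (p ++ q)) K c.1 c.2 =
  \sum_(c <- contract act f i p) K c.1 (c.2 ++ q).
Proof.
move=> /andP[i0 ip]; rewrite sum_contract (sum_contract (fun a h => K a (h ++ q))).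
have ip' : (i.-1 < size p)%N by lia.
rewrite take_cat ip' !nth_cat ip ip' drop_cat.
have -> : (if (i.+1 < size p)%N then drop i.+1 p ++ q else drop (i.+1 - size p) q) =
   drop i.+1 p ++ q.
  case: ltnP => // pi; have -> : (i.+1 - size p = 0)%N by lia.
  by rewrite drop0 drop_oversize.
by apply: eq_bigr => u _; apply: eq_bigr => x _; apply: eq_bigr => y _; rewrite -catA.
Qed.

Lemma contract_catr (K : A -> seq H -> U) p q j : (0 < j)%N ->
  \sum_(c <- contract act f (size p + j) (p ++ q)) K c.1 c.2 =
  \sum_(c <- contract act f j q) \sum_(u <- wsw p) K (wact act u.1 c.1) (u.2 ++ c.2).
Proof.
move=> j0; rewrite sum_contract.
rewrite (sum_contract (fun a h => \sum_(u <- wsw p) K (wact act u.1 a) (u.2 ++ h))).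
have -> : ((size p + j).-1 = size p + j.-1)%N by lia.
have lt0 i : (size p + i < size p)%N = false by lia.
have lt1 : ((size p + j).+1 < size p)%N = false by lia.
have subS : ((size p + j).+1 - size p = j.+1)%N by lia.
rewrite take_cat !nth_cat drop_cat !lt0 lt1 subS !addKn.
rewrite (wsw_cat p (take j.-1 q) (fun u v => \sum_(x <- sw q`_j.-1) \sum_(y <- sw q`_j)
  K (wact act u (f (x.1 ⊗ y.1))) (v ++ x.2 * y.2 :: drop j.+1 q))).
rewrite exchange_big; apply: eq_bigr => v _ /=; rewrite exchange_big; apply: eq_bigr => x _.
rewrite exchange_big; apply: eq_bigr => y _; apply: eq_bigr => u _ /=.
by rewrite wact_cat catA.
Qed.

Definition embed (z : H + A) : E := match z with inl x => 1 # x | inr b => b # 1 end.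

(** With the cut after p, the block q turns a into a word w over A and a last letter. The letters of
    w then pass through p exactly as the word over A in an ordinary run of Phi on p. The proof
    compares the first steps of both sides. *)
Lemma Phicut_cat n Gam p q a : n = (size p + (size q + size a))%N ->
  Phicut n (size p) Gam (p ++ q) a =
  (-1) ^+ ((size q).+1 * size p) *:
    block (size q + size a)
      (fun w e => Phi cp (size p + size w) (fun u => Gam u (embed e)) p w) q a.
Proof.
elim: n Gam p q a => [|n IH] Gam p q a ns.
  by case: p q a ns => [|x p] [|y q] [|a1 a] //= _; rewrite scaler0.
have [n0|n0] := posnP n.
  subst n; case: p q a ns => [|x [|x' p]] [|y [|y' q]] [|a1 [|a2 a]] //= _;
    by rewrite ?expr0 ?scale1r ?scaler0.
case: n n0 IH ns => // n _ IH ns.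
set sg := (-1) ^+ _.
pose psi w e := Phi cp (size p + size w) (fun u => Gam u (embed e)) p w.
(* The three possible first steps of the inner Phi: action of p on the first letter of w, emission
   of the first letter of p, contraction inside p. *)
pose psit (w : seq A) (e : H + A) : U := if w is b :: w' then
  \sum_(u <- wsw p) Phi cp (size p + size w') (fun v => Gam ((wact act u.1 b # 1) :: v) (embed e)) u.2 w'
  else 0.
pose psie (w : seq A) (e : H + A) : U := if p is x :: p' then
  Phi cp (size p' + size w) (fun v => Gam ((1 # x) :: v) (embed e)) p' w else 0.
pose psic i (w : seq A) (e : H + A) : U := \sum_(c <- contract act f i p)
  Phi cp (size c.2 + size w) (fun v => Gam ((c.1 # 1) :: v) (embed e)) c.2 w.
have nsE : (size (p ++ q) + size a = n.+2)%N by rewrite size_cat; lia.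
pose N := (size q + size a)%N.
have blockE : block N psi q a = block N psit q a + (-1) ^+ N.-1 *: block N psie q a +
    \sum_(1 <= i < size p) (-1) ^+ (N.-1 + i) *: block N (psic i) q a.
  rewrite -blockZ -blockD.
  under eq_bigr do rewrite -blockZ.
  rewrite -block_sum -blockD; apply: eq_block => w e sw.
  have [m pwE] : exists m, (size p + size w = m.+1)%N.
    exists (size p + size w).-1; rewrite prednK //; lia.
  rewrite /psi pwE -sw /=; congr (_ + _ *: _ + _).
  - rewrite /psit; case: w {sw} pwE => // b w pwE; apply: eq_bigr => u _.
    by congr (Phi cp _ _ _ _); move: pwE; rewrite /= addnS => -[].
  - by rewrite /psie; case: (p) pwE => // x p' [->].
  - apply: eq_big_nat => i ih; congr (_ *: _); rewrite /psic big_seq [RHS]big_seq.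
    apply: eq_bigr => c /(contract_size ih) sc.
    by congr (Phi cp _ _ _ _); move: pwE; rewrite -sc => -[].
rewrite -/N -/psi blockE.
(* The first letter of w is the one produced by the first step of the block; when N <= 1 the word w
   is empty and both sides vanish. *)
have blockT : block N psit q a =
  (if a is a1 :: a' then
     \sum_(v <- wsw q) block N.-1 (fun w e => psit (wact act v.1 a1 :: w) e) v.2 a' else 0) +
  \sum_(1 <= j < size q) (-1) ^+ (size a + j) *:
     \sum_(c <- contract act f j q) block N.-1 (fun w e => psit (c.1 :: w) e) c.2 a.
  rewrite /N; case NE: (size q + size a)%N => [|[|m]] //.
    by move: NE; case: (q) (a) => [|y q'] [|a1 a'] //= _; rewrite big_geq ?addr0.
  move: NE; case: (q) (a) => [|y [|y' q']] [|a1 [|a2 a']] //= NE; try by lia.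
    by rewrite big_seq1 big_geq // addr0.
  by rewrite big_geq // addr0.
have partT : (if a is a1 :: a' then \sum_(x <- wsw (p ++ q))
      Phicut n.+1 (size p) (fun u => Gam ((wact act x.1 a1 # 1) :: u)) x.2 a' else 0) =
   sg *: (if a is a1 :: a' then
     \sum_(v <- wsw q) block N.-1 (fun w e => psit (wact act v.1 a1 :: w) e) v.2 a' else 0).
  rewrite /sg /N; case: (a) ns => [|a1 a'] ns'; first by rewrite scaler0.
  rewrite (wsw_cat p q (fun x y => Phicut n.+1 (size p) (fun u => Gam ((wact act x a1 # 1) :: u)) y a')).
  rewrite exchange_big scaler_sumr big_seq [RHS]big_seq; apply: eq_bigr => v /wsw_size sv.
  rewrite block_sum scaler_sumr big_seq [RHS]big_seq; apply: eq_bigr => u /wsw_size su.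
  rewrite -{1}su IH; last by rewrite su sv; move: ns'; rewrite /= !addnS => -[].
  rewrite su sv /= addnS /=; congr (_ *: _); apply: eq_block => w e _.
  by rewrite wact_cat.
have partE : (-1) ^+ size a *: (if p ++ q is x :: h' then
      if size p is m'.+1 then Phicut n.+1 m' (fun u => Gam ((1 # x) :: u)) h' a else 0
    else 0) = sg *: ((-1) ^+ N.-1 *: block N psie q a).
  rewrite /sg /psie; case: (p) ns => [|x p'] ns'.
    by rewrite block0 !scaler0; case: (q) => [|y q'] /=; rewrite scaler0.
  rewrite -[X in _ *: X = _]/(Phicut n.+1 (size p') (fun u => Gam ((1 # x) :: u)) (p' ++ q) a).
  rewrite IH; last by move: ns' => [].
  rewrite -/N !scalerA -!exprD; have [N0|N0] := posnP N; first by rewrite N0 !scaler0.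
  congr (_ *: _); apply: sign_odd_eq; rewrite [size (x :: p')]/= mulnS.
  by move: ((size q).+1 * size p')%N N0; rewrite /N => t; lia.
have partC : \sum_(1 <= i < size (p ++ q)) (-1) ^+ (size a + i) *:
      \sum_(c <- contract act f i (p ++ q))
        (if (i < size p)%N then Phicut n.+1 (size p).-1 (fun u => Gam ((c.1 # 1) :: u)) c.2 a
         else if (size p < i)%N then Phicut n.+1 (size p) (fun u => Gam ((c.1 # 1) :: u)) c.2 a
         else 0) =
   \sum_(1 <= i < size p) sg *: ((-1) ^+ (N.-1 + i) *: block N (psic i) q a) +
   \sum_(1 <= j < size q) sg *: ((-1) ^+ (size a + j) *:
      \sum_(c <- contract act f j q) block N.-1 (fun w e => psit (c.1 :: w) e) c.2 a).
  (* The contraction across the cut, i = size p, is the one that [Phicut] sets to 0. *)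
  rewrite size_cat sum_split_at => [|_]; last first.
    by rewrite ltnn big1 ?scaler0.
  congr (_ + _); apply: eq_big_nat => i ih.
    have /andP[_ ip] := ih; rewrite ip.
    rewrite (contract_catl (fun b h => Phicut n.+1 (size p).-1 (fun u => Gam ((b # 1) :: u)) h a)) //.
    rewrite /psic block_sum !scaler_sumr big_seq [RHS]big_seq.
    apply: eq_bigr => c /(contract_size ih) sc.
    have -> : (size p).-1 = size c.2 by rewrite -sc.
    rewrite IH; last by move: ns; rewrite -sc addSn => -[].
    rewrite -/N !scalerA -!exprD; have [N0|N0] := posnP N; first by rewrite N0 !scaler0.
    congr (_ *: _); apply: sign_odd_eq; rewrite -sc mulnS /N.
    by move: ((size q).+1 * size c.2)%N N0; rewrite /N => t; lia.
  have /andP[i0 iq] := ih.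
  have -> : (size p + i < size p)%N = false by lia.
  have -> : (size p < size p + i)%N by lia.
  rewrite (contract_catr (fun b h => Phicut n.+1 (size p) (fun u => Gam ((b # 1) :: u)) h a)) //.
  rewrite !scaler_sumr big_seq [RHS]big_seq.
  apply: eq_bigr => c /(contract_size ih) sc.
  rewrite block_sum !scaler_sumr big_seq [RHS]big_seq; apply: eq_bigr => u /wsw_size su.
  rewrite -[X in Phicut _ X]su IH; last by move: ns; rewrite su -sc addSn addnS => -[].
  rewrite su !scalerA -!exprD /N -sc addSn; congr (_ *: _); apply: sign_odd_eq.
  by rewrite !mulSn; move: (size c.2 * size p)%N => t; lia.
have -> : Phicut n.+2 (size p) Gam (p ++ q) a =
   (if a is a1 :: a' then \sum_(x <- wsw (p ++ q))
      Phicut n.+1 (size p) (fun u => Gam ((wact act x.1 a1 # 1) :: u)) x.2 a' else 0) +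
   (-1) ^+ size a *: (if p ++ q is x :: h' then
      if size p is m'.+1 then Phicut n.+1 m' (fun u => Gam ((1 # x) :: u)) h' a else 0
    else 0) +
   \sum_(1 <= i < size (p ++ q)) (-1) ^+ (size a + i) *:
      \sum_(c <- contract act f i (p ++ q))
        (if (i < size p)%N then Phicut n.+1 (size p).-1 (fun u => Gam ((c.1 # 1) :: u)) c.2 a
         else if (size p < i)%N then Phicut n.+1 (size p) (fun u => Gam ((c.1 # 1) :: u)) c.2 a
         else 0) by [].
rewrite partT partE partC blockT !scalerDr !scaler_sumr -!addrA; congr (_ + _).
by rewrite [RHS]addrC -!addrA.
Qed.

End RightPart.

(** * The components of the differential *)

Section FormalSums.
Context {k : comNzRingType} {H : hopfAlgType k} {A : algType k} {U : lmodType k}.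
Implicit Types (g : seq A -> U) (t : fsum (k := k) (A := A)).

Lemma feval_lin g g' c t :
  feval (fun w => c *: g w + g' w) t = c *: feval g t + feval g' t.
Proof.
rewrite /feval scaler_sumr -big_split; apply: eq_bigr => x _ /=.
by rewrite scalerDr !scalerA mulrC.
Qed.

Lemma eq_feval g g' t : g =1 g' -> feval g t = feval g' t.
Proof. by move=> gg'; apply: eq_bigr => x _; rewrite gg'. Qed.

Lemma feval_sum I (r : seq I) (g : I -> seq A -> U) t :
  feval (fun w => \sum_(i <- r) g i w) t = \sum_(i <- r) feval (g i) t.
Proof.
rewrite /feval exchange_big; apply: eq_bigr => x _; exact: scaler_sumr.
Qed.

Lemma fevalZ c g t : feval (fun w => c *: g w) t = c *: feval g t.
Proof. by rewrite /feval scaler_sumr; apply: eq_bigr => x _; rewrite !scalerA mulrC. Qed.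

Lemma feval_bigcat g I (r : seq I) (F : I -> fsum) :
  feval g (\big[cat/[::]]_(i <- r) F i) = \sum_(i <- r) feval g (F i).
Proof. by rewrite /feval sum_bigcat. Qed.

Lemma feval_fcat g t t' :
  feval g (fcat t t') = feval (fun w => feval (fun w' => g (w ++ w')) t') t.
Proof.
rewrite /feval /fcat big_allpairs_dep; apply: eq_bigr => x _.
by rewrite scaler_sumr; apply: eq_bigr => y _; rewrite scalerA.
Qed.

Lemma feval_word g w : feval g (fword w) = g w.
Proof. by rewrite /feval big_seq1 scale1r. Qed.

Lemma feval_scale g c t : feval g (fscale c t) = c *: feval g t.
Proof.
by rewrite /feval big_map scaler_sumr; apply: eq_bigr => x _; rewrite scalerA.
Qed.

End FormalSums.

(** * Runs of a single block of letters *)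

Section Block.
Context {k : comNzRingType} {H : hopfAlgType k} {A : algType k}.
Context {act : weak_action H A} {f : {linear tensor H H -> A}} {E : algType k}.
Variable cp : crossed_product act f E.
Local Notation "a # h" := (sharp cp a h) (at level 40).
Local Notation ones h := (map (sharp cp 1) h).
Context {U : lmodType k}.
Implicit Types (g : seq A -> U) (psi : seq A -> H + A -> U).
Local Notation block := (@block k H A act f U).

Lemma weps_multilin (x : U) : multilin (fun h : seq H => weps h *: x).
Proof.
move=> u v c y z; rewrite /weps !big_cat !big_cons /= linearP /=.
by rewrite mulrDl mulrDr scalerDl !scalerA; congr (_ *: _ + _); ring.
Qed.

Lemma feval_tact_cons g h a1 a : feval g (tact act h (a1 :: a)) =
  \sum_(p <- wsw h) feval (fun w => g (wact act p.1 a1 :: w)) (tact act p.2 a).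
Proof.
rewrite /= feval_bigcat; apply: eq_bigr => p _; rewrite feval_fcat.
exact: feval_word.
Qed.

Lemma feval_tact_nil g h : feval g (tact act h [::]) = weps h *: g [::].
Proof. by rewrite /feval big_seq1. Qed.

Lemma wact_tail_multilin g h a1 a : multilin g ->
  multilin (fun x => feval (fun w => g (wact act x a1 :: w)) (tact act h a)).
Proof.
move=> gm u v c x y; rewrite -feval_lin; apply: eq_feval => w.
by rewrite wact_multilin multilin_consl.
Qed.

Lemma tact_multilin g a : multilin g -> multilin (fun h => feval g (tact act h a)).
Proof.
elim: a g => [|a1 a IH] g gm.
  by move=> u v c x y; rewrite !feval_tact_nil; exact: weps_multilin.
move=> u v c x y; rewrite !feval_tact_cons.
apply: (wsw_multilin (G := fun x y => feval (fun w => g (wact act x a1 :: w)) (tact act y a))).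
- by move=> h; exact: wact_tail_multilin.
- by move=> h; apply: IH; exact: multilin_tail.
Qed.

Definition contract_sum (K : A -> seq H -> U) (h : seq H) : U :=
  \sum_(1 <= j < size h) (-1) ^+ j *: \sum_(c <- contract act f j h) K c.1 c.2.

(** Up to the term of the leading 1, the alternating sum of contractions is a merge sum of a normal
    form, hence multilinear in h; K is extended from A to E by [epsA] for this purpose. *)
Lemma contract_sum_multilin K : (forall h, linear (K ^~ h)) -> (forall a, multilin (K a)) ->
  multilin (contract_sum K).
Proof.
move=> K1 K2; pose K' e h := K (epsA cp e) h.
have Kl : letter_linear K'.
  by split=> [h c x y|e]; [rewrite /K' epsA_linear K1|exact: K2].
have KE h : contract_sum K h = mergesum (fun w => NF cp K' (1 :: w)) (ones h).
  have := step_merge cp h Kl.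
  case: h => [|x h].
    by move=> _; rewrite /contract_sum big_geq.
  rewrite map_cons mergesum_cons opprD opprK mul1r opprK.
  rewrite -(NF_ones cp _ _ Kl) => /addrI <-; apply: eq_bigr => i _; congr (_ *: _).
  by apply: eq_bigr => c _; rewrite /K' epsA_iota.
move=> u v c x y; rewrite !KE; apply: multilin_ones.
by apply: mergesum_multilin; apply: multilin_tail; exact: NF_multilin.
Qed.

Lemma block_step n psi q a : block n.+2 psi q a =
  (if a is a1 :: a' then
     \sum_(p <- wsw q) block n.+1 (fun u => psi (wact act p.1 a1 :: u)) p.2 a'
   else 0)
  + (-1) ^+ size a *: contract_sum (fun b h => block n.+1 (fun u => psi (b :: u)) h a) q.
Proof.
rewrite /contract_sum scaler_sumr [LHS]/=; congr (_ + _).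
by apply: eq_bigr => i _; rewrite scalerA exprD.
Qed.

Definition psi_linear psi :=
  (forall z, multilin (psi ^~ z)) /\ (forall w, linear (fun x => psi w (inl x))).

Lemma psi_linear_cons psi b : psi_linear psi -> psi_linear (fun w => psi (b :: w)).
Proof. move=> [P1 P2]; split=> [z|w]; [exact: multilin_tail (P1 z)|exact: P2]. Qed.

Lemma block_letter n psi q a : psi_linear psi ->
  linear (fun b => block n (fun w => psi (b :: w)) q a).
Proof.
move=> [P1 _] c x y; rewrite -block_lin; apply: eq_block => w e _.
exact: (P1 e [::]).
Qed.

Lemma block_multilin n psi a : psi_linear psi -> multilin (fun q => block n psi q a).
Proof.
elim: n psi a => [|[|n] IH] psi a P.
- by move=> u v c x y; rewrite /= scaler0 addr0.
- move=> [|z [|z' u]] [|t v] c x y /=; rewrite ?scaler0 ?addr0 //.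
    by case: a => [|a1 a]; rewrite ?scaler0 ?addr0 // P.2.
- move=> u v c x y; rewrite !block_step.
  rewrite (contract_sum_multilin (K := fun b h => block n.+1 (fun u => psi (b :: u)) h a)); last first.
  + by move=> b; apply: IH; exact: psi_linear_cons.
  + by move=> h; exact: block_letter.
  rewrite !scalerDr [RHS]addrACA; congr (_ + _); last by rewrite !scalerA mulrC.
  case: a => [|a1 a]; first by rewrite scaler0 addr0.
  apply: (wsw_multilin (G := fun x y => block n.+1 (fun u => psi (wact act x a1 :: u)) y a)).
  + by move=> h u' v' d x' y'; rewrite wact_multilin; exact: block_letter.
  + by move=> h; apply: IH; exact: psi_linear_cons.
Qed.

Lemma block_nil_rcons n psi a x : n = size a ->
  block n.+1 psi [::] (rcons a x) = psi a (inr x).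
Proof.
elim: a n psi => [|a1 a IH] n psi -> //.
by rewrite rcons_cons block_step /contract_sum big_geq // scaler0 addr0 big_seq1 IH.
Qed.

Lemma block_nil_nil n psi : block n psi [::] [::] = 0.
Proof.
by case: n => [|[|n]] //; rewrite block_step /contract_sum big_geq // scaler0 addr0.
Qed.

(* All the letters of a that are consumed before the first merge are made explicit. *)
Lemma block_unroll psi q a : psi_linear psi -> (1 < size q)%N ->
  block (size q + size a) psi q a =
  \sum_(0 <= i < (size a).+1) (-1) ^+ (size a - i) *:
    \sum_(p <- wsw q) feval (fun w =>
      contract_sum (fun b h => block (size q + size a - i).-1 (fun u => psi (w ++ b :: u)) h
        (drop i a)) p.2) (tact act p.1 (take i a)).
Proof.
elim: a psi q => [|a1 a IH] psi q P sq.
  rewrite big_nat1 subn0 expr0 scale1r addn0.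
  have Cm : multilin (contract_sum (fun b h => block (size q).-1 (fun u => psi (b :: u)) h [::])).
    apply: contract_sum_multilin => [h|b]; first exact: block_letter.
    by apply: block_multilin; exact: psi_linear_cons.
  rewrite (eq_bigr (fun p => weps p.1 *: contract_sum
    (fun b h => block (size q).-1 (fun u => psi (b :: u)) h [::]) p.2)); last first.
    by move=> p _; rewrite feval_tact_nil subn0.
  rewrite (wsw_counit Cm); case: (size q) sq => [|[|n]] // _.
  by rewrite block_step add0r scale1r.
have [n qE] : exists n, size q = n.+2 by exists (size q).-2; lia.
rewrite big_nat_recl // [RHS]addrC.
have -> : (size q + size (a1 :: a))%N = (size q + size a).-1.+2 by rewrite /= qE; lia.
rewrite block_step; congr (_ + _).
  transitivity (\sum_(p <- wsw q) \sum_(0 <= i < (size a).+1) (-1) ^+ (size a - i) *: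
    \sum_(p' <- wsw p.2) feval (fun w =>
      contract_sum (fun b h => block (size q + size a - i).-1
        (fun u => psi (wact act p.1 a1 :: w ++ b :: u)) h
        (drop i a)) p'.2) (tact act p'.1 (take i a))).
    rewrite big_seq [RHS]big_seq; apply: eq_bigr => p /wsw_size sp.
    have -> : ((size q + size a).-1.+1 = size p.2 + size a)%N by rewrite sp qE; lia.
    by rewrite (IH _ _ (psi_linear_cons _ P)) sp.
  rewrite exchange_big; apply: eq_big_nat => i /andP[_ ia].
  rewrite subSS -scaler_sumr; congr (_ *: _).
  pose K x w b h := block (size q + size a - i).-1 (fun u => psi (wact act x a1 :: w ++ b :: u)) h (drop i a).
  have Kw x w b : psi_linear (fun u => psi (wact act x a1 :: w ++ b :: u)).
    split=> [z|v]; last exact: P.2.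
    by move=> u v c y y'; have := P.1 z (wact act x a1 :: w ++ b :: u) v c y y'; rewrite /= -!catA.
  rewrite (wsw_coassoc (T := fun x y z => feval (fun w => contract_sum (K x w) z)
    (tact act y (take i a)))).
  - apply: eq_bigr => p _.
    have -> : ((size q + size a).-1.+1 - i = size q + size a - i)%N by lia.
    by rewrite feval_tact_cons.
  - move=> y z u v c x x'; rewrite -feval_lin; apply: eq_feval => w.
    rewrite /contract_sum scaler_sumr -big_split; apply: eq_bigr => j _ /=.
    rewrite scalerA mulrC -scalerA -scalerDr; congr (_ *: _).
    rewrite scaler_sumr -big_split; apply: eq_bigr => e _ /=.
    rewrite /K -block_lin; apply: eq_block => t s _.
    by rewrite wact_multilin (P.1 s [::]).
  - move=> x z; apply: tact_multilin => u v c y y'.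
    rewrite /contract_sum scaler_sumr -big_split; apply: eq_bigr => j _ /=.
    rewrite scalerA mulrC -scalerA -scalerDr; congr (_ *: _).
    rewrite scaler_sumr -big_split; apply: eq_bigr => e _ /=.
    rewrite /K -block_lin; apply: eq_block => t s _.
    by rewrite -!catA -!cat_cons (P.1 s).
  - move=> x y u v c z z'; rewrite -feval_lin; apply: eq_feval => w.
    apply: contract_sum_multilin => [h|b].
      move=> d b b'; rewrite /K -block_lin; apply: eq_block => t s _.
      by rewrite -!cat_cons (P.1 s).
    by apply: block_multilin.
rewrite subn0 -/(size a) take0 drop0.
have Cm : multilin (contract_sum (fun b h => block (size q + size a).-1.+1
     (fun u => psi (b :: u)) h (a1 :: a))).
  apply: contract_sum_multilin => [h|b]; first exact: block_letter.
  by apply: block_multilin; exact: psi_linear_cons.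
rewrite (eq_bigr (fun p => weps p.1 *: contract_sum
    (fun b h => block (size q + size a).-1.+1 (fun u => psi (b :: u)) h (a1 :: a)) p.2)).
  by rewrite (wsw_counit Cm).
move=> p _; rewrite feval_tact_nil.
by have -> : (((size q + size a).-1.+2 - 0).-1 = (size q + size a).-1.+1)%N by rewrite qE; lia.
Qed.

End Block.

(* F^(l) for l >= 1, with F^(1)(h (x) a) = a^h. *)
Definition Fmap1 (k : comNzRingType) (H : hopfAlgType k) (A : algType k)
    (act : weak_action H A) (f : {linear tensor H H -> A}) l (h : seq H) (a : seq A) :=
  if l == 1 then tact act h a else Fmap act f l h a.

(** * The maps F^(l) as runs of a block *)

Section FmapBlock.
Context {k : comNzRingType} {H : hopfAlgType k} {A : algType k}.
Context {act : weak_action H A} {f : {linear tensor H H -> A}} {E : algType k}.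
Variable cp : crossed_product act f E.
Context {U : lmodType k}.
Implicit Types (g : seq A -> U) (psi : seq A -> H -> U).
Local Notation block := (@block k H A act f U).

Definition onl psi (w : seq A) (z : H + A) : U :=
  if z is inl x then psi w x else 0.

Lemma feval_F2 g x y a1 a : feval g (F2 act f [:: x; y] (a1 :: a)) =
  \sum_(0 <= i < (size a).+2) (-1) ^+ i.+1 *:
    \sum_(p <- wsw [:: x; y]) feval (fun w => \sum_(c <- contract act f 1 p.2)
       feval (fun w' => g (w ++ c.1 :: w')) (tact act c.2 (drop i (a1 :: a))))
       (tact act p.1 (take i (a1 :: a))).
Proof.
rewrite /F2 feval_bigcat; apply: eq_bigr => i _.
rewrite feval_bigcat scaler_sumr big_seq [RHS]big_seq; apply: eq_bigr => p pw.
rewrite feval_bigcat.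
have [x' [y' ->]] : exists x' y', p.2 = [:: x'; y'].
  have := wsw_size pw; case: (p.2) => [|x' [|y' [|z v]]] // _; by exists x', y'.
have C1 (K : A -> seq H -> U) : \sum_(c <- contract act f 1 [:: x'; y']) K c.1 c.2 =
    \sum_(q <- wsw [:: x'; y']) K (f (q.1`_0 ⊗ q.1`_1)) [:: \prod_(z <- q.2) z].
  rewrite sum_contract big_seq1 /= (wsw_cons x' [:: y'] (fun u v =>
     K (f (u`_0 ⊗ u`_1)) [:: \prod_(z <- v) z])).
  rewrite (wsw_cons y' [::] (fun u v => \sum_(q <- sw x')
     K (f ((q.1 :: u)`_0 ⊗ (q.1 :: u)`_1)) [:: \prod_(z <- q.2 :: v) z])) big_seq1.
  rewrite exchange_big; apply: eq_bigr => q _; apply: eq_bigr => s _ /=.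
  by rewrite !big_cons big_nil mulr1.
rewrite (eq_feval (g' := fun w => \sum_(q <- wsw [:: x'; y'])
   feval (fun w' => g (w ++ f (q.1`_0 ⊗ q.1`_1) :: w'))
     (tact act [:: \prod_(z <- q.2) z] (drop i (a1 :: a))))) => [|w]; last first.
  by rewrite (C1 (fun b h => feval (fun w' => g (w ++ b :: w')) (tact act h (drop i (a1 :: a))))).
rewrite feval_sum scaler_sumr; apply: eq_bigr => q _.
rewrite feval_scale feval_fcat; congr (_ *: _); apply: eq_feval => w.
by rewrite feval_fcat feval_word.
Qed.

Lemma feval_Fmap_cons l g h a1 a : size h = l.+2 ->
  feval g (Fmap act f l.+2 h (a1 :: a)) =
  \sum_(1 <= j < l.+2) \sum_(0 <= i < (size a).+2) (-1) ^+ (i * l.+1 + j) *: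
    \sum_(p <- wsw h) feval (fun w => \sum_(c <- contract act f j p.2)
       feval (fun w' => g (w ++ c.1 :: w')) (Fmap1 act f l.+1 c.2 (drop i (a1 :: a))))
       (tact act p.1 (take i (a1 :: a))).
Proof.
case: l => [|l] hl.
  rewrite big_nat1; case: h hl => [|x [|y [|z h]]] // _.
  rewrite [Fmap _ _ _ _ _]/= feval_F2; apply: eq_bigr => i _.
  by rewrite muln1 addn1.
rewrite [Fmap _ _ _ _ _]/= -/(Fmap act f l.+2) feval_bigcat; apply: eq_bigr => j _.
rewrite feval_bigcat; apply: eq_bigr => i _.
rewrite feval_bigcat scaler_sumr; apply: eq_bigr => p _.
rewrite feval_bigcat feval_sum scaler_sumr; apply: eq_bigr => c _.
rewrite feval_scale feval_fcat; congr (_ *: _); apply: eq_feval => w.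
by rewrite feval_fcat feval_word.
Qed.

Lemma feval_Fmap_nil l g h : size h = l.+3 ->
  feval g (Fmap act f l.+3 h [::]) =
  contract_sum (act := act) (f := f) (fun b h => feval (fun w' => g (b :: w')) (Fmap1 act f l.+2 h [::])) h.
Proof.
move=> hl; rewrite [Fmap _ _ _ _ _]/= -/(Fmap act f l.+2) feval_bigcat /contract_sum hl.
apply: eq_bigr => j _; rewrite feval_bigcat scaler_sumr; apply: eq_bigr => c _.
by rewrite feval_scale feval_fcat feval_word.
Qed.

(** F^(l) records only the word over A, so the letter in which the block ends is evaluated by the
    counit. *)
Definition epsg g (w : seq A) (x : H) : U := counit x *: g w.

Lemma epsg_linear g : multilin g -> psi_linear (onl (epsg g)).
Proof.
move=> gm; split=> [[x|b]|w] /=.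
- exact: multilin_Z.
- by move=> u v c x y; rewrite scaler0 addr0.
- by move=> c x y; rewrite /epsg linearP /= scalerDl scalerA.
Qed.

(** Both sides obey the same recursion: the index i in the definition of F^(l) is the number of
    letters of a consumed before the first merge, as in [block_unroll]. For l = 0 there is nothing
    to merge and the block is the action of one letter. *)
Lemma feval_Fmap l g h a : size h = l.+1 -> multilin g ->
  feval g (Fmap1 act f l.+1 h a) = (-1) ^+ (l * size a) *: block (l.+1 + size a) (onl (epsg g)) h a.
Proof.
elim: l g h a => [|l IH] g h a hl gm.
  rewrite expr0 scale1r /Fmap1 eqxx; elim: a g h hl gm => [|a1 a IHa] g h hl gm.
    case: h hl => [|x [|y h]] // _.
    by rewrite feval_tact_nil /weps big_seq1.
  rewrite feval_tact_cons [(1 + _)%N]/= addnS block_step.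
  rewrite /contract_sum hl big_geq // scaler0 addr0 big_seq [RHS]big_seq.
  apply: eq_bigr => p /wsw_size sp; rewrite IHa ?sp //; exact: multilin_tail.
rewrite [Fmap1 _ _ _ _ _]/Fmap1 [l.+2 == 1]/=; case: a => [|a1 a].
  rewrite muln0 expr0 scale1r addn0 block_step add0r expr0 scale1r.
  case: l IH hl => [|l] IH hl.
    case: h hl => [|x [|y [|z h]]] // _.
    (* F^(2)_0 is defined without comultiplication; the counits of h_1^(2) and h_2^(2) absorb the
       one present in the contraction. *)
    rewrite /Fmap /F2 /contract_sum big_nat1 expr1 scaleN1r /feval big_seq1 scaleN1r.
    congr (- _); rewrite (sum_contract (fun b h => block 1 (fun u => onl (epsg g) (b :: u)) h [::])).
    rewrite big_seq1 /=.
    transitivity (\sum_(p <- sw x) counit p.2 *: \sum_(q <- sw y) counit q.2 *: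
       g [:: f (p.1 ⊗ q.1)]).
      rewrite (sw_counitr (G := fun x => \sum_(q <- sw y) counit q.2 *: g [:: f (x ⊗ q.1)])).
        rewrite (sw_counitr (G := fun y => g [:: f (x ⊗ y)])) // => c s t.
        by rewrite linearPr linearP multilin_consl.
      move=> c s t; rewrite scaler_sumr -big_split; apply: eq_bigr => q _ /=.
      by rewrite linearPl linearP multilin_consl // scalerDr !scalerA mulrC.
    apply: eq_bigr => p _; rewrite scaler_sumr; apply: eq_bigr => q _.
    by rewrite /epsg counitM scalerA.
  rewrite feval_Fmap_nil // /contract_sum; apply: eq_big_nat => j jl; congr (_ *: _).
  rewrite big_seq [RHS]big_seq; apply: eq_bigr => c /(contract_size jl) sc.
  rewrite IH; last exact: multilin_tail.
    by rewrite muln0 expr0 scale1r addn0.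
  by move: sc; rewrite hl => -[].
rewrite feval_Fmap_cons // exchange_big_nat.
have Pg := epsg_linear gm.
rewrite -[X in block (X + _)]hl (block_unroll cp) ?hl // scaler_sumr; apply: eq_big_nat => i /andP[_ ia].
transitivity (\sum_(p <- wsw h) feval (fun w => \sum_(1 <= j < l.+2) (-1) ^+ (i * l.+1 + j) *:
   \sum_(c <- contract act f j p.2)
       feval (fun w' => g (w ++ c.1 :: w')) (Fmap1 act f l.+1 c.2 (drop i (a1 :: a))))
       (tact act p.1 (take i (a1 :: a)))).
  rewrite (eq_bigr _ (fun j _ => scaler_sumr _ _ _ _)) exchange_big; apply: eq_bigr => p _ /=.
  by rewrite feval_sum; apply: eq_bigr => j _; rewrite fevalZ.
rewrite !scaler_sumr big_seq [RHS]big_seq; apply: eq_bigr => p /wsw_size sp.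
rewrite -!fevalZ; apply: eq_feval => w.
rewrite /contract_sum !scaler_sumr sp hl; apply: eq_big_nat => j; rewrite -hl -sp => jl.
rewrite !scalerA -!exprD !scaler_sumr big_seq [RHS]big_seq.
apply: eq_bigr => c /(contract_size jl) sc.
rewrite IH; last 2 first.
- by move: sc; rewrite sp hl => -[].
- by move=> u v e x y; have := gm (w ++ c.1 :: u) v e x y; rewrite -!catA.
have si : size (drop i (a1 :: a)) = ((size a).+1 - i)%N by rewrite size_drop.
rewrite scalerA -exprD si sp hl.
have -> : (l.+1 + ((size a).+1 - i) = (l.+2 + size (a1 :: a) - i).-1)%N by rewrite /=; lia.
congr (_ *: _); apply: sign_odd_eq.
move: (ia); rewrite ltnS [size (a1 :: a)]/= => /subnKC {2}<-.
move: ((size a).+1 - i)%N => d; rewrite !mulSn !mulnS mulnDr [(i * l)%N]mulnC.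
by move: (l * i)%N (l * d)%N => t t'; lia.
Qed.

(** A nonempty block keeps at least one letter of H through all its steps, so its last letter is
    never taken from a. *)
Lemma eq_block_inl n psi (phi : seq A -> H + A -> U) q a : q != [::] ->
  (forall w x, phi w (inl x) = psi w x) -> block n phi q a = block n (onl psi) q a.
Proof.
elim: n psi phi q a => [|[|n] IH] psi phi q a q0 pp //.
  by case: q q0 => [|x [|y q]] // _; case: a => [|a1 a] /=; rewrite ?pp.
rewrite !block_step; congr (_ + _ *: _).
  case: a => // a1 a; rewrite big_seq [RHS]big_seq; apply: eq_bigr => p /wsw_size sp.
  rewrite (IH (fun u => psi (wact act p.1 a1 :: u))) //.
  by rewrite -size_eq0 sp size_eq0.
rewrite /contract_sum; apply: eq_big_nat => j jl; congr (_ *: _).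
rewrite big_seq [RHS]big_seq; apply: eq_bigr => c /(contract_size jl) sc.
rewrite (IH (fun u => psi (c.1 :: u))) //.
by rewrite -size_eq0; move/andP: jl; rewrite -sc; case: (size _) => [|s] // [j1]; rewrite ltnS leqNgt j1.
Qed.

End FmapBlock.

(** * Colinearity of contractions *)

Section Comultiplication.
Context {k : comNzRingType} {H : hopfAlgType k} {A : algType k}.
Context {act : weak_action H A} {f : {linear tensor H H -> A}} {E : algType k}.
Variable cp : crossed_product act f E.
Context {U : lmodType k}.
Implicit Types (psi : seq A -> H -> U).
Local Notation block := (@block k H A act f U).

Lemma sw_mul (b : H -> H -> U) x y : bilin b ->
  \sum_(z <- sw (x * y)) b z.1 z.2 =
  \sum_(u <- sw x) \sum_(v <- sw y) b (u.1 * v.1) (u.2 * v.2).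
Proof.
move=> bP; rewrite (sum_sw bP) coproductM raddf_sum; apply: eq_bigr => u _.
by rewrite raddf_sum; apply: eq_bigr => v _; exact: tlift_tens.
Qed.

Lemma prod_multilin (g : H -> U) : linear g -> multilin (fun h => g (\prod_(x <- h) x)).
Proof.
move=> gl u v c x y; rewrite !big_cat !big_cons /=.
by rewrite mulrDl mulrDr -scalerAl -scalerAr gl.
Qed.

Definition trilinear (K : A -> seq H -> H -> U) :=
  [/\ forall h z, linear (fun b => K b h z), forall b z, multilin (fun h => K b h z)
    & forall b h, linear (K b h)].

(** Comultiplying before or after the merge gives the same Sweedler components, by coassociativity
    in x and in y and multiplicativity of the coproduct. *)
Lemma contract_comult1 K x y h : trilinear K ->
  \sum_(p <- wsw (x :: y :: h)) \sum_(c <- contract act f 1 p.1)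
     K c.1 c.2 (\prod_(z <- p.2) z) =
  \sum_(c <- contract act f 1 (x :: y :: h)) \sum_(p <- wsw c.2)
     K c.1 p.1 (\prod_(z <- p.2) z).
Proof.
move=> [K1 K2 K3].
have Kb b a z z' : bilin (fun s t => K b (s :: a) (z * (t * z'))).
  split=> [w|w] c s t; first exact: (K2 b _ [::]).
  by rewrite mulrDl mulrDr -scalerAl -scalerAr K3.
rewrite (wsw_cons x (y :: h) (fun p1 p2 => \sum_(c <- contract act f 1 p1)
     K c.1 c.2 (\prod_(z <- p2) z))).
rewrite (wsw_cons y h (fun p1 p2 => \sum_(u <- sw x)
  \sum_(c <- contract act f 1 (u.1 :: p1)) K c.1 c.2 (\prod_(z <- u.2 :: p2) z))).
have C1 (G : A -> seq H -> U) s t v : \sum_(c <- contract act f 1 [:: s, t & v]) G c.1 c.2 =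
    \sum_(u <- sw s) \sum_(w <- sw t) G (f (u.1 ⊗ w.1)) (u.2 * w.2 :: v).
  by rewrite sum_contract big_seq1 /= drop0.
rewrite (C1 (fun b v => \sum_(p <- wsw v) K b p.1 (\prod_(z <- p.2) z))).
transitivity (\sum_(r <- wsw h) \sum_(u <- sw x) \sum_(v <- sw y)
   \sum_(u' <- sw u.2) \sum_(v' <- sw v.2)
     K (f (u.1 ⊗ v.1)) (u'.1 * v'.1 :: r.1) (u'.2 * v'.2 * \prod_(z <- r.2) z)); last first.
  rewrite exchange_big; apply: eq_bigr => u _; rewrite exchange_big; apply: eq_bigr => v _ /=.
  rewrite (wsw_cons (u.2 * v.2) h (fun p q => K (f (u.1 ⊗ v.1)) p (\prod_(z <- q) z))).
  apply: eq_bigr => r _.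
  rewrite (sw_mul (b := fun s t => K (f (u.1 ⊗ v.1)) (s :: r.1) (\prod_(z <- t :: r.2) z))).
    by apply: eq_bigr => u' _; apply: eq_bigr => v' _; rewrite big_cons.
  by split=> [w|w] c s t; [exact: (K2 _ _ [::])|rewrite !big_cons mulrDl -scalerAl K3].
apply: eq_bigr => r _.
pose T u1 v1 u2 v2 u3 v3 : U :=
  K (f (u1 ⊗ v1)) (u2 * v2 :: r.1) (u3 * v3 * \prod_(z <- r.2) z).
transitivity (\sum_(u <- sw x) \sum_(u' <- sw u.1) \sum_(v <- sw y) \sum_(v' <- sw v.1)
    T u'.1 v'.1 u'.2 v'.2 u.2 v.2).
  rewrite exchange_big; apply: eq_bigr => u _ /=.
  rewrite [RHS]exchange_big; apply: eq_bigr => v _ /=.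
  rewrite (C1 (fun b w => K b w (\prod_(z <- [:: u.2, v.2 & r.2]) z))).
  by apply: eq_bigr => u' _; apply: eq_bigr => v' _; rewrite /T !big_cons mulrA.
have T1 v1 u2 v2 u3 v3 : linear (fun u1 => T u1 v1 u2 v2 u3 v3).
  by move=> c s t; rewrite /T linearPl linearP K1.
have T2 u1 u2 v2 u3 v3 : linear (fun v1 => T u1 v1 u2 v2 u3 v3).
  by move=> c s t; rewrite /T linearPr linearP K1.
have T3 u1 v1 v2 u3 v3 : linear (fun u2 => T u1 v1 u2 v2 u3 v3).
  by move=> c s t; rewrite /T mulrDl -scalerAl (K2 _ _ [::]).
have T4 u1 v1 u2 u3 v3 : linear (fun v2 => T u1 v1 u2 v2 u3 v3).
  by move=> c s t; rewrite /T mulrDr -scalerAr (K2 _ _ [::]).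
have T5 u1 v1 u2 v2 v3 : linear (fun u3 => T u1 v1 u2 v2 u3 v3).
  by move=> c s t; rewrite /T !mulrDl -!scalerAl K3.
have T6 u1 v1 u2 v2 u3 : linear (fun v3 => T u1 v1 u2 v2 u3 v3).
  by move=> c s t; rewrite /T mulrDr -scalerAr mulrDl -scalerAl K3.
have lin_sum I (s : seq I) (F : I -> H -> U) : (forall i, linear (F i)) ->
    linear (fun z => \sum_(i <- s) F i z).
  by move=> Fl c z z'; rewrite scaler_sumr -big_split; apply: eq_bigr => i _; exact: Fl.
transitivity (\sum_(u <- sw x) \sum_(u' <- sw u.1) \sum_(v <- sw y) \sum_(v' <- sw v.2)
    T u'.1 v.1 u'.2 v'.1 u.2 v'.2).
  apply: eq_bigr => u _; apply: eq_bigr => u' _; apply: esym.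
  by apply: (sw_coassoc (T := fun a b c => T u'.1 a u'.2 b u.2 c)); split.
rewrite -(sw_coassoc (T := fun a b c => \sum_(v <- sw y) \sum_(v' <- sw v.2)
    T a v.1 b v'.1 c v'.2)).
- by apply: eq_bigr => u _; rewrite exchange_big.
- by split=> w; do 2!apply: (lin_sum) => ?.
- by split=> w; do 2!apply: (lin_sum) => ?.
Qed.

(** Contractions are maps of H-comodules, where H coacts on words by h |-> h^(1) ⊗ (product of the
    letters of h^(2)). *)
Lemma contract_comult K j h : trilinear K -> (0 < j < size h)%N ->
  \sum_(p <- wsw h) \sum_(c <- contract act f j p.1) K c.1 c.2 (\prod_(z <- p.2) z) =
  \sum_(c <- contract act f j h) \sum_(p <- wsw c.2) K c.1 p.1 (\prod_(z <- p.2) z).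
Proof.
elim: h j K => [|x h IH] [|[|j]] K // [K1 K2 K3] jh.
  by case: h {IH} jh => // y h _; exact: contract_comult1.
pose K' b v z : U := \sum_(t <- sw x) \sum_(t' <- sw t.2)
   K (act t.1 b) (t'.1 :: v) (t'.2 * z).
have cons1 (G : A -> seq H -> U) s v : \sum_(c <- contract act f j.+2 (s :: v)) G c.1 c.2 =
    \sum_(c <- contract act f j.+1 v) \sum_(t <- sw s) G (act t.1 c.1) (t.2 :: c.2).
  rewrite -[s :: v]/([:: s] ++ v) -[j.+2]/(size [:: s] + j.+1)%N contract_catr //.
  apply: eq_bigr => c _.
  by rewrite (wsw_cons s [::] (fun a b => G (wact act a c.1) (b ++ c.2))) big_seq1.
have tK' : trilinear K'.
  split=> [v z|b z|b v].
  - move=> c s t; rewrite /K' scaler_sumr -big_split; apply: eq_bigr => i _ /=.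
    by rewrite scaler_sumr -big_split; apply: eq_bigr => i' _; rewrite linearPr K1.
  - move=> u v c s t; rewrite /K' scaler_sumr -big_split; apply: eq_bigr => i _ /=.
    by rewrite scaler_sumr -big_split; apply: eq_bigr => i' _; rewrite -!cat_cons K2.
  - move=> c s t; rewrite /K' scaler_sumr -big_split; apply: eq_bigr => i _ /=.
    by rewrite scaler_sumr -big_split; apply: eq_bigr => i' _; rewrite mulrDr -scalerAr K3.
transitivity (\sum_(p <- wsw h) \sum_(c <- contract act f j.+1 p.1) K' c.1 c.2 (\prod_(z <- p.2) z)).
  rewrite (wsw_cons x h (fun p1 p2 => \sum_(c <- contract act f j.+2 p1)
     K c.1 c.2 (\prod_(z <- p2) z))).
  apply: eq_bigr => p _.
  transitivity (\sum_(t <- sw x) \sum_(c <- contract act f j.+1 p.1) \sum_(t' <- sw t.1)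
      K (act t'.1 c.1) (t'.2 :: c.2) (t.2 * \prod_(z <- p.2) z)).
    apply: eq_bigr => t _.
    rewrite (cons1 (fun b v => K b v (\prod_(z <- t.2 :: p.2) z))).
    by apply: eq_bigr => c _; rewrite big_cons.
  rewrite exchange_big; apply: eq_bigr => c _ /=; apply: esym.
  apply: (sw_coassoc (T := fun a b d => K (act a c.1) (b :: c.2) (d * \prod_(z <- p.2) z))).
    by move=> z; split=> w e s t; [rewrite linearPl K1|exact: (K2 _ _ [::])].
  by move=> z; split=> w e s t; [exact: (K2 _ _ [::])|rewrite mulrDl -scalerAl K3].
rewrite IH //; rewrite (cons1 (fun b v => \sum_(p <- wsw v) K b p.1 (\prod_(z <- p.2) z))).
apply: eq_bigr => c _; rewrite exchange_big; apply: eq_bigr => t _ /=.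
rewrite (wsw_cons t.2 c.2 (fun p q => K (act t.1 c.1) p (\prod_(z <- q) z))).
by apply: eq_bigr => p _; apply: eq_bigr => t' _; rewrite big_cons.
Qed.

(** By iterated colinearity, the last letter of the block and the product of h^(2) arise from one
    comultiplication of the merged letter, which the counit undoes. *)
Lemma block_comult n psi q a : q != [::] ->
  (forall x, multilin (psi ^~ x)) -> (forall w, linear (psi w)) ->
  \sum_(p <- wsw q) block n (onl (epsg (fun w => psi w (\prod_(x <- p.2) x)))) p.1 a =
  block n (onl psi) q a.
Proof.
elim: n psi q a => [|[|n] IH] psi q a q0 pm pl.
- by rewrite big1.
- case: q q0 => [|x [|y q]] // _.
    rewrite (wsw_cons x [::] (fun p1 p2 => block 1 (onl (epsg (fun w => psi w (\prod_(x <- p2) x)))) p1 a)).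
    rewrite big_seq1 /=; case: a => [|a1 a] /=; last by rewrite big1.
    rewrite /epsg -[RHS](sw_counitl (pl [::])); apply: eq_bigr => p _.
    by rewrite big_cons big_nil mulr1.
  rewrite big_seq big1 // => p /wsw_size1.
  by case: (p.1) => [|s [|t v]].
have eP z : psi_linear (onl (epsg (fun w => psi w z))) by exact: epsg_linear.
have eP' b z : psi_linear (onl (epsg (fun w => psi (b :: w) z))).
  by apply: epsg_linear; exact: (multilin_tail b (pm z)).
have lin1 n' h a' z : linear (fun b => block n' (onl (epsg (fun w => psi (b :: w) z))) h a').
  move=> c s t; rewrite -block_lin; apply: eq_block => w [x|b'] _ /=.
    by rewrite /epsg (pm z [::]) scalerDr !scalerA mulrC.
  by rewrite scaler0 addr0.
have lin3 n' h a' b : linear (fun z => block n' (onl (epsg (fun w => psi (b :: w) z))) h a').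
  move=> c s t; rewrite -block_lin; apply: eq_block => w [x|b'] _ /=.
    by rewrite /epsg pl scalerDr !scalerA mulrC.
  by rewrite scaler0 addr0.
rewrite block_step.
rewrite (eq_bigr (fun p => (if a is a1 :: a' then
     \sum_(u <- wsw p.1) block n.+1 (onl (epsg (fun w => psi (wact act u.1 a1 :: w) (\prod_(x <- p.2) x)))) u.2 a'
     else 0) + (-1) ^+ size a *: contract_sum (act := act) (f := f) (fun b h =>
     block n.+1 (onl (epsg (fun w => psi (b :: w) (\prod_(x <- p.2) x)))) h a) p.1)); last first.
  by move=> p _; rewrite block_step; case: a.
rewrite big_split -scaler_sumr; congr (_ + _ *: _).
  case: a => [|a1 a]; first by rewrite big1.
  rewrite -(wsw_coassoc (T := fun x y z =>
    block n.+1 (onl (epsg (fun w => psi (wact act x a1 :: w) (\prod_(x <- z) x)))) y a)).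
  - rewrite big_seq [RHS]big_seq; apply: eq_bigr => p /wsw_size sp.
    rewrite (IH (fun w => psi (wact act p.1 a1 :: w))) //.
    + by rewrite -size_eq0 sp size_eq0.
    + by move=> x; exact: (multilin_tail _ (pm x)).
  - by move=> y z u v c x x'; rewrite wact_multilin lin1.
  - by move=> x z; exact: (block_multilin cp).
  - move=> x y; apply: (prod_multilin (g := fun z =>
      block n.+1 (onl (epsg (fun w => psi (wact act x a1 :: w) z))) y a)); exact: lin3.
rewrite /contract_sum.
rewrite big_seq (eq_bigr (fun p => \sum_(1 <= j < size q) (-1) ^+ j *: \sum_(c <- contract act f j p.1)
    block n.+1 (onl (epsg (fun w => psi (c.1 :: w) (\prod_(x <- p.2) x)))) c.2 a)); last first.
  by move=> p /wsw_size1 ->.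
rewrite -big_seq exchange_big; apply: eq_big_nat => j jq.
rewrite -scaler_sumr; congr (_ *: _).
rewrite (contract_comult (K := fun b h z =>
  block n.+1 (onl (epsg (fun w => psi (b :: w) z))) h a)) //; last first.
  split=> [h z|b z|b h]; [exact: lin1|exact: (block_multilin cp)|exact: lin3].
rewrite big_seq [RHS]big_seq; apply: eq_bigr => c /(contract_size jq) sc.
rewrite (IH (fun w => psi (c.1 :: w))) //.
  by rewrite -size_eq0; move/andP: jq; rewrite -sc; case: (size _) => [|s] // [j1]; rewrite ltnS leqNgt j1.
by move=> x; exact: (multilin_tail _ (pm x)).
Qed.

(* The coefficients F^(l) of the differential are the runs of a single block. *)
Lemma block_Fmap l psi q a : size q = l.+1 ->
  (forall x, multilin (psi ^~ x)) -> (forall w, linear (psi w)) ->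
  \sum_(p <- wsw q) feval (fun w => psi w (\prod_(x <- p.2) x)) (Fmap1 act f l.+1 p.1 a) =
  (-1) ^+ (l * size a) *: block (l.+1 + size a) (onl psi) q a.
Proof.
move=> sq pm pl; rewrite -block_comult // ?scaler_sumr; last by case: q sq.
rewrite big_seq [RHS]big_seq; apply: eq_bigr => p /wsw_size1 sp.
by rewrite (feval_Fmap cp) // sp.
Qed.

End Comultiplication.

(** * The comparison map commutes with the differentials *)

Section ChainMap.
Context {k : comNzRingType} {H : hopfAlgType k} {A : algType k}.
Context {act : weak_action H A} {f : {linear tensor H H -> A}} {E : algType k}.
Variable cp : crossed_product act f E.
Context {M : lmodType k} (bM : bimodule E M).
Local Notation "a # h" := (sharp cp a h) (at level 40).
Local Notation "x *l m" := (lact bM x m) (at level 40).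
Local Notation "m *r x" := (ract bM m x) (at level 40).
Local Notation block := (@block k H A act f M).
Implicit Types (g : seq E -> M).

Definition PhiX g (h : seq H) (a : seq A) : M := Phi cp (size h + size a) g h a.

Lemma Phi_lact n x g h a : Phi cp n (fun u => x *l g u) h a = x *l Phi cp n g h a.
Proof.
elim: n g h a => [|n IH] g h a /=; first by case: ifP; rewrite ?linear0r.
rewrite !linearDr linearZr_LR /= linear_sumr; congr (_ + _ *: _ + _).
- case: a => [|a1 a]; first by rewrite linear0r.
  by rewrite linear_sumr; apply: eq_bigr => p _; rewrite IH.
- by case: h => [|y h]; rewrite ?linear0r.
- apply: eq_bigr => i _; rewrite linearZr_LR linear_sumr; congr (_ *: _).
  by apply: eq_bigr => c _; rewrite IH.
Qed.

Lemma Phi_ract n x g h a : Phi cp n (fun u => g u *r x) h a = Phi cp n g h a *r x.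
Proof.
elim: n g h a => [|n IH] g h a /=; first by case: ifP; rewrite ?linear0l.
rewrite !linearDl linearZl_LR /= linear_sumlz; congr (_ + _ *: _ + _).
- case: a => [|a1 a]; first by rewrite linear0l.
  by rewrite linear_sumlz; apply: eq_bigr => p _; rewrite IH.
- by case: h => [|y h]; rewrite ?linear0l.
- apply: eq_bigr => i _; rewrite linearZl_LR linear_sumlz; congr (_ *: _).
  by apply: eq_bigr => c _; rewrite IH.
Qed.

Lemma tdifE g w : w != [::] -> tdif bM g w =
  mergesum g w + (-1) ^+ size w *: splitlast (fun u x => g u *r x) w.
Proof.
by case/lastP: w => // w x _; rewrite tdif_rcons splitlast_rcons size_rcons.
Qed.

Lemma feval_ract (G : seq A -> M) x t : feval (fun w => G w *r x) t = feval G t *r x.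
Proof.
by rewrite /feval linear_sumlz; apply: eq_bigr => y _; rewrite linearZl_LR.
Qed.

(** At the cut m = size h the block is empty: the last letter is that of a, which is the
    right-acting term of d_0. *)
Lemma cut_last n g h a : n.+1 = (size h + size a)%N ->
  (-1) ^+ n.+1 *: Phicut cp n.+1 (size h) (fun u x => g u *r x) h a =
  (if a is _ :: _ then
     (-1) ^+ size a *: (PhiX g h (take (size a).-1 a) *r (a`_(size a).-1 # 1)) else 0).
Proof.
move=> nE; rewrite -[X in Phicut _ _ _ _ X]cats0 Phicut_cat // /= mul1n add0n.
case/lastP: a nE => [|a x] nE; first by rewrite block_nil_nil !scaler0.
rewrite size_rcons block_nil_rcons // Phi_ract -/(PhiX g h a) scalerA -exprD.
rewrite -[in RHS]cats1 take_size_cat // nth_cat ltnn subnn.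
case aE : (a ++ [:: x]) => [|b v]; first by case: (a) aE.
by congr (_ *: _); apply: sign_odd_eq; rewrite nE size_rcons; lia.
Qed.

Lemma PhiX_multilinr g h : multilin g -> multilin (PhiX g h).
Proof.
move=> gm u v c x y; rewrite /PhiX !size_cat /=; exact: Phi_multilinr.
Qed.

(** The cut that leaves a final block of l letters yields d_l; for l = 1 it yields the right-acting
    term of d_1. *)
Lemma cut_block n g (h : seq H) (a : seq A) l : n.+1 = (size h + size a)%N -> (0 < l <= size h)%N ->
  multilin g ->
  (-1) ^+ n.+1 *: Phicut cp n.+1 (size h - l)%N (fun u x => g u *r x) h a =
  (-1) ^+ (l * (size a + size h)) *: \sum_(p <- wsw (drop (size h - l)%N h))
     (feval (PhiX g (take (size h - l)%N h)) (Fmap1 act f l p.1 a) *r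
        (1 # \prod_(x <- p.2) x)).
Proof.
move=> nE /andP[l0 lh] gm; case: l l0 lh => // l _ lh.
set m := (size h - l.+1)%N.
have sp : size (take m h) = m by rewrite size_take; case: ifP => //; lia.
have sq : size (drop m h) = l.+1 by rewrite size_drop; lia.
rewrite -[X in Phicut _ _ _ _ X](cat_take_drop m) -[X in Phicut _ _ X]sp.
rewrite Phicut_cat; last by rewrite sp sq nE; lia.
rewrite sp sq.
pose psi w x := PhiX g (take m h) w *r (1 # x).
rewrite (eq_block_inl _ _ (psi := psi)); first last.
- by move=> w x; rewrite Phi_ract /psi /PhiX sp.
- by rewrite -size_eq0 sq.
have psm x : multilin (psi ^~ x).
  by move=> u v c y z; rewrite /psi (PhiX_multilinr _ gm) linearPl.
have psl w : linear (psi w).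
  by move=> c y z; rewrite /psi sharp_linearr linearPr.
have := block_Fmap cp a sq psm psl.
move=> /(congr1 ( *:%R ((-1) ^+ (l * size a)))); rewrite scalerA -expr2 sqrr_sign scale1r => <-.
rewrite !scalerA -!exprD !scaler_sumr; apply: eq_bigr => p _.
rewrite /psi feval_ract; congr (_ *: _); apply: sign_odd_eq.
rewrite nE (_ : size h = m + l.+1)%N; last by rewrite /m; lia.
move: (size a) => r; rewrite !(mulSn, mulnDr, mulnS).
have : odd (l * l) = odd l by rewrite oddM andbb.
by move: (l * l)%N (l * r)%N (l * m)%N => t t1 t2; lia.
Qed.

(** The action of the first letter, seen at the first step of Phi, gives the left-acting terms of
    d_0 and d_1; the merges give the inner terms of d_0; the action of the last letter, cut by cut,
    gives all right-acting terms. *)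
Lemma PhiX_hochd g : multilin g -> PhiX (hochd bM g) = xdif cp bM (PhiX g).
Proof.
move=> gm; apply/funext => h; apply/funext => a.
rewrite {1}/PhiX; case nE: (size h + size a)%N => [|n].
  case: h a nE => [|x h] [|a1 a] // _.
  by rewrite /xdif /xdif_fun /= big_geq // !addr0.
have nE' := esym nE.
rewrite (eq_Phi cp (g' := fun w => (if w is e :: u then e *l g u else 0) +
  (mergesum g w + (-1) ^+ n.+1 *: splitlast (fun u x => g u *r x) w))); last first.
  by case=> // e u su; rewrite hochd_cons tdifE // su.
rewrite !PhiD PhiZ Phi_splitlast // Phi_mergesum //.
have -> : mergesum (Phi cp n g h) a = \sum_(1 <= i < size a)
    (-1) ^+ i *: PhiX g h (take i.-1 a ++ a`_i.-1 * a`_i :: drop i.+1 a).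
  rewrite -mergesumE; apply: eq_mergesum => b sb; rewrite /PhiX.
  by congr (Phi _ _ _ _ _); lia.
rewrite big_nat_recr // [X in _ + (_ + X)]scalerDr cut_last //.
have -> : (-1) ^+ n.+1 *: \sum_(0 <= m < size h) Phicut cp n.+1 m (fun u x => g u *r x) h a =
  \sum_(1 <= l < (size h).+1) (-1) ^+ (l * (size a + size h)) *: \sum_(p <- wsw (drop (size h - l)%N h))
     (feval (PhiX g (take (size h - l)%N h)) (Fmap1 act f l p.1 a) *r
        (1 # \prod_(x <- p.2) x)).
  rewrite big_nat_rev /= [in RHS]big_add1 /= scaler_sumr; apply: eq_big_nat => i /andP[_ ih].
  by rewrite add0n cut_block.
have lactE : Phi cp n.+1 (fun w => if w is e :: u then e *l g u else 0) h a =
  (if a is a1 :: a' then \sum_(p <- wsw h) (wact act p.1 a1 # 1) *l PhiX g p.2 a' else 0) +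
  (-1) ^+ size a *: (if h is x :: h' then (1 # x) *l PhiX g h' a else 0) +
  \sum_(1 <= i < size h) (-1) ^+ (size a + i) *: \sum_(c <- contract act f i h)
    ((c.1 # 1) *l PhiX g c.2 a).
  rewrite [LHS]/=; congr (_ + _ *: _ + _).
  - case: (a) nE => // a1 a' nE1; rewrite big_seq [RHS]big_seq; apply: eq_bigr => p /wsw_size sp.
    by rewrite Phi_lact /PhiX sp; congr (_ *l Phi _ _ _ _ _); move: nE1 => /=; lia.
  - by case: (h) nE => // x h' [nE1]; rewrite Phi_lact /PhiX nE1.
  - apply: eq_big_nat => i ih; congr (_ *: _); rewrite big_seq [RHS]big_seq.
    apply: eq_bigr => c /(contract_size ih) sc.
    have sn : (size c.2 + size a)%N = n by lia.
    by rewrite Phi_lact /PhiX sn.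
rewrite lactE /xdif /xdif_fun.
set T := (if a is a1 :: a' then _ else 0); set Em := (-1) ^+ size a *: _.
set D := \sum_(1 <= i < size a) _; set C := \sum_(1 <= i < size h) _.
set LA := (if a is _ :: _ then _ else 0).
pose B l := (-1) ^+ (l * (size a + size h)) *: \sum_(p <- wsw (drop (size h - l)%N h))
     (feval (PhiX g (take (size h - l)%N h)) (Fmap1 act f l p.1 a) *r
        (1 # \prod_(x <- p.2) x)).
rewrite -/(B _).
have -> : xd0 cp bM (PhiX g) h a = T + LA + D.
  rewrite /xd0 /T /LA /D; case: (a) => //.
  by rewrite big_geq // !addr0.
have -> : \sum_(2 <= l < (size h).+1) xdl cp bM (PhiX g) h a l = \sum_(2 <= l < (size h).+1) B l.
  by apply: eq_big_nat => l /andP[l2 _]; rewrite /xdl /B /Fmap1 gtn_eqF // addnC.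
have -> : xd1 cp bM (PhiX g) h a = Em + (if h is _ :: _ then B 1%N else 0) + C.
  rewrite /xd1 /Em /C /B; case: (h) => [|x h'].
    by rewrite scaler0 big_geq // !addr0.
  congr (_ + _ *: _ + _); first by rewrite mul1n addnC.
  rewrite subn1 [_.-1]/=.
  have -> : drop (size h') (x :: h') = [:: (x :: h')`_(size h')].
    by rewrite (drop_nth 0) ?drop_oversize /=.
  rewrite (wsw_cons _ [::] (fun u v => feval (PhiX g (take (size h') (x :: h')))
     (Fmap1 act f 1 u a) *r (1 # \prod_(z <- v) z))) big_seq1.
  by apply: eq_bigr => p _; rewrite big_cons big_nil mulr1.
have -> : \sum_(1 <= l < (size h).+1) B l =
    (if h is _ :: _ then B 1%N else 0) + \sum_(2 <= l < (size h).+1) B l.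
  by case: (h) => [|x h']; [rewrite !big_geq ?addr0|rewrite big_ltn].
by rewrite !addrA [LHS](ACl (1*7*4*2*5*3*6)).
Qed.

End ChainMap.

(** * Filtrations and surjectivity *)

Section Filtrations.
Context {k : comNzRingType} {H : hopfAlgType k} {A : algType k}.
Context {act : weak_action H A} {f : {linear tensor H H -> A}} {E : algType k}.
Variable cp : crossed_product act f E.
Context {M : lmodType k} (bM : bimodule E M).
Local Notation "a # h" := (sharp cp a h) (at level 40).
Local Notation ones h := (map (sharp cp 1) h).
Local Notation out := (outside (in_A cp)).
Local Notation HSC := (hochschild_serre cp bM).
Local Notation XH := (xhat cp bM).
Implicit Types (g : seq E -> M).

(** In length n, at least n - i + 1 letters in A means fewer than i outside A; this count is the one
    that faces do not increase. *)
Lemma hs_filP i n g : reflect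
  (homP n g /\ forall w, size w = n -> (out w < i)%N -> g w = 0) (g \in hs_fil cp i n).
Proof.
have E1 w : size w = n -> (n + 1 <= count (in_A cp) w + i)%N = (out w < i)%N.
  by move=> <-; have := count_predC (in_A cp) w; rewrite /outside; lia.
apply: (iffP andP) => [[/asboolP gh /asboolP g0]|[gh g0]].
  by split=> // w sw; rewrite -E1 //; exact: g0.
by split; [exact/asboolP|apply/asboolP => w sw; rewrite E1 //; exact: g0].
Qed.

Lemma hs_is_filtered_complex : is_filtered_complex HSC.
Proof.
split.
- by move=> n x; exact: hochd_homset.
- by move=> n x _; apply/funext => w; exact: hochd_hochd.
- move=> n g; apply/hs_filP/asboolP => [[]|] //; by split.
- by move=> i n g /hs_filP[gh g0]; apply/hs_filP; split=> // w sw wi; apply: g0 => //; exact: leqW.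
- move=> i n g /hs_filP[gh g0]; apply/hs_filP; split.
    by have /asboolP := hochd_homset bM (introT (asboolP _) gh).
  move=> w sw wi; apply: (hochd_outside bM _ g0 sw wi); exact: in_AM.
Qed.

Lemma hs_fil_big p n g : (n < p)%N -> g \in hs_fil cp p n -> g = 0.
Proof.
move=> np /hs_filP[[_ _ gs] g0]; apply/funext => w.
have [sw|/eqP sw] := eqVneq (size w) n; last by rewrite gs //; apply/eqP.
by apply: g0 => //; apply: leq_ltn_trans np; rewrite -sw /outside count_size.
Qed.

Lemma PhiX_linear : linear (PhiX cp (M := M)).
Proof.
move=> c g g'; apply/funext => h; apply/funext => a.
by rewrite /PhiX -[RHS](Phi_lin cp).
Qed.
HB.instance Definition _ := GRing.isLinear.Build k (seq E -> M) (seq H -> seq A -> M) _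
  (PhiX cp (M := M)) PhiX_linear.

Lemma PhiX_multilinl g a : multilin g -> multilin (fun h => PhiX cp g h a).
Proof. by move=> gm u v c x y; rewrite /PhiX !size_cat /=; exact: Phi_multilinl. Qed.

Lemma PhiX_fil p n g : g \in hs_fil cp p n -> PhiX cp g \in xfil (H := H) (A := A) p n.
Proof.
move=> /hs_filP[[gm g1 gs] g0]; apply/asboolP; split=> [a|h|h a].
- split; first exact: PhiX_multilinl.
  by move=> u v; exact: Phi_normalizedl.
- split; first exact: PhiX_multilinr.
  by move=> u v; exact: Phi_normalizedr.
rewrite negb_and -ltnNge => /orP[hp|ne].
  have [sn|ne] := eqVneq (size h + size a)%N n.
    apply: Phi_supp => // w sw _ ow; apply: g0; first by rewrite sw.
    exact: leq_ltn_trans ow hp.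
  rewrite /PhiX (eq_Phi cp (g' := fun=> 0)) ?Phi0 // => w sw; apply: gs.
  by rewrite sw.
rewrite /PhiX (eq_Phi cp (g' := fun=> 0)) ?Phi0 // => w sw; apply: gs.
by rewrite sw.
Qed.

Lemma xfilS i n : {subset xfil (H := H) (A := A) (M := M) i.+1 n <= xfil i n}.
Proof.
move=> y /asboolP[yh ya ys]; apply/asboolP; split=> // h a hn; apply: ys.
by apply: contra hn => /andP[/ltnW-> ->].
Qed.

End Filtrations.

(** * Lifting the leading component of a cochain of Xhat *)

Section Lift.
Context {k : comNzRingType} {H : hopfAlgType k} {A : algType k}.
Context {act : weak_action H A} {f : {linear tensor H H -> A}} {E : algType k}.
Variable cp : crossed_product act f E.
Context {M : lmodType k} (bM : bimodule E M).
Local Notation "a # h" := (sharp cp a h) (at level 40).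
Local Notation ones h := (map (sharp cp 1) h).
Local Notation out := (outside (in_A cp)).

Lemma NF_iota (U : lmodType k) (K : E -> seq H -> U) e u b v : letter_linear K ->
  (forall e, normalized (K e)) -> NF cp K (e :: u ++ (b # 1) :: v) = 0.
Proof.
elim: u K e => [|x u IH] K e Kl K1.
  rewrite cat0s NF_cons /= big1 // => p _.
  by rewrite -iotaM NFtail_sharp // normalized_head.
rewrite cat_cons NF_cons IH //; first exact: NFtail_linear.
by move=> y u' v'; rewrite /NFtail big1 // => q _; rewrite -cat_cons K1.
Qed.

Variables (p n : nat) (y : seq H -> seq A -> M).
Hypothesis (pn : (p <= n)%N) (yP : xP p n y).

Let K (b : seq E) (e : E) (h : seq H) : M := lact bM e (y h (map (epsA cp) b)).

Let K_linear b : letter_linear (K b).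
Proof.
have [yh _ _] := yP; split=> [h c e e'|e u v c z z'].
  by rewrite /K linearPl.
by rewrite /K (yh _).1 linearPr.
Qed.

Let K_normalized b e : normalized (K b e).
Proof. by have [yh _ _] := yP; move=> u v; rewrite /K (yh _).2 linear0r. Qed.

(** The first p letters are put in normal form, the others projected to A by [epsA]. The result
    vanishes as soon as one of the first p letters is in A, so Phi sees it only through the run of
    [Phi_lead], whose sign is compensated here. *)
Definition lift (w : seq E) : M :=
  if size w == n then (-1) ^+ ((n - p) * p) *: NF cp (K (drop p w)) (1 :: take p w) else 0.

Let drop_lin u v c z z' : (p <= size u)%N ->
  NF cp (K (drop p (u ++ c *: z + z' :: v))) (1 :: take p u) =
  c *: NF cp (K (drop p (u ++ z :: v))) (1 :: take p u) +
  NF cp (K (drop p (u ++ z' :: v))) (1 :: take p u).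
Proof.
move=> pu; have [_ ya _] := yP; rewrite -NF_lin; apply: eq_NF => e h _.
have D x : drop p (u ++ x :: v) = drop p u ++ x :: v.
  rewrite drop_cat; case: ltnP => // up.
  have -> : p = size u by apply/eqP; rewrite eqn_leq pu.
  by rewrite subnn drop_size.
by rewrite /K !D !map_cat /= epsA_linear (ya h).1 linearPr.
Qed.

Lemma lift_homP : homP n lift.
Proof.
split.
- move=> u v c z z'; rewrite /lift !size_cat ![size (_ :: v)]/=; case: eqP => _; last by rewrite scaler0 addr0.
  rewrite scalerA [c * _]mulrC -scalerA -scalerDr; congr (_ *: _).
  have [pu|up] := leqP p (size u).
    by rewrite !takel_cat // drop_lin.
  have Tk x : take p (u ++ x :: v) = u ++ x :: take (p - size u).-1 v.
    rewrite take_cat ltnNge (ltnW up) /=; congr (_ ++ _).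
    by case: (p - size u)%N (subn_gt0 (size u) p) => [|q]; rewrite up.
  have Dr x : drop p (u ++ x :: v) = drop (p - size u).-1 v.
    rewrite drop_cat ltnNge (ltnW up) /=.
    by case: (p - size u)%N (subn_gt0 (size u) p) => [|q]; rewrite up.
  by rewrite !Tk !Dr; exact: (NF_multilin cp (K_linear _) (1 :: u)).
- move=> u v; rewrite /lift size_cat [size (_ :: v)]/=; case: eqP => // _.
  have [pu|up] := leqP p (size u).
    have [_ ya _] := yP.
    rewrite takel_cat // (eq_NF cp (K' := fun _ _ => 0)) => [|e h _].
      by rewrite /= big1 ?scaler0.
    have -> : drop p (u ++ 1 :: v) = drop p u ++ 1 :: v.
      rewrite drop_cat; case: ltnP => // up.
      have -> : p = size u by apply/eqP; rewrite eqn_leq pu.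
      by rewrite subnn drop_size.
    by rewrite /K map_cat /= -(sharp11 cp) epsA_iota (ya h).2 linear0r.
  have -> : take p (u ++ 1 :: v) = u ++ 1 :: take (p - size u).-1 v.
    rewrite take_cat ltnNge (ltnW up) /=; congr (_ ++ _).
    by case: (p - size u)%N (subn_gt0 (size u) p) => [|q]; rewrite up.
  by rewrite NF_normalized ?scaler0.
- by move=> w /negPf sw; rewrite /lift sw.
Qed.

Lemma lift_in_A w : has (in_A cp) (take p w) -> lift w = 0.
Proof.
rewrite /lift; case: eqP => // _ /split_find[x u v /asboolP[b ->] _].
by rewrite -cats1 -catA cat1s NF_iota ?scaler0.
Qed.

(** Fewer than p letters outside A force one of the first p letters into A. *)
Lemma lift_fil : lift \in hs_fil cp p n.
Proof.
apply/hs_filP; split=> [|w sw ow]; first exact: lift_homP.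
apply: lift_in_A; apply: contraLR ow; rewrite -leqNgt has_count -leqNgt leqn0 => /eqP c0.
have := count_predC (in_A cp) (take p w); rewrite c0 add0n size_takel ?sw // => <-.
by rewrite /outside -[in X in (_ <= X)%N](cat_take_drop p w) count_cat leq_addr.
Qed.

Lemma PhiX_lift h a : size h = p -> (size h + size a)%N = n -> PhiX cp lift h a = y h a.
Proof.
move=> sh sn; rewrite /PhiX Phi_lead //; last first.
  by move=> w _ _; rewrite sh; exact: lift_in_A.
rewrite /lift size_cat !size_map sn eqxx scalerA -exprD.
have -> : (n - p = size a)%N by rewrite -sn sh addKn.
rewrite -sh -signr_odd oddD addbb expr0 scale1r take_size_cat ?size_map //.
rewrite drop_size_cat ?size_map // NF_ones // /K lact1 -map_comp.
by congr (y _ _); rewrite -[RHS]map_id; apply: eq_map => b; exact: epsA_iota.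
Qed.

End Lift.

Section Surjectivity.
Context {k : comNzRingType} {H : hopfAlgType k} {A : algType k}.
Context {act : weak_action H A} {f : {linear tensor H H -> A}} {E : algType k}.
Variable cp : crossed_product act f E.
Context {M : lmodType k} (bM : bimodule E M).

(** Descending induction on p, with [m] bounding n + 1 - p: [lift] realizes the component size h =
    p, and the rest lies in F_(p+1), which is zero once the index exceeds n. *)
Lemma PhiX_surj p n y : y \in xfil (H := H) (A := A) (M := M) p n ->
  exists2 g, g \in hs_fil cp p n & PhiX cp g = y.
Proof.
move: (leqnn (n.+1 - p)); move: {2}(n.+1 - p)%N => m; elim: m p y => [|m IH] p y pm yF.
  exists 0; first exact: rpred0.
  apply/funext => h; apply/funext => a; rewrite linear0.
  by have /asboolP[_ _ ->] := yF => //; apply/negP => /andP[ph /eqP hn]; lia.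
have [np|pn] := ltnP n p; first by apply: IH => //; lia.
have yP : xP p n y by exact/asboolP.
have [g gF gE] : exists2 g, g \in hs_fil cp p.+1 n & PhiX cp g = y - PhiX cp (lift cp bM p n y).
  apply: IH; first by lia.
  have /asboolP[dh da ds] : y - PhiX cp (lift cp bM p n y) \in xfil p n.
    by apply: submodB => //; apply: PhiX_fil; exact: lift_fil.
  apply/asboolP; split=> // h a hn.
  have [/andP[ph /eqP sn]|ns] := boolP ((p <= size h) && (size h + size a == n))%N; last exact: ds.
  have sh : size h = p.
    by apply/eqP; rewrite eqn_leq ph andbT leqNgt; apply: contra hn => ->; rewrite sn eqxx.
  rewrite -[LHS]/(y h a - PhiX cp (lift cp bM p n y) h a).
  by rewrite (PhiX_lift cp bM yP sh sn) subrr.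
exists (lift cp bM p n y + g).
  by rewrite rpredD ?lift_fil //; move/(filS (hs_is_filtered_complex cp bM)): gF.
by rewrite raddfD /= gE addrC subrK.
Qed.

End Surjectivity.

(** * Acyclicity of the kernel *)

Section Split.
Context {k : comNzRingType} {H : hopfAlgType k} {A : algType k}.
Context {act : weak_action H A} {f : {linear tensor H H -> A}} {E : algType k}.
Variable cp : crossed_product act f E.
Context {M : lmodType k} (bM : bimodule E M).
Local Notation "a # h" := (sharp cp a h) (at level 40).
Local Notation ones h := (map (sharp cp 1) h).
Local Notation out := (outside (in_A cp)).
Implicit Types (x : seq E -> M) (G : E -> E -> M).

Definition splitsum G (t : E) : M := \sum_(q <- dec cp t) G (q.1 # 1) (1 # q.2).

Definition bilinear2 G := (forall y, linear (G ^~ y)) /\ (forall z, linear (G z)).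

Section SplitSum.
Variables (G : E -> E -> M) (Gb : bilinear2 G).

Lemma splitsum_bilin : bilin (fun a h => G (a # 1) (1 # h)).
Proof.
by split=> [h|a] c s t; [rewrite sharp_linearl Gb.1|rewrite sharp_linearr Gb.2].
Qed.

Lemma splitsum_linear : linear (splitsum G).
Proof. exact: sum_dec_linear splitsum_bilin. Qed.

Lemma splitsum_sharp a h : splitsum G (a # h) = G (a # 1) (1 # h).
Proof. exact: (sum_dec_sharp cp splitsum_bilin). Qed.

Lemma splitsum_iota a : splitsum G (a # 1) = G (a # 1) 1.
Proof. by rewrite splitsum_sharp sharp11. Qed.

Lemma splitsum_eq0 t : (in_A cp t -> G t 1 = 0) ->
  (~~ in_A cp t -> forall a h, G (a # 1) (1 # h) = 0) -> splitsum G t = 0.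
Proof.
have [/asboolP[a ->] G1 _|_ _ G0] := boolP (in_A cp t).
  by rewrite splitsum_iota G1 // in_A_iota.
by rewrite /splitsum big1 // => q _; exact: G0.
Qed.
End SplitSum.

Lemma splitsum_mul G d t : bilinear2 G ->
  splitsum G ((d # 1) * t) = splitsum (fun y z => G ((d # 1) * y) z) t.
Proof.
move=> Gb; have Gb' : bilinear2 (fun y z => G ((d # 1) * y) z).
  by split=> [z|y] c s s'; [rewrite mulrDr -scalerAr Gb.1|rewrite Gb.2].
apply: (linear_eq_sharp (cp := cp) (g := fun t => splitsum G ((d # 1) * t))).
- by move=> c s s'; rewrite mulrDr -scalerAr (splitsum_linear Gb).
- exact: splitsum_linear Gb'.
by move=> a h; rewrite iota_sharp !splitsum_sharp // iotaM.
Qed.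

Lemma splitsum_prod (G : E -> M) t : linear G -> splitsum (fun y z => G (y * z)) t = G t.
Proof.
move=> Gl; rewrite [in RHS](decE cp t) linear_bigsum //; apply: eq_bigr => q _.
by rewrite -sharpE.
Qed.

Lemma splitsumD G G' t : splitsum (fun y z => G y z + G' y z) t = splitsum G t + splitsum G' t.
Proof. exact: big_split. Qed.

Lemma splitsumN G t : splitsum (fun y z => - G y z) t = - splitsum G t.
Proof. exact: sumrN. Qed.

Lemma splitsumZ c G t : splitsum (fun y z => c *: G y z) t = c *: splitsum G t.
Proof. by rewrite /splitsum scaler_sumr. Qed.

(** The part of the Hochschild differential at w1 ++ rest made of the faces that leave [rest]
    intact. *)
Definition facesl x (w1 rest : seq E) : M :=
  (if w1 is e :: w then lact bM e (x (w ++ rest)) else 0) +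
  mergesum (fun w => x (w ++ rest)) w1.

Lemma tdif_cat x u z rest : tdif bM x (u ++ z :: rest) =
  mergesum (fun w => x (w ++ rest)) (rcons u z) +
  (-1) ^+ size u *: tdif bM (fun w => x (u ++ w)) (z :: rest).
Proof.
elim: u x => [|e u IH] x; first by rewrite expr0 scale1r add0r.
have := IH (fun w => x (e :: w)); case: u {IH} => [|e' u] IH.
  by rewrite [_ ++ _]/= tdif_cons [rcons _ _]/= mergesum_cons [mergesum _ [:: z]]/= subr0 expr1 scaleN1r.
rewrite !cat_cons tdif_cons -!cat_cons IH !rcons_cons mergesum_cons opprD addrA.
by rewrite -[size (e :: _)]/(size (e' :: u)).+1 [in RHS]exprS mulN1r scaleNr cat_cons -cat_rcons.
Qed.

Lemma hochd_cat x u z rest : hochd bM x (u ++ z :: rest) =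
  facesl x (rcons u z) rest +
  (-1) ^+ size u *: tdif bM (fun w => x (u ++ w)) (z :: rest).
Proof.
case: u => [|e u]; first by rewrite hochd_cons /facesl /= expr0 scale1r addr0.
rewrite cat_cons hochd_cons -cat_cons tdif_cat addrA /facesl rcons_cons cat_rcons.
by [].
Qed.

(* The homotopy that inserts a letter by splitting a # h into a (x) (1 # h). *)
Definition splitting m x (w : seq E) : M :=
  if drop m w is t :: v then splitsum (fun y z => x (take m w ++ y :: z :: v)) t else 0.

Lemma splitting_cat x u t v :
  splitting (size u) x (u ++ t :: v) = splitsum (fun y z => x (u ++ y :: z :: v)) t.
Proof. by rewrite /splitting drop_size_cat // take_size_cat. Qed.

Lemma insert_bilinear x u v : multilin x -> bilinear2 (fun y z => x (u ++ y :: z :: v)).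
Proof.
move=> xm; split=> [z|y] c s t; first exact: xm.
by have := xm (rcons u y) v c s t; rewrite !cat_rcons.
Qed.

(** Faces to the left of the split letter are the same in d (splitting x) and in the splitting of d
    x, so the cocycle condition trades them for faces further right. Among these, remerging the two
    halves of t gives x back. *)
Lemma splitting_formula x u z t v : multilin x ->
  splitsum (fun al be => hochd bM x (u ++ z :: al :: be :: v)) t = 0 ->
  x (u ++ z :: t :: v) + (-1) ^+ size u *: hochd bM (splitting (size u) x) (u ++ z :: t :: v) =
  splitsum (fun al be => x (u ++ z * al :: be :: v)) t
  - splitsum (fun al be => tdif bM (fun w => x (u ++ z :: al :: w)) (be :: v)) t
  - splitsum (fun al be => x (u ++ al :: be :: v)) (z * t)
  - tdif bM (fun w => splitsum (fun al be => x (u ++ al :: be :: w)) z) (t :: v).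
Proof.
move=> xm cyc.
have FL : facesl (splitting (size u) x) (rcons u z) (t :: v) =
    splitsum (fun al be => facesl x (rcons u z) (al :: be :: v)) t.
  rewrite /facesl splitsumD; congr (_ + _).
    case: u {cyc} => [|e u] /=.
      by rewrite (splitting_cat x [::]) /splitsum linear_sumr.
    have -> : splitting (size u).+1 x (rcons u z ++ t :: v) =
      splitsum (fun y z' => x (rcons u z ++ y :: z' :: v)) t.
      by rewrite -splitting_cat size_rcons.
    by rewrite /splitsum linear_sumr.
  rewrite (eq_mergesum (g' := fun w => splitsum (fun al be => x (w ++ al :: be :: v)) t)).
    by rewrite /splitsum mergesum_sum.
  by move=> w; rewrite size_rcons => -[sw]; rewrite -splitting_cat sw.
have cyc' : splitsum (fun al be => facesl x (rcons u z) (al :: be :: v)) t =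
   - ((-1) ^+ size u *: splitsum (fun al be => tdif bM (fun w => x (u ++ w)) (z :: al :: be :: v)) t).
  apply/eqP; rewrite -addr_eq0 -splitsumZ -splitsumD; apply/eqP; rewrite -[RHS]cyc.
  by apply: eq_bigr => q _; rewrite hochd_cat.
rewrite hochd_cat FL cyc' -scalerN -scalerDr scalerA -expr2 sqrr_sign scale1r.
have -> : splitsum (fun al be => tdif bM (fun w => x (u ++ w)) (z :: al :: be :: v)) t =
   - splitsum (fun al be => x (u ++ z * al :: be :: v)) t + x (u ++ z :: t :: v) +
   splitsum (fun al be => tdif bM (fun w => x (u ++ z :: al :: w)) (be :: v)) t.
  rewrite -(splitsum_prod (G := fun s => x (u ++ z :: s :: v)) t); last first.
    by move=> c s s'; have := xm (rcons u z) v c s s'; rewrite !cat_rcons.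
  rewrite -splitsumN -!splitsumD; apply: eq_bigr => q _.
  by rewrite !tdif_cons opprD !opprK addrA.
rewrite tdif_cons splitting_cat.
rewrite (eq_tdif bM (g := fun w => splitting (size u) x (u ++ z :: w))
  (g' := fun w => splitsum (fun al be => x (u ++ al :: be :: w)) z)); last first.
  by move=> w _; rewrite splitting_cat.
by rewrite !opprD !opprK !addrA [X in X + _ + _ + _ = _]addrAC subrr add0r.
Qed.

End Split.

(** * Removing the values on unsorted words *)

Section Kernel.
Context {k : comNzRingType} {H : hopfAlgType k} {A : algType k}.
Context {act : weak_action H A} {f : {linear tensor H H -> A}} {E : algType k}.
Variable cp : crossed_product act f E.
Context {M : lmodType k} (bM : bimodule E M).
Local Notation "a # h" := (sharp cp a h) (at level 40).
Local Notation ones h := (map (sharp cp 1) h).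
Local Notation out := (outside (in_A cp)).
Local Notation toE b := (sharp cp b 1%R).
Implicit Types (x : seq E -> M).

Lemma out_cat u v : out (u ++ v) = (out u + out v)%N.
Proof. exact: count_cat. Qed.

Lemma PhiX_scale c x : PhiX cp (c *: x) = c *: PhiX cp x.
Proof. by apply/funext => h; apply/funext => a; exact: (PhiZ cp). Qed.

Lemma hochd_scale c x : hochd bM (c *: x) = c *: hochd bM x.
Proof. exact: linearZ. Qed.

Lemma outC z w : out (z :: w) = (~~ in_A cp z + out w)%N.
Proof. by []. Qed.

Section Process.
Variables (p n : nat).

Definition gr_cocycle x := (x \in hs_fil cp p n.+1) /\ (hochd bM x \in hs_fil cp p.+1 n.+2).

(* Vanishing of x, modulo F_(p+1), on the words with a letter of A among the first j;
   respectively, on the words whose letters j+1, ..., j+m lie in A. *)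
Definition vanish_before j x := forall w, size w = n.+1 -> (out w <= p)%N ->
  has (in_A cp) (take j w) -> x w = 0.
Definition vanish_run j m x := forall w, size w = n.+1 -> (out w <= p)%N ->
  all (in_A cp) (take m (drop j w)) -> x w = 0.

Definition kernel_reach x x' := exists t,
  [/\ t \in hs_fil cp p n, PhiX cp t = 0 & x' = x - hochd bM t].

Lemma kernel_reach_refl x : kernel_reach x x.
Proof.
exists 0; rewrite rpred0; split=> //; first exact: linear0.
by rewrite linear0 subr0.
Qed.

Lemma kernel_reach_trans x y z : kernel_reach x y -> kernel_reach y z -> kernel_reach x z.
Proof.
move=> [t [tF t0 ->]] [s [sF s0 ->]]; exists (t + s); rewrite rpredD //; split=> //.
  by rewrite raddfD /= t0 s0 addr0.
by rewrite raddfD opprD addrA.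
Qed.

Lemma gr_cocycle_reach x x' : gr_cocycle x -> kernel_reach x x' -> gr_cocycle x'.
Proof.
have cE := hs_is_filtered_complex cp bM.
move=> [xF dxF] [t [tF _ ->]]; split.
  by apply: submodB => //; exact: (cdif_fil cE (i := p) (n := n)).
rewrite raddfB /=; have -> : hochd bM (hochd bM t) = 0 by apply/funext => w; exact: hochd_hochd.
by rewrite subr0.
Qed.

(** A letter outside A splits into a letter of A and at most one letter outside A, while splitting a
    letter of A inserts a 1, which gives 0. *)
Lemma splitting_fil m x : x \in hs_fil cp p n.+1 -> (m < n)%N ->
  splitting cp m x \in hs_fil cp p n.
Proof.
move=> /hs_filP[[xm x1 xs] x0] mn; apply/hs_filP; split; first split.
- move=> u v c y z; rewrite /splitting.
  have [um|mu|um] := ltngtP (size u) m.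
  + have Tk s : take m (u ++ s :: v) = u ++ s :: take (m - size u).-1 v.
      rewrite take_cat ltnNge (ltnW um) /=; congr (_ ++ _).
      by case: (m - size u)%N (subn_gt0 (size u) m) => [|q]; rewrite um.
    have Dr s : drop m (u ++ s :: v) = drop (m - size u).-1 v.
      rewrite drop_cat ltnNge (ltnW um) /=.
      by case: (m - size u)%N (subn_gt0 (size u) m) => [|q]; rewrite um.
    rewrite !Dr; case: (drop _ v) => [|t v']; first by rewrite scaler0 addr0.
    rewrite /splitsum scaler_sumr -big_split; apply: eq_bigr => q _ /=.
    by rewrite !Tk -!catA xm.
  + have Tk s : take m (u ++ s :: v) = take m u by rewrite takel_cat // ltnW.
    have Dr s : drop m (u ++ s :: v) = drop m u ++ s :: v by rewrite drop_cat mu.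
    rewrite !Tk !Dr; case: (drop m u) (size_drop m u) => [|t u'] su.
      by have := mu; rewrite -subn_gt0 -su.
    rewrite !cat_cons /splitsum scaler_sumr -big_split; apply: eq_bigr => q _ /=.
    by have := xm (take m u ++ [:: q.1 # 1, 1 # q.2 & u']) v c y z; rewrite -!catA.
  + rewrite -um !drop_size_cat // !take_size_cat //.
    by have := splitsum_linear cp (insert_bilinear u v xm) c y z; rewrite /=.
- move=> u v; rewrite /splitting.
  have [um|mu|um] := ltngtP (size u) m.
  + have -> : take m (u ++ 1 :: v) = u ++ 1 :: take (m - size u).-1 v.
      rewrite take_cat ltnNge (ltnW um) /=; congr (_ ++ _).
      by case: (m - size u)%N (subn_gt0 (size u) m) => [|q]; rewrite um.
    case: (drop m _) => // t v'; rewrite /splitsum big1 // => q _.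
    by rewrite -catA x1.
  + have -> : take m (u ++ 1 :: v) = take m u by rewrite takel_cat // ltnW.
    have -> : drop m (u ++ 1 :: v) = drop m u ++ 1 :: v by rewrite drop_cat mu.
    case: (drop m u) (size_drop m u) => [|t u'] su; first by have := mu; rewrite -subn_gt0 -su.
    rewrite cat_cons /splitsum big1 // => q _.
    by have := x1 (take m u ++ [:: q.1 # 1, 1 # q.2 & u']) v; rewrite -catA.
  + rewrite -um drop_size_cat // take_size_cat //=.
    have := splitsum_iota cp (insert_bilinear u v xm) 1; rewrite sharp11 => ->.
    by rewrite -cat_rcons x1.
- move=> w sw; rewrite /splitting.
  case wE : (drop m w) => [|t v] //; rewrite /splitsum big1 // => q _; apply: xs.
  have := congr1 size wE; rewrite size_drop /= => swm.
  by rewrite size_cat /= size_takel; move/eqP: sw; lia.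
move=> w sw ow; have wE : w = take m w ++ drop m w by rewrite cat_take_drop.
rewrite /splitting; case: (drop m w) wE => [|t v] // wE.
apply: (splitsum_eq0 (cp:=cp) (insert_bilinear (take m w) v xm)).
  by move=> _; rewrite -cat_rcons x1.
move=> tA a h; apply: x0.
  by have := congr1 size wE; rewrite sw !size_cat /=; lia.
apply: leq_ltn_trans ow; rewrite [in X in (_ <= X)%N]wE !out_cat out_iota leq_add2l.
by rewrite !outC tA leq_add2r leq_b1.
Qed.

(** Phi evaluates only on letters b # 1 and 1 # h, and splitting either of these inserts a letter
    1. *)
Lemma PhiX_splitting m x : x \in hs_fil cp p n.+1 -> (m < n)%N ->
  PhiX cp (splitting cp m x) = 0.
Proof.
move=> xF mn; have /hs_filP[[_ _ ss] _] := splitting_fil xF mn.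
have /hs_filP[[xm x1 xs] _] := xF.
apply/funext => h; apply/funext => a.
apply: Phi_supp => // w sw lw _; rewrite /splitting.
have wE : w = take m w ++ drop m w by rewrite cat_take_drop.
case: (drop m w) wE => // t v wE.
have /orP[/asboolP[b ->]|/asboolP[b ->]] : letter cp t.
- by move: lw; rewrite wE all_cat /= => /and3P[].
- rewrite (splitsum_iota cp (insert_bilinear (take m w) v xm)).
  by rewrite -cat_rcons x1.
- rewrite (splitsum_sharp cp (insert_bilinear (take m w) v xm)).
  by rewrite sharp11 x1.
Qed.

Section Step.
Variables (x : seq E -> M).
Hypothesis xc : gr_cocycle x.

Let xm : multilin x. Proof. by have [/hs_filP[[]]] := xc. Qed.
Let x1 : normalized x. Proof. by have [/hs_filP[[]]] := xc. Qed.
Let dxm : multilin (hochd bM x). Proof. exact: hochd_multilin. Qed.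
Let dx1 : normalized (hochd bM x). Proof. exact: hochd_normalized. Qed.

Let cocycle_split u z t v : size (u ++ z :: t :: v) = n.+1 -> (out (u ++ z :: t :: v) <= p)%N ->
  splitsum cp (fun al be => hochd bM x (u ++ z :: al :: be :: v)) t = 0.
Proof.
have [_ /hs_filP[_ dx0]] := xc; move=> sw ow.
have B := insert_bilinear (rcons u z) v dxm.
have E1 al be : hochd bM x (u ++ z :: al :: be :: v) = hochd bM x (rcons u z ++ al :: be :: v).
  by rewrite cat_rcons.
rewrite [LHS](_ : _ = splitsum cp (fun al be => hochd bM x (rcons u z ++ al :: be :: v)) t); last first.
  by apply: eq_bigr => q _; rewrite E1.
apply: (splitsum_eq0 B) => [_|tA a h]; first by rewrite -cat_rcons dx1.
apply: dx0; first by move: sw; rewrite !size_cat /= size_rcons; lia.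
rewrite ltnS; apply: leq_trans ow; rewrite cat_rcons !out_cat leq_add2l !outC in_A_iota tA.
by case: (in_A cp (1 # h)) => /=; lia.
Qed.

Let tdif_insert_bil u z v : bilinear2 (fun al be => tdif bM (fun w => x (u ++ z :: al :: w)) (be :: v)).
Proof.
have X1 w : linear (fun al => x (u ++ z :: al :: w)).
  by move=> c s t; have := xm (rcons u z) w c s t; rewrite !cat_rcons.
split=> [be|al] c s t.
  rewrite (eq_tdif bM (g' := fun w => c *: x (u ++ z :: s :: w) + x (u ++ z :: t :: w))).
    exact: tdif_lin.
  by move=> w _; exact: X1.
apply: (@tdif_multilin _ _ _ bM _ _ [::]) => u' v' d y y'.
by have := xm (u ++ z :: al :: u') v' d y y'; rewrite -!catA.
Qed.

Let new m : seq E -> M := x + (-1) ^+ m *: hochd bM (splitting cp m x).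

(* A word on which x vanishes whatever follows u. *)
Lemma step_keep u z t v :
  (forall w, size (u ++ w) = n.+1 -> (out (u ++ w) <= p)%N -> x (u ++ w) = 0) ->
  size (u ++ z :: t :: v) = n.+1 -> (out (u ++ z :: t :: v) <= p)%N ->
  new (size u) (u ++ z :: t :: v) = 0.
Proof.
move=> xu sw ow; rewrite -[LHS]/(x _ + _ *: hochd bM _ _) splitting_formula //; last exact: cocycle_split.
have sv : size (u ++ z :: t :: v) = (size u + (size v).+2)%N by rewrite size_cat.
have owE : (out u + (~~ in_A cp z + (~~ in_A cp t + out v)) <= p)%N by move: ow; rewrite out_cat !outC.
have B1 : bilinear2 (fun al be => x (u ++ z * al :: be :: v)).
  have [Bl Br] := insert_bilinear u v xm.
  by split=> [be|al] c s s'; [rewrite mulrDr -scalerAr Bl|rewrite Br].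
have t1 : splitsum cp (fun al be => x (u ++ z * al :: be :: v)) t = 0.
  apply: (splitsum_eq0 B1) => [_|tA a h]; first by rewrite -cat_rcons x1.
  apply: xu; first by rewrite -sw !size_cat.
  apply: leq_trans owE; rewrite out_cat leq_add2l tA.
  have := outside_mul (@in_AM _ _ _ _ _ _ cp) z (a # 1) ((1 # h) :: v).
  by rewrite !outC in_A_iota; case: (in_A cp (1 # h)) => /=; lia.
have t2 : splitsum cp (fun al be => tdif bM (fun w => x (u ++ z :: al :: w)) (be :: v)) t = 0.
  apply: (splitsum_eq0 (tdif_insert_bil u z v)) => [_|tA a h].
    rewrite tdif_1 ?xu ?oppr0 // => u' v'.
    by have := x1 (u ++ [:: z, t & u']) v'; rewrite -catA.
  apply: (tdif_outside bM (@in_AM _ _ _ _ _ _ cp) (i := (out ((1 # h) :: v)).+1) (n := size v)) => //.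
  move=> w swv; rewrite ltnS => owv; apply: xu.
    by rewrite -sw !size_cat /= swv.
  apply: leq_trans owE; rewrite out_cat leq_add2l !outC in_A_iota tA /=.
  by move: owv; rewrite outC; case: (in_A cp (1 # h)) => /=; lia.
have t3 : splitsum cp (fun al be => x (u ++ al :: be :: v)) (z * t) = 0.
  apply: (splitsum_eq0 (insert_bilinear u v xm)) => [_|tA a h]; first by rewrite -cat_rcons x1.
  apply: xu; first by rewrite -sw !size_cat.
  apply: leq_trans owE; rewrite out_cat leq_add2l !outC in_A_iota /=.
  have : ~~ (in_A cp z && in_A cp t) by apply: contra tA => /andP[]; exact: in_AM.
  by case: (in_A cp (1 # h)); case: (in_A cp z); case: (in_A cp t) => //= _; lia.
have t4 : tdif bM (fun w => splitsum cp (fun al be => x (u ++ al :: be :: w)) z) (t :: v) = 0.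
  apply: (tdif_outside bM (@in_AM _ _ _ _ _ _ cp) (i := (out (t :: v)).+1) (n := size v)) => //.
  move=> w swv; rewrite ltnS => owv.
  apply: (splitsum_eq0 (insert_bilinear u w xm)) => [_|zA a h]; first by rewrite -cat_rcons x1.
  apply: xu; first by rewrite -sw !size_cat /= swv.
  apply: leq_trans owE; rewrite out_cat leq_add2l !outC in_A_iota zA /=.
  by move: owv; rewrite outC; case: (in_A cp (1 # h)) => /=; lia.
by rewrite t1 t2 t3 t4 !subr0.
Qed.

(* The first merge that could involve the run of letters of A lengthens it. *)
Lemma step_shrink u d t v :
  (forall b w, size (u ++ toE d :: toE b :: w) = n.+1 ->
     (out (u ++ toE d :: toE b :: w) <= p)%N -> x (u ++ toE d :: toE b :: w) = 0) ->
  size (u ++ toE d :: t :: v) = n.+1 -> (out (u ++ toE d :: t :: v) <= p)%N ->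
  new (size u) (u ++ toE d :: t :: v) = 0.
Proof.
move=> xu sw ow; rewrite -[LHS]/(x _ + _ *: hochd bM _ _) splitting_formula //; last exact: cocycle_split.
rewrite splitsum_mul; last exact: insert_bilinear.
have owE : (out u + (~~ in_A cp t + out v) <= p)%N by move: ow; rewrite out_cat out_iota outC.
have t4 : tdif bM (fun w => splitsum cp (fun al be => x (u ++ al :: be :: w)) (d # 1)) (t :: v) = 0.
  rewrite (eq_tdif bM (g' := fun=> 0)) ?tdif_const0 // => w _.
  by rewrite (splitsum_iota cp (insert_bilinear u w xm)) -cat_rcons x1.
rewrite t4 subr0 addrAC subrr add0r.
suff -> : splitsum cp (fun al be => tdif bM (fun w => x (u ++ (d # 1) :: al :: w)) (be :: v)) t = 0.
  exact: oppr0.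
apply: (splitsum_eq0 (tdif_insert_bil u (d # 1) v)) => [/asboolP[b tE]|tA a h].
  rewrite tE tdif_1 ?xu ?oppr0 -?tE // => u' v'.
  by have := x1 (u ++ [:: d # 1, t & u']) v'; rewrite -catA.
apply: (tdif_outside bM (@in_AM _ _ _ _ _ _ cp) (i := (out ((1 # h) :: v)).+1) (n := size v)) => //.
move=> w swv; rewrite ltnS => owv; apply: xu.
  by rewrite -sw !size_cat /= swv.
apply: leq_trans owE; rewrite out_cat leq_add2l !out_iota tA /=.
by move: owv; rewrite outC; case: (in_A cp (1 # h)) => /=; lia.
Qed.

End Step.
(** A run of letters of A that reaches the end of the word leaves at most j < p letters outside
    A. *)
Lemma run_trivial x j m : gr_cocycle x -> (j < p)%N -> (n.+1 <= j + m)%N -> vanish_run j m x.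
Proof.
move=> [/hs_filP[_ x0] _] jp njm w sw _ wA; apply: x0 => //.
have dm : (size (drop j w) <= m)%N by rewrite size_drop sw leq_subLR.
rewrite -(cat_take_drop j w) out_cat.
have -> : out (drop j w) = 0%N.
  by apply/eqP; rewrite -leqn0 leqNgt -has_count has_predC; move: wA; rewrite take_oversize // => ->.
rewrite addn0; apply: leq_ltn_trans jp; apply: leq_trans (count_size _ _) _.
by rewrite size_take_min geq_minl.
Qed.

Lemma word_split m (w : seq E) : (m.+1 < size w)%N ->
  exists u z t v, w = u ++ z :: t :: v /\ size u = m.
Proof.
move=> mw; exists (take m w).
have sd : (1 < size (drop m w))%N by rewrite size_drop ltn_subRL addn1.
case dE : (drop m w) sd => [|z [|t v]] // _; exists z, t, v.
by rewrite -dE cat_take_drop size_takel // ltnW // ltnW.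
Qed.

(** The splitting takes place at position j + m, that of the last letter of a run of m + 1 letters:
    [step_keep] preserves the vanishing caused by the first j letters, and [step_shrink] uses the
    known vanishing on runs of length m + 2. *)
Lemma run_step x j m : gr_cocycle x -> (j < p)%N -> vanish_before j x ->
  vanish_run j m.+2 x ->
  exists x', [/\ kernel_reach x x', vanish_before j x' & vanish_run j m.+1 x'].
Proof.
move=> xc jp xb xr; have [njm|jmn] := leqP n.+1 (j + m.+1).
  exists x; split=> //; [exact: kernel_reach_refl|exact: run_trivial].
rewrite addnS ltnS in jmn.
have sF := splitting_fil xc.1 jmn.
exists (x + (-1) ^+ (j + m) *: hochd bM (splitting cp (j + m) x)); split.
- exists (- ((-1) ^+ (j + m) *: splitting cp (j + m) x)); split.
  + by apply: submodN; apply: rpredZ.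
  + by rewrite -scaleNr PhiX_scale PhiX_splitting ?xc.1 // scaler0.
  + by rewrite -scaleNr hochd_scale scaleNr opprK.
- move=> w sw ow wA; have [|u [z [t [v [wE su]]]]] := @word_split (j + m) w.
    by rewrite sw ltnS.
  rewrite {w}wE in sw ow wA *; rewrite -su; apply: step_keep => // w' sw' ow'.
  apply: xb => //; move: wA; rewrite !takel_cat // su leq_addr //.
- move=> w sw ow wA; have [|u [z [t [v [wE su]]]]] := @word_split (j + m) w.
    by rewrite sw ltnS.
  rewrite {w}wE in sw ow wA *.
  have ju : (j <= size u)%N by rewrite su leq_addr.
  have sd : size (drop j u) = m by rewrite size_drop su addKn.
  have dropE w' : drop j (u ++ w') = drop j u ++ w'.
    rewrite drop_cat; case: ltnP => // uj.
    have -> : j = size u by apply/eqP; rewrite eqn_leq ju uj.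
    by rewrite subnn drop_size drop0.
  have take1 z' w' : take m.+1 (drop j u ++ z' :: w') = drop j u ++ [:: z'].
    by rewrite cats1 -cat_rcons take_size_cat // size_rcons sd.
  move: wA; rewrite dropE take1 all_cat /= andbT => /andP[uA /asboolP[d zE]].
  rewrite zE in sw ow *; rewrite -su; apply: step_shrink => // b w' sw' ow'.
  apply: xr => //; rewrite dropE.
  have -> : take m.+2 (drop j u ++ toE d :: toE b :: w') = drop j u ++ [:: toE d; toE b].
    by rewrite -[[:: _, _ & w']]/([:: toE d; toE b] ++ w') catA take_size_cat // size_cat sd addn2.
  by rewrite all_cat uA /= !in_A_iota.
Qed.

End Process.

(** The run length descends from one that fills the rest of the word to 1, and a run of length 1 is
    a single letter of A at position j + 1. *)
Lemma run_all p n x j : gr_cocycle p n x -> (j < p)%N -> vanish_before p n j x ->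
  exists x', kernel_reach p n x x' /\ vanish_before p n j.+1 x'.
Proof.
move=> xc jp xb.
suff [x' [rx xb' xr]] : exists x',
    [/\ kernel_reach p n x x', vanish_before p n j x' & vanish_run p n j 1 x'].
  exists x'; split=> // w sw ow; rewrite -addn1 takeD has_cat => /orP[|wA]; first exact: xb'.
  apply: xr => //; move: wA; case: (drop j w) => [|z v] //=; rewrite take0 /=.
  by rewrite orbF andbT.
have: exists m, vanish_run p n j m.+1 x.
  by exists n; apply: run_trivial => //; exact: leq_addl.
case=> m; elim: m x xc xb => [|m IH] x xc xb xr.
  by exists x; split=> //; exact: kernel_reach_refl.
have [y [ry yb yr]] := run_step xc jp xb xr.
have [z [rz zb zr]] := IH y (gr_cocycle_reach xc ry) yb yr.
by exists z; split=> //; exact: kernel_reach_trans ry rz.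
Qed.

Lemma before_all p n x j : gr_cocycle p n x -> (j <= p)%N ->
  exists x', kernel_reach p n x x' /\ vanish_before p n j x'.
Proof.
move=> xc; elim: j => [|j IH] jp.
  by exists x; split; [exact: kernel_reach_refl|move=> w _ _; rewrite take0].
have [y [ry yb]] := IH (ltnW jp).
have [z [rz zb]] := run_all (gr_cocycle_reach xc ry) jp yb.
by exists z; split=> //; exact: kernel_reach_trans ry rz.
Qed.

(** * Balancedness over A on sorted words *)

Section Sorted.
Variables (p n : nat) (x : seq E -> M).
Hypotheses (xc : gr_cocycle p n x) (xb : vanish_before p n p x).

Let xm : multilin x. Proof. by have [/hs_filP[[]]] := xc. Qed.

Variable a : seq A.
Hypothesis sa : (p + size a)%N = n.+1.
Local Notation as_ := (map (fun b : A => toE b) a).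

Let out_as : out as_ = 0%N.
Proof. by elim: (a) => // b a' IH; rewrite map_cons out_iota. Qed.

Let x_zero u b w : size (u ++ toE b :: w) = n.+1 -> (size u < p)%N ->
  (out (u ++ toE b :: w) <= p)%N -> x (u ++ toE b :: w) = 0.
Proof.
move=> sw up ow; apply: xb => //.
rewrite take_cat ltnNge (ltnW up) /= has_cat; apply/orP; right.
by case: (p - size u)%N (subn_gt0 (size u) p) => [|q]; rewrite up //= in_A_iota.
Qed.

Let dx_zero w : size w = n.+2 -> (out w <= p)%N -> hochd bM x w = 0.
Proof. by have [_ /hs_filP[_ dx0]] := xc => sw ow; apply: dx0. Qed.

Let out_le w : (out (w ++ as_) <= size w)%N.
Proof. by rewrite out_cat out_as addn0 count_size. Qed.

Let size_as w : size (w ++ as_) = (size w + size a)%N.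
Proof. by rewrite size_cat size_map. Qed.

(** Cocycle condition at the word with b # 1 put in front: the faces that keep b vanish by [xb], so
    the action of b and its merge with y agree. *)
Let push_head b y v : (size v).+1 = p ->
  lact bM (toE b) (x (y :: v ++ as_)) = x (toE b * y :: v ++ as_).
Proof.
move=> sv; have sy : size (y :: v ++ as_) = n.+1 by rewrite /= size_as -sa -sv.
have oy : (out (y :: v ++ as_) <= p)%N by rewrite -sv; exact: (out_le (y :: v)).
have := @dx_zero (toE b :: y :: v ++ as_).
rewrite out_iota hochd_cons tdif_cons (tdif_outside bM (@in_AM _ _ _ _ _ _ cp) (i := p.+1) (n := n)) //.
  by rewrite subr0 => D; apply/eqP; rewrite -subr_eq0 D //= -sy.
move=> w sw ow; apply: (x_zero (u := [::])).
- by rewrite /= sw.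
- by rewrite -sv.
- by rewrite cat0s out_iota.
Qed.

(** Here b # 1 is inserted between y and z. Every face except its merges with y and with z keeps it
    among the first p letters, hence vanishes. *)
Let push_tail u y b z v : (size u + size v).+2 = p ->
  x (u ++ y * toE b :: z :: v ++ as_) = x (u ++ y :: toE b * z :: v ++ as_).
Proof.
move=> sv.
have sz : size (u ++ y :: toE b :: z :: v ++ as_) = n.+2.
  by rewrite size_cat /= size_as -sa -sv !addnS addnA.
have up : (size u < p)%N by rewrite -sv ltnS leqW // leq_addr.
have up' : ((size u).+1 < p)%N by rewrite -sv !ltnS leq_addr.
have zero w w' b' : size w = size u -> size (w ++ toE b' :: w') = n.+1 ->
    (out w' <= (size v).+2)%N -> x (w ++ toE b' :: w') = 0.
  move=> sw sw' ow; apply: x_zero; rewrite ?sw // out_cat out_iota -sv -!addnS.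
  by apply: leq_add => //; rewrite -sw count_size.
have ov : (out (z :: v ++ as_) <= (size v).+1)%N by exact: (out_le (z :: v)).
have oy : (out (u ++ y :: toE b :: z :: v ++ as_) <= p)%N.
  rewrite -cat_rcons out_cat out_iota -sv -addSn -addnS leq_add //.
  by rewrite -(size_rcons u y) count_size.
have := dx_zero sz oy; rewrite hochd_cat !tdif_cons => D.
have f0 : facesl bM x (rcons u y) (toE b :: z :: v ++ as_) = 0.
  have sz' : size (u ++ toE b :: z :: v ++ as_) = n.+1.
    by apply: succn_inj; rewrite -sz !size_cat /= !addnS.
  rewrite /facesl (eq_mergesum (g' := fun=> 0)) ?mergesum0 ?addr0; last first.
    move=> w; rewrite size_rcons => -[sw]; apply: zero => //; last exact: leqW.
    by rewrite -sz' !size_cat sw.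
  case rE : (rcons u y) (size_rcons u y) => [|e w] // [sw].
  by rewrite zero ?linear0r //; [rewrite -sz' !size_cat sw|exact: leqW].
have t0 : tdif bM (fun w => x (u ++ y :: toE b :: w)) (z :: v ++ as_) = 0.
  apply: (tdif_outside bM (@in_AM _ _ _ _ _ _ cp) (i := (size v).+2) (n := size (v ++ as_))) => //.
  move=> w sw; rewrite ltnS => ow; rewrite -cat_rcons; apply: x_zero; rewrite ?size_rcons //.
    by apply: succn_inj; rewrite cat_rcons -sz !size_cat /= sw size_cat !addnS.
  rewrite out_cat out_iota -sv -addSn -addnS leq_add //.
  by rewrite -(size_rcons u y) count_size.
move: D; rewrite f0 t0 subr0 add0r opprK => D.
have D1 : - x (u ++ y * toE b :: z :: v ++ as_) + x (u ++ y :: toE b * z :: v ++ as_) = 0.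
  by rewrite -[LHS]scale1r -(sqrr_sign _ (size u)) expr2 -scalerA D scaler0.
by apply/eqP; rewrite -subr_eq0 -oppr_eq0 opprB addrC D1.
Qed.

(** An extra first letter e acting on the value supplies the argument in E that [NF_universal]
    needs; the cochain itself is recovered at e = 1. *)
Let tensored (w : seq E) : M :=
  if size w == p.+1 then (if w is e :: v then lact bM e (x (v ++ as_)) else 0) else 0.

Let tensored_balanced : balanced cp tensored.
Proof.
split=> [u v c y z|u y b z v]; rewrite /tensored !size_cat /=.
  case: ifP => _; last by rewrite scaler0 addr0.
  case: u => [|e u] /=; first exact: linearPl.
  by rewrite -!catA !cat_cons xm linearPr.
case: ifP => // /eqP sw; case: u sw => [|e u] /= sw.
  by rewrite lactA push_head //; case: sw.
by rewrite -!catA !cat_cons push_tail //; move: sw; rewrite !addSn !addnS => -[].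
Qed.

Lemma sorted_zero : (forall h, size h = p -> x (ones h ++ as_) = 0) ->
  forall w, size w = p -> x (w ++ as_) = 0.
Proof.
move=> x0 w sw; have := NF_universal 1 w tensored_balanced.
rewrite [X in _ = X]/tensored /= sw eqxx lact1 => <-.
rewrite big1 // => q _; rewrite /tensored /= size_map.
by case: eqP => // -[sq]; rewrite x0 // linear0r.
Qed.

End Sorted.

Lemma in_A_words v : all (in_A cp) v -> exists a, v = map (fun b => toE b) a.
Proof.
elim: v => [|y v IH] /=; first by exists [::].
by move=> /andP[/asboolP[b ->] /IH[a ->]]; exists (b :: a).
Qed.

(** By [Phi_lead], the value of Phi x at (h, a) with size h = p is, up to sign, that of x on the
    sorted word; its vanishing is the hypothesis of [sorted_zero]. *)
Lemma sorted_next p n x : gr_cocycle p n x -> vanish_before p n p x ->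
  PhiX cp x \in xfil (H := H) (A := A) p.+1 n.+1 -> x \in hs_fil cp p.+1 n.+1.
Proof.
move=> xc xb /asboolP[_ _ Phi0]; have [xh x0] := hs_filP _ _ _ _ xc.1.
apply/hs_filP; split=> // w sw; rewrite ltnS leq_eqVlt => /orP[/eqP ow|]; last exact: x0.
have [wA|wA] := boolP (has (in_A cp) (take p w)); first by apply: xb => //; rewrite ow.
have pw : size (take p w) = p.
  by rewrite size_takel // -ow; exact: count_size.
have tA : out (take p w) = p.
  have := wA; rewrite -all_predC => /all_filterP wE.
  by rewrite /outside -size_filter wE.
have dA : all (in_A cp) (drop p w).
  have := ow; rewrite -{1}(cat_take_drop p w) out_cat tA -[in RHS](addn0 p).
  move/addnI/eqP; rewrite -leqn0 leqNgt -has_count has_predC negbK; exact: id.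
have [a aE] := in_A_words dA.
have sa : (p + size a)%N = n.+1.
  by rewrite -sw -[in RHS](cat_take_drop p w) size_cat pw aE size_map.
rewrite -(cat_take_drop p w) aE; apply: (sorted_zero xc xb sa) => // h sh.
have := Phi0 h a; rewrite /PhiX sh ltnn => /(_ isT).
rewrite (Phi_lead (n := (p + size a)%N)) ?sh ?sa // => E0.
by rewrite -[LHS]scale1r -(sqrr_sign _ (size a * p)) expr2 -scalerA E0 scaler0.
Qed.

Theorem kernel_acyclicity p n x : x \in hs_fil cp p n ->
  hochd bM x \in hs_fil cp p.+1 n.+1 -> PhiX cp x \in xfil (H := H) (A := A) p.+1 n ->
  exists t, [/\ if n is m.+1 then t \in hs_fil cp p m else t = 0, PhiX cp t = 0 &
    x - hochd bM t \in hs_fil cp p.+1 n].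
Proof.
case: n => [|n] xF dxF PF.
  (* In degree 0 the only available t is 0, and it suffices because Phi x at the empty words is x at
     the empty word. *)
  exists 0; split=> //; first exact: linear0.
  rewrite linear0 subr0; have [xh x0] := hs_filP _ _ _ _ xF.
  apply/hs_filP; split=> // w /size0nil -> _.
  have /asboolP[_ _ P0] := PF.
  by have := P0 [::] [::] isT.
have [y [[t [tF t0 yE]] yb]] := before_all (conj xF dxF) (leqnn p).
exists t; split=> //; rewrite -yE.
have yc : gr_cocycle p n y by apply: gr_cocycle_reach (conj xF dxF) _; exists t.
apply: sorted_next => //.
have xm : multilin t by have [[]] := hs_filP _ _ _ _ tF.
by rewrite yE raddfB /= PhiX_hochd // t0 linear0 subr0.
Qed.

End Kernel.

(** * The first page *)

Section FirstPage.
Context {k : comNzRingType} {H : hopfAlgType k} {A : algType k}.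
Context {act : weak_action H A} {f : {linear tensor H H -> A}} {E : algType k}.
Variable cp : crossed_product act f E.
Context {M : lmodType k} (bM : bimodule E M).
Local Notation XH := (xhat cp bM).

Section Complex.
Let cE := hs_is_filtered_complex cp bM.
Let X0 n : fil XH 0 n =i cdeg XH n. Proof. by []. Qed.
Let XS i n : {subset fil XH i.+1 n <= fil XH i n}. Proof. exact: xfilS. Qed.
Let Phi : {linear cmod (hochschild_serre cp bM) -> cmod XH} := PhiX cp (M := M).
Let PhiF p n x : x \in fil (hochschild_serre cp bM) p n -> Phi x \in fil XH p n.
Proof. exact: PhiX_fil. Qed.
Let PhiS p n y : y \in fil XH p n ->
  exists2 x, x \in fil (hochschild_serre cp bM) p n & Phi x = y.
Proof. exact: PhiX_surj. Qed.
Let Phid n x : x \in cdeg (hochschild_serre cp bM) n -> Phi (hochd bM x) = xdif cp bM (Phi x).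
Proof. by move=> /asboolP[xm _ _]; exact: PhiX_hochd. Qed.

Lemma xhat_is_filtered_complex : is_filtered_complex XH.
Proof. exact: (surj_is_filtered_complex cE X0 XS PhiF PhiS Phid). Qed.

Lemma hochschild_serre_sseq_iso (cX : is_filtered_complex XH) : sseq_iso cE cX.
Proof. exact: (surj_sseq_iso cE X0 XS PhiF PhiS Phid (kernel_acyclicity (bM := bM))). Qed.

Lemma xhat_converges (cX : is_filtered_complex XH) : converges cX (HH bM).
Proof.
have Kn p n x : (n < p)%N -> x \in fil (hochschild_serre cp bM) p n -> x = 0.
  exact: hs_fil_big.
exact: (surj_converges cE XS PhiF PhiS Phid (kernel_acyclicity (bM := bM)) Kn cX).
Qed.
End Complex.

(** * One column of the first page *)

Section Degree.
Variable s : nat.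
Local Notation hb := (hom_bimodule cp bM s).
Local Notation HM := (redhom H M s).
Implicit Types (x y : seq H -> seq A -> M) (g : seq A -> HM).

Definition restricts x g := forall h a, size h = s -> val (g a) h = x h a.

Lemma redhom_eq0 (u : HM) h : size h <> s -> val u h = 0.
Proof. by move=> hs; have /asboolP[_ _ us] := valP u; apply: us; apply/eqP. Qed.

Lemma redhom_eq (u v : HM) : (forall h, size h = s -> val u h = val v h) -> u = v.
Proof.
move=> uv; apply: val_inj; apply/funext => h.
by have [/uv|/eqP hs] := eqVneq (size h) s; last by rewrite !redhom_eq0.
Qed.

Lemma restricts_lin c x y g g' : restricts x g -> restricts y g' ->
  restricts (c *: x + y) (c *: g + g').
Proof. by move=> xg yg h a hs; rewrite -[LHS]/(c *: val (g a) h + val (g' a) h) xg ?yg. Qed.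

Lemma hochd_restricts x g h a : restricts x g -> size h = s ->
  val (hochd hb g a) h = xd0 cp bM x h a.
Proof.
move=> xg hs; case: a => [|a1 a] //.
rewrite /hochd /hochd_fun /xd0.
set n := size (a1 :: a).
pose ev (u : HM) : M := val u h.
have ev_sum (F : nat -> HM) (r : seq nat) : ev (\sum_(i <- r) F i) = \sum_(i <- r) ev (F i).
  by elim/big_rec2: _ => // i _ u _ <-.
have evE b : ev (g b) = x h b by exact: xg.
rewrite -[LHS]/(ev _ + ev (\sum_(_ <- _) _) + _ *: ev _) ev_sum addrAC; congr (_ + _ + _).
- apply: eq_big_seq => p /wsw_size sp; by rewrite xg // sp.
- rewrite -[ev _]/(ract bM (ev _) _) evE -[last a1 a](nth_last 0 (a1 :: a)).
  by [].
- by apply: eq_bigr => i _; rewrite -[LHS]/(_ *: ev (g _)) evE.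
Qed.

Definition low x := forall h a, (size h < s)%N -> x h a = 0.

(** For l > 0 the component d_l evaluates x on words over H with fewer than s letters. *)
Lemma xdif_low x h a : low x -> size h = s -> xdif cp bM x h a = xd0 cp bM x h a.
Proof.
move=> x0 hs; have f0 h' t : (size h' < s)%N -> feval (x h') t = 0.
  by move=> h's; rewrite /feval big1 // => q _; rewrite x0 // scaler0.
rewrite /xdif /xdif_fun big_nat big1 ?addr0 => [|l /andP[l2 ls]]; last first.
  rewrite /xdl big1 ?scaler0 // => p _; rewrite f0 ?linear0l //.
  by rewrite size_take_min; apply: leq_ltn_trans (geq_minl _ _) _; rewrite hs; lia.
suff -> : xd1 cp bM x h a = 0 by rewrite addr0.
case: h hs => [|h1 h'] //= hs.
have ls : (size h' < s)%N by rewrite -hs.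
rewrite x0 // linear0r scaler0 add0r big1 ?scaler0 ?add0r => [|q _]; last first.
  by rewrite f0 ?linear0l // size_take_min; exact: leq_ltn_trans (geq_minl _ _) ls.
rewrite big_nat big1 // => i ih; rewrite big_seq big1 ?scaler0 // => c ch.
have := contract_size (h := h1 :: h') ih ch => -[sc].
by rewrite x0 ?linear0r // sc.
Qed.

Definition extend g : seq H -> seq A -> M := fun h a => val (g a) h.

Lemma extend_restricts g : restricts (extend g) g.
Proof. by []. Qed.

Lemma xfil_low i x : x \in xfil s i -> low x.
Proof.
move=> /asboolP[_ _ x0] h a hs; apply: x0; by rewrite negb_and -ltnNge hs.
Qed.

Lemma xfil_next i x : x \in xfil s i -> (forall h a, size h = s -> x h a = 0) ->
  x \in xfil s.+1 i.
Proof.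
move=> /asboolP[xh xa x0] xs; apply/asboolP; split=> // h a.
rewrite negb_and -leqNgt leq_eqVlt -orbA => /or3P[/eqP/xs //|hs|hs]; apply: x0.
  by rewrite negb_and -ltnNge hs.
by rewrite negb_and hs orbT.
Qed.

Lemma extend_fil r g : g \in homset r -> extend g \in xfil s (r + s).
Proof.
move=> /asboolP[gm g1 gs]; apply/asboolP; split=> [a|h|h a].
- by have /asboolP[] := valP (g a).
- split=> [u v c y z|u v].
    by rewrite /extend gm.
  by rewrite /extend g1.
rewrite negb_and -ltnNge => hs; rewrite /extend.
have [hE|/eqP hE] := eqVneq (size h) s; last exact: redhom_eq0.
rewrite gs //; move: hs; rewrite hE ltnn addnC eqn_add2r; exact: id.
Qed.

Lemma restricts_exists r x : x \in xfil s (r + s) ->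
  exists2 g : seq A -> HM, g \in homset r & restricts x g.
Proof.
move=> /asboolP[xh xa x0].
pose v a h := if size h == s then x h a else 0.
have vP a : v a \in homset s.
  have [xm x1] := xh a; apply/asboolP; split=> [u w c y z|u w|h hs]; rewrite /v.
  - by rewrite !size_cat /=; case: ifP => _; rewrite ?xm // scaler0 addr0.
  - by rewrite x1 if_same.
  - by rewrite (negPf hs).
exists (fun a => Submod (vP a)); last by move=> h a hs; rewrite /= /v hs eqxx.
apply/asboolP; split=> [u w c y z|u w|a ar]; apply: redhom_eq => h hs.
- rewrite -[RHS]/(c *: v _ h + v _ h) /= /v hs eqxx; exact: (xa h).1.
- by rewrite /= /v hs eqxx (xa h).2.
- by rewrite /= /v hs eqxx x0 // negb_and addnC hs eqn_add2r ar orbT.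
Qed.

Section Page.
Variable r : nat.
Hypothesis cX : is_filtered_complex XH.
Local Notation Z := (Zpage XH 1 s (r + s)%N).
Local Notation B := (Bpage XH 1 s (r + s)%N).
Local Notation Z' := (cocycle (hochschild hb) r).
Local Notation B' := (coboundary (hochschild hb) r).

Lemma Zpage_restricts x : x \in Z -> exists2 g, g \in Z' & restricts x g.
Proof.
move=> /andP[Fx]; rewrite addn1 => /asboolP[_ _ dx0].
have [g gr xg] := restricts_exists Fx; exists g => //.
apply/andP; split=> //; apply/eqP/funext => a; apply: redhom_eq => h hs.
rewrite (hochd_restricts a xg hs) -(xdif_low a (xfil_low Fx) hs) dx0 //.
by rewrite hs ltnn.
Qed.

(** The summand z of F_(s+1) has no component in column s, and y in F_s contributes to it through
    d_0 alone, which is the Hochschild differential of A. *)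
Lemma Bpage_restricts x g : x \in B -> restricts x g -> g \in B'.
Proof.
move=> /asboolP[z [y [-> zF _ yF dyF]]] xg.
have [/asboolP[_ _ z0] /asboolP[_ _ dy0]] := (zF, dyF).
rewrite subn1 /= in yF.
have yl : low y.
  by case: (r + s)%N yF => [-> //|m]; exact: xfil_low.
have gE a h : size h = s -> val (g a) h = xd0 cp bM y h a.
  by move=> hs; rewrite xg // -(xdif_low a yl hs) -[LHS]/(z h a + _) z0 ?add0r // hs ltnn.
have g0 a : size a != r -> g a = 0.
  move=> ar; apply: redhom_eq => h hs; rewrite gE // -(xdif_low a yl hs) dy0 //.
  by rewrite negb_and addnC hs eqn_add2r ar orbT.
apply/asboolP; case: (r) yF g0 => [|r'] yF g0.
  apply/funext => a; case: (eqVneq (size a) 0%N) => [/size0nil ->|/g0//].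
  by apply: redhom_eq => h hs; rewrite gE.
have [g' g'r yg'] := restricts_exists yF; exists g' => //.
by apply/funext => a; apply: redhom_eq => h hs; rewrite gE // -(hochd_restricts a yg' hs).
Qed.

Lemma extend_Zpage g : g \in Z' -> extend g \in Z.
Proof.
move=> /andP[gr /eqP dg]; have eF := extend_fil gr.
apply/andP; split=> //; rewrite addn1; apply: xfil_next; first exact: (cdif_fil cX).
move=> h a hs; rewrite -[LHS]/(xdif cp bM _ h a) (xdif_low a (xfil_low eF) hs).
by rewrite -(hochd_restricts a (@extend_restricts g) hs) -[hochd hb g]/(cdif (hochschild hb) g) dg.
Qed.

(** A primitive of g, extended by zero to the other columns, serves as y; then x - d y vanishes in
    column s and so lies in F_(s+1). For r = 0 the only coboundary is 0 and y = 0. *)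
Lemma Bpage_of_coboundary x g : x \in Z -> restricts x g -> g \in B' -> x \in B.
Proof.
move=> /andP[xF]; rewrite addn1 => dxF xg /asboolP gB.
have [y [yF dyF ddy xyE]] : exists y,
    [/\ if (r + s)%N is m.+1 then y \in fil XH s m else y = 0,
        xdif cp bM y \in fil XH s (r + s)%N, xdif cp bM (xdif cp bM y) = 0 &
        forall h a, size h = s -> x h a = xdif cp bM y h a].
  case: (r) gB xF => [gB _|r' [g' g'r gB] _].
    have d0 : xdif cp bM 0 = 0 by exact: (raddf0 (cdif XH)).
    exists 0; rewrite d0 d0; split=> //; [|exact: rpred0|].
      by case: (0 + s)%N => // m; exact: rpred0.
    by move=> h a hs; rewrite -xg // gB.
  have eF := extend_fil g'r; exists (extend g'); split=> //.
  - exact: (cdif_fil cX eF).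
  - apply: (cdifK cX (n := (r' + s)%N)); rewrite -(fil0 cX).
    exact: (fil_le (filS cX) (leq0n s) eF).
  - move=> h a hs; rewrite -xg // gB (xdif_low a (xfil_low eF) hs).
    exact: (hochd_restricts a (@extend_restricts g') hs).
apply/asboolP; exists (x - xdif cp bM y), y; rewrite subrK subn1 addn1; split=> //.
- apply: xfil_next => [|h a hs]; first exact: submodB.
  by rewrite -[LHS]/(x h a - xdif cp bM y h a) xyE // subrr.
- by rewrite raddfB /= ddy subr0.
Qed.

Lemma first_page : exists2 theta : {linear page XH 1 s (r + s)%N -> HH hb r},
  bijective theta &
  forall x g (Zx : x \in Z) (Zg : g \in Z'), restricts x g -> theta (pcls Zx) = subcls B' Zg.
Proof.
have RB x g : x \in Z -> x \in B -> restricts x g -> g \in B' by move=> _; exact: Bpage_restricts.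
have [theta thetaE] := @subquo_map_exists _ (cmod XH) (cmod (hochschild hb)) Z B Z' B'
  restricts restricts_lin Zpage_restricts RB.
exists theta => //.
apply: (@subquo_map_bij _ (cmod XH) (cmod (hochschild hb)) Z B Z' B'
  restricts restricts_lin Zpage_restricts RB theta thetaE).
- move=> g Zg; exists (extend g); first exact: extend_Zpage.
  by exists g => //; rewrite subrr; exact: rpred0.
- exact: Bpage_of_coboundary.
Qed.

End Page.
End Degree.
End FirstPage.

Theorem theorem2p2p2p2 (k : comNzRingType) (H : hopfAlgType k) (A : algType k)
    (act : weak_action H A) (f : {linear tensor H H -> A}) (E : algType k)
    (cp : crossed_product act f E) (M : lmodType k) (bM : bimodule E M) :
  exists (cE : is_filtered_complex (hochschild_serre cp bM))
         (cX : is_filtered_complex (xhat cp bM)),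
  [/\ sseq_iso cE cX,
      forall r s : nat,
        exists2 theta : {linear page (xhat cp bM) 1 s (r + s)%N
                                -> HH (hom_bimodule cp bM s) r},
          bijective theta &
          forall (x : seq H -> seq A -> M) (Zx : x \in Zpage (xhat cp bM) 1 s (r + s)%N)
                 (g : seq A -> redhom H M s)
                 (Zg : g \in cocycle (hochschild (hom_bimodule cp bM s)) r),
            (forall h a, size h = s -> val (g a) h = x h a) ->
            theta (pcls Zx)
            = subcls (coboundary (hochschild (hom_bimodule cp bM s)) r) Zg
    & converges cX (HH bM)].
Proof.
exists (hs_is_filtered_complex cp bM), (xhat_is_filtered_complex cp bM); split.
- exact: hochschild_serre_sseq_iso.
- move=> r s; have [theta tb tE] := first_page s r (xhat_is_filtered_complex cp bM).
  by exists theta => // x Zx g Zg xg; exact: tE.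
- exact: xhat_converges.
Qed.
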